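(* Let $n\ge 2$ and let $\gamma$ be a Coxeter element in $D_n$. The poset group $\Gamma(D_n,\gamma)$ is isomorphic to the Artin group $A(D_n)$.
   Context: $D_n$ is the finite reflection group in $O(n)$ generated by the reflections in the hyperplanes $x_i=x_j$ and $x_i=-x_j$ ($i\neq j$); these are all its reflections. Its elements act as permutations of $\{\pm e_1,\dots,\pm e_n\}$ commuting with negation. All Coxeter elements of $D_n$ are conjugate; one of them is $\gamma_D=[1][2,3,\dots,n]$, where $[i_1,\dots,i_k]$ denotes the cycle $(i_1,\dots,i_k,-i_1,\dots,-i_k)$ on the indices. For a finite reflection group $W$ with identity $I$, the reflection length $l(w)$ is the least $k$ such that $w$ is a product of $k$ reflections of $W$, and $u\le w$ means $l(w)=l(u)+l(u^{-1}w)$; this is a partial order on $W$. For $\gamma\in W$, write $(I,\gamma]$ for the set of $w\in W$ with $w\le\gamma$, $w\ne I$. The poset group $\Gamma(W,\gamma)$ is the group with one generator $\{w\}$ for each $w\in(I,\gamma]$ and with relations $\{w_1\}\{w_2\}=\{w_3\}$ for all $w_1,w_2,w_3\in(I,\gamma]$ with $w_1\le w_3$ and $w_2=w_1^{-1}w_3$. The Artin group $A(D_n)$ has generators $x_1,\dots,x_n$ and relations (whenever the generators involved exist) $x_1x_2=x_2x_1$; $x_1x_3x_1=x_3x_1x_3$; $x_1x_i=x_ix_1$ for $i\ge4$; $x_ix_{i+1}x_i=x_{i+1}x_ix_{i+1}$ for $1<i<n$; $x_ix_j=x_jx_i$ for $|j-i|\ge2$ and $i,j\neq1$. *)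

(* Defs.v *)
From HB Require Import structures.
From mathcomp Require Import all_boot all_order all_algebra.
From mathcomp Require Import generic_quotient.
From mathcomp Require Import boolp classical_sets reals.

Set Implicit Arguments.
Unset Strict Implicit.
Unset Printing Implicit Defensive.

Import GRing.Theory.

Local Open Scope classical_set_scope.
Local Open Scope ring_scope.
Local Open Scope quotient_scope.

(** Groups given by generators and relations.  The letter [(x, false)] stands
    for the generator [x] and [(x, true)] for its inverse.  A presentation is
    given by relations [u = v] between positive words, i.e. words in the
    generators themselves. *)

Section Presentation.
Variables (X : choiceType) (rels : seq X -> seq X -> Prop).

Definition word := seq (X * bool).

Definition positive_word (u : seq X) : word := [seq (x, false) | x <- u].

Definition inv_word (u : word) : word := rev [seq (a.1, ~~ a.2) | a <- u].

Inductive word_eq : word -> word -> Prop :=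
| word_eq_refl u : word_eq u u
| word_eq_sym u v : word_eq u v -> word_eq v u
| word_eq_trans u v w : word_eq u v -> word_eq v w -> word_eq u w
| word_eq_cat u u' v v' :
    word_eq u u' -> word_eq v v' -> word_eq (u ++ v) (u' ++ v')
| word_eq_cancel x b : word_eq [:: (x, b); (x, ~~ b)] [::]
| word_eq_rel u v : rels u v -> word_eq (positive_word u) (positive_word v).

Definition word_eqb (u v : word) : bool := `[< word_eq u v >].

Lemma word_eqb_refl : reflexive word_eqb.
Proof. by move=> u; apply/asboolP; exact: word_eq_refl. Qed.

Lemma word_eqb_sym : symmetric word_eqb.
Proof.
by move=> u v; apply/asboolP/asboolP; exact: word_eq_sym.
Qed.

Lemma word_eqb_trans : transitive word_eqb.
Proof.
move=> v u w /asboolP uv /asboolP vw.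
by apply/asboolP; exact: word_eq_trans uv vw.
Qed.

Canonical word_equiv := EquivRel word_eqb
  word_eqb_refl word_eqb_sym word_eqb_trans.

Definition presented := {eq_quot word_equiv}.

HB.instance Definition _ := Choice.on presented.

Definition word_class (u : word) : presented := \pi u.
Definition class_word (a : presented) : word := repr a.

Definition pres_one : presented := word_class [::].
Definition pres_mul (a b : presented) : presented :=
  word_class (class_word a ++ class_word b).
Definition pres_inv (a : presented) : presented :=
  word_class (inv_word (class_word a)).

Lemma word_classK (a : presented) : word_class (class_word a) = a.
Proof. exact: reprK. Qed.

Lemma word_classP (u v : word) : word_class u = word_class v <-> word_eq u v.
Proof.
by split=> [/eqmodP/asboolP|uv]; last by apply/eqmodP/asboolP.
Qed.

Lemma word_class_cat (u v : word) :
  word_class (u ++ v) = pres_mul (word_class u) (word_class v).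
Proof.
apply/word_classP/word_eq_cat; apply/word_classP; by rewrite word_classK.
Qed.

Lemma cat_inv_word (u : word) : word_eq (u ++ inv_word u) [::].
Proof.
elim: u => [|[x b] u IH]; first exact: word_eq_refl.
rewrite /inv_word /= rev_cons -cats1 -/(inv_word u).
apply: word_eq_trans (word_eq_cancel x b).
suff E : word_eq (u ++ (inv_word u ++ [:: (x, ~~ b)])) [:: (x, ~~ b)].
  exact: word_eq_cat (word_eq_refl [:: (x, b)]) E.
by rewrite catA; exact: word_eq_cat IH (word_eq_refl [:: (x, ~~ b)]).
Qed.

Lemma inv_wordK : involutive inv_word.
Proof.
move=> u; rewrite /inv_word map_rev revK -map_comp -[RHS]map_id.
by apply: eq_map => -[x b]; rewrite /= negbK.
Qed.

Lemma pres_mulA : associative pres_mul.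
Proof.
move=> a b c; rewrite -(word_classK a) -(word_classK b) -(word_classK c).
by rewrite -!word_class_cat catA.
Qed.

Lemma pres_mul1 : left_id pres_one pres_mul.
Proof. by move=> a; rewrite -(word_classK a) -word_class_cat. Qed.

Lemma pres_mulr1 : right_id pres_one pres_mul.
Proof. by move=> a; rewrite -(word_classK a) -word_class_cat cats0. Qed.

Lemma pres_mulV : left_inverse pres_one pres_inv pres_mul.
Proof.
move=> a; rewrite -[X in pres_mul _ X]word_classK -word_class_cat.
apply/word_classP; rewrite -{2}[class_word a]inv_wordK.
exact: cat_inv_word.
Qed.

Lemma pres_mulrV : right_inverse pres_one pres_inv pres_mul.
Proof.
move=> a; rewrite -[X in pres_mul X _]word_classK -word_class_cat.
apply/word_classP; exact: cat_inv_word.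
Qed.

HB.instance Definition _ := isGroup.Build presented
  pres_mulA pres_mul1 pres_mulr1 pres_mulV pres_mulrV.

End Presentation.

Definition isomorphic (G H : groupType) : Prop :=
  exists f : {multiplicative G -> H}, bijective f.

(** Finite reflection groups, as sets [W] of real [n x n] matrices acting on
    column vectors. *)

Section ReflectionGroups.
Variables (R : realType) (n : nat).
Implicit Types (W S : set 'M[R]_n) (u v w g : 'M[R]_n) (a : 'cV[R]_n).

(* Orthogonal reflection in the hyperplane a^perp (for a != 0):
   x |-> x - 2 <x, a> / <a, a> a. *)
Definition reflmx a : 'M[R]_n :=
  1%:M - (2 / (a^T *m a) 0 0) *: (a *m a^T).

Definition mxgroup W : Prop :=
  [/\ W 1%:M, forall u v, W u -> W v -> W (u *m v)
    & forall u, W u -> W (invmx u)].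

Definition mxgenerated S : set 'M[R]_n := smallest mxgroup S.

(* Nonzero normals to the reflecting hyperplanes of W.  They are not
   normalised: [simple_system] is insensitive to positive rescaling. *)
Definition root_vectors W : set 'cV[R]_n := [set a | a != 0 /\ W (reflmx a)].

Definition reflections W : set 'M[R]_n := [set reflmx a | a in root_vectors W].

Definition mxprod (s : seq 'M[R]_n) : 'M[R]_n := \big[mulmx/1%:M]_(r <- s) r.

Definition refl_product W k w : Prop :=
  exists s : seq 'M[R]_n,
    [/\ size s = k, forall r, r \in s -> reflections W r & w = mxprod s].

(* The junk value 0 is taken only when w is not a product of reflections
   of W, which does not happen for w in a reflection group W. *)
Definition refl_length W w : nat :=
  xget 0%N [set k | refl_product W k w /\
                    forall j, refl_product W j w -> (k <= j)%N].

Definition refl_le W u w : Prop :=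
  [/\ W u, W w
    & refl_length W w = (refl_length W u + refl_length W (invmx u *m w))%N].

(* The half-open interval (I, g]. *)
Definition poset_interval W g : set 'M[R]_n := [set w | refl_le W w g /\ w <> 1%:M].

Definition poset_rel W g (l r : seq (poset_interval W g)) : Prop :=
  exists w1 w2 w3 : poset_interval W g,
    [/\ refl_le W (val w1) (val w3),
        val w2 = invmx (val w1) *m val w3,
        l = [:: w1; w2] & r = [:: w3]].

Definition poset_group W g : groupType := presented (@poset_rel W g).

(* A simple system, with a chosen order of its elements. *)
Definition simple_system W (s : seq 'cV[R]_n) : Prop :=
  [/\ free s, forall a, a \in s -> root_vectors W a
    & forall a, root_vectors W a ->
      exists c : 'I_(size s) -> R,
        a = \sum_i c i *: s`_i /\
        ((forall i, 0 <= c i) \/ (forall i, c i <= 0))].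

Definition coxeter_element W g : Prop :=
  exists2 s, simple_system W s & g = mxprod (map reflmx s).

Definition basis_vec (i : 'I_n) : 'cV[R]_n := delta_mx i 0.

Definition groupD : set 'M[R]_n :=
  mxgenerated [set r | exists i j : 'I_n, i != j /\
    (r = reflmx (basis_vec i - basis_vec j) \/
     r = reflmx (basis_vec i + basis_vec j))].

End ReflectionGroups.

Arguments groupD : clear implicits.

(** The Artin group A(D_n): the ordinal [i : 'I_n] stands for the generator
    x_(i+1), so that the subscripts below are those of x. *)

Definition commute_rel (X : Type) (x y : X) (l r : seq X) : Prop :=
  l = [:: x; y] /\ r = [:: y; x].

Definition braid_rel (X : Type) (x y : X) (l r : seq X) : Prop :=
  l = [:: x; y; x] /\ r = [:: y; x; y].

Inductive artinD_rel (n : nat) : seq 'I_n -> seq 'I_n -> Prop :=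
| artinD_12 (i j : 'I_n) l r :
    i.+1 = 1%N -> j.+1 = 2%N -> commute_rel i j l r -> artinD_rel l r
| artinD_13 (i j : 'I_n) l r :
    i.+1 = 1%N -> j.+1 = 3%N -> braid_rel i j l r -> artinD_rel l r
| artinD_1i (i j : 'I_n) l r :
    i.+1 = 1%N -> (4 <= j.+1)%N -> commute_rel i j l r -> artinD_rel l r
| artinD_braid (i j : 'I_n) l r :
    (1 < i.+1 < n)%N -> j.+1 = i.+2 -> braid_rel i j l r -> artinD_rel l r
| artinD_comm (i j : 'I_n) l r :
    i.+1 <> 1%N -> j.+1 <> 1%N -> (i.+1 + 2 <= j.+1)%N \/ (j.+1 + 2 <= i.+1)%N ->
    commute_rel i j l r -> artinD_rel l r.

Definition artinD (n : nat) : groupType := presented (@artinD_rel n).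

(* Main.v *)
Require Import Defs.
From HB Require Import structures.
From mathcomp Require Import all_boot all_order all_algebra.
From mathcomp Require Import boolp classical_sets reals.
From mathcomp Require Import zify ring lra.

(** Up to a signed permutation of the coordinates, a Coxeter element [g] of D_n acts as
    [f0][v 0, ..., v (N - 1)] with N = n - 1.  Extending [v] by [v (p + N) = - v p], every
    reflection is a reflection in some [v p - v q] with [p < q < p + N] or in some [f0 - v p],
    uniquely up to simultaneous shifts of the indices.  In the Artin group, conjugation by
    powers of the product of the generators gives elements [B p q] and [C p] with the same
    periodicity, which satisfy [phi(t) phi(t') = phi(t') phi(t' t t')] whenever [t t' <= g].
    That the product of the [phi(t)] along a reduced factorization of [w <= g] depends only
    on [w] then follows by induction on the length, once the graph on the reflections below
    [w] in which [t] and [t'] are adjacent if [t t' <= w] or [t' t <= w] is known to be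
    connected: for a basis vector [x] not mapped to [x] or [- x], the reflection in [w x - x]
    is adjacent to all others except possibly the one in [w x + x], which in turn has some
    neighbour.  Membership in the interval is linear algebra: the reflection in a root [a]
    lies below [w] iff [a = w u - u] for some [u], and then its product with the reflection
    in a root [b] lies below [w] iff [b] is also in the image of [w - 1] and [b] is
    orthogonal to [u]. *)

Set Implicit Arguments.
Unset Strict Implicit.
Unset Printing Implicit Defensive.
Import Order.TTheory GRing.Theory Num.Theory.

(** * Presented groups and the Artin group of type D *)

(** The two homomorphisms raise different difficulties. From the Artin group only the n simple
    reflections need images, and the Artin relations are checked in the poset group. From the poset
    group every [{w}] needs an image, and a choice of factorization has to be eliminated. The
    connectedness argument does the work of the transitivity of the braid group on reduced
    factorizations. It fails for diagonal [w], which are settled separately: an element below [g]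
    negates at most two mutually orthogonal signed vectors. Indices live in [nat] rather than modulo
    N because a shift by N changes the sign of [v p]. The reflection in [v p - v q] is invariant
    under this shift, the one in [f0 - v p] only under a shift by 2N. The elements of the Artin
    group need the same invariance for the lift of reflections to be well defined, and proving it is
    the main computation with the Artin relations. The two maps are inverse to each other because
    the product of the generators goes to [{g}], and conjugation by [{g}] acts on the generators of
    reflections as [g] acts on roots. *)

Section PresentationTheory.
Local Open Scope group_scope.
Variables (X : choiceType) (rels : seq X -> seq X -> Prop).

Definition pres_gen (x : X) : presented rels := word_class rels [:: (x, false)].

Lemma pres_homP (H : groupType) (f : X -> H) :
  (forall u v, rels u v -> \prod_(x <- u) f x = \prod_(x <- v) f x) ->
  exists F : UMagmaMorphism.type (presented rels) H,
    forall x, F (pres_gen x) = f x.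
Proof.
move=> hf; pose lv (a : X * bool) := if a.2 then (f a.1)^-1 else f a.1.
pose wv (u : word X) : H := \prod_(a <- u) lv a.
have wvE u v : word_eq rels u v -> wv u = wv v.
  elim=> {u v} // [u v w _ -> _ ->|u u' v v' _ eu _ ev|x b|u v /hf] //.
  - by rewrite /wv !big_cat /= -/(wv u) -/(wv v) eu ev.
  - by rewrite /wv !big_cons big_nil mulg1; case: b; rewrite /lv /= (mulVg, mulgV).
  - by rewrite /wv /positive_word !big_map.
pose F (a : presented rels) := wv (class_word a).
have FE u : F (word_class rels u) = wv u.
  by apply: wvE; apply/word_classP; rewrite word_classK.
have FM : {morph F : a b / a * b}.
  move=> a b; rewrite -(word_classK a) -(word_classK b) -[_ * _]word_class_cat.
  by rewrite !FE /wv big_cat.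
have F1 : F 1 = 1 by rewrite -[1]/(word_class rels [::]) FE /wv big_nil.
pose FF : UMagmaMorphism.type (presented rels) H :=
  HB.pack F (isUMagmaMorphism.Build _ _ F (F1, FM)).
by exists FF => x; rewrite [LHS]FE /wv big_seq1.
Qed.

Lemma pres_rel u v : rels u v ->
  \prod_(x <- u) pres_gen x = \prod_(x <- v) pres_gen x.
Proof.
have E w : \prod_(x <- w) pres_gen x = word_class rels (positive_word w).
  elim: w => [|x w IH]; first by rewrite big_nil.
  by rewrite big_cons IH /pres_gen -[_ * _]word_class_cat.
by move=> ruv; rewrite !E; apply/word_classP; exact: word_eq_rel.
Qed.

Lemma pres_hom_id (F : UMagmaMorphism.type (presented rels) (presented rels)) :
  (forall x, F (pres_gen x) = pres_gen x) -> F =1 id.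
Proof.
move=> FE a; rewrite -(word_classK a); elim: (class_word a) => [|[x b] u IH].
  by rewrite -[word_class _ _]/(1 : presented rels) gmulf1.
rewrite -cat1s word_class_cat -[pres_mul _ _]/((_ : presented rels) * (_ : presented rels)) gmulfM IH; congr (_ * _).
case: b; last exact: FE.
suff -> : word_class rels [:: (x, true)] = (pres_gen x)^-1 by rewrite gmulfV FE.
apply: (mulgI (pres_gen x)); rewrite mulgV /pres_gen -[LHS]word_class_cat.
by apply/word_classP; exact: (word_eq_cancel _ x false).
Qed.

End PresentationTheory.

Section GroupFacts.
Local Open Scope group_scope.
Variable G : groupType.
Implicit Types x y z : G.

Lemma conjg_eq x y z : x * y = y * z -> x ^ y = z.
Proof. by rewrite conjgE => ->; rewrite mulKg. Qed.

Lemma commute_conjg x y : commute x y -> x ^ y = x.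
Proof. exact: conjg_eq. Qed.

Lemma commuteJ x y z : commute x y -> commute (x ^ z) (y ^ z).
Proof. by move=> c; rewrite /commute -!conjMg c. Qed.

Definition braided x y := x * y * x = y * x * y.

Lemma braidedJ x y z : braided x y -> braided (x ^ z) (y ^ z).
Proof. by move=> c; rewrite /braided -!conjMg c. Qed.

Lemma braided_sym x y : braided x y -> braided y x.
Proof. by []. Qed.

Lemma braided_conj x y : braided x y -> x ^ y = y ^ x^-1.
Proof.
move=> c; rewrite !conjgE invgK; apply: (mulgI y); apply: (mulIg x).
by rewrite mulVKg !mulgA mulgVK -c.
Qed.

(** Here [x ^ y] is y^-1 x y, so x y = y (x ^ y) always holds. With this third factorization, x y
    satisfies all the dual relations of a rank two subgroup of type A_2. *)
Lemma braided_conjM x y : braided x y -> x ^ y * x = x * y.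
Proof.
by move=> c; rewrite conjgE; apply: (mulgI y); rewrite -!mulgA mulVKg !mulgA.
Qed.

Lemma commuteJr x y z : commute x y -> commute x z -> commute x (y ^ z).
Proof.
move=> cy cz; rewrite -(commute_conjg cz); exact: commuteJ.
Qed.

Lemma braided_Jl x y z : braided x y -> commute z y -> braided (x ^ z) y.
Proof.
move=> cy cz; have cz' : commute y z by [].
by rewrite -(commute_conjg cz'); exact: braidedJ.
Qed.

End GroupFacts.

Section Words.
Local Open Scope group_scope.
Variable G : groupType.
Implicit Types x y z t : G.

Lemma braidedA x y : braided x y ->
  forall t, x * (y * (x * t)) = y * (x * (y * t)).
Proof. by move=> c t; rewrite !mulgA c. Qed.

Lemma commuteA x y : commute x y -> forall t, x * (y * t) = y * (x * t).
Proof. by move=> c t; rewrite !mulgA c. Qed.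

End Words.

(* [a], [b] and [s 0, ..., s (N - 2)] play the roles of x_1, x_2 and x_3, ..., x_n, where
   [N = n - 1]; the values of [s] beyond [N - 2] are irrelevant. *)
Record artin_generators (G : groupType) (N : nat) (a b : G) (s : nat -> G) : Prop :=
  ArtinGenerators {
    artin_gt0 : 0 < N;
    artin_ab : commute a b;
    artin_as0 : 1 < N -> braided a (s 0);
    artin_bs0 : 1 < N -> braided b (s 0);
    artin_asi i : 0 < i -> i.+1 < N -> commute a (s i);
    artin_bsi i : 0 < i -> i.+1 < N -> commute b (s i);
    artin_ssS i : i.+2 < N -> braided (s i) (s i.+1);
    artin_ssc i j : i.+1 < j -> j.+1 < N -> commute (s i) (s j)
  }.

(** * Periodic families of conjugates of the generators in the Artin group *)

Section ArtinD.
Local Open Scope group_scope.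
Variables (G : groupType) (N : nat) (a b : G) (s : nat -> G).
Hypothesis gens : artin_generators N a b s.

Let N_gt0 : 0 < N := artin_gt0 gens.
Let ab : commute a b := artin_ab gens.
Let as0 : 1 < N -> braided a (s 0) := artin_as0 gens.
Let bs0 : 1 < N -> braided b (s 0) := artin_bs0 gens.
Let asi i : 0 < i -> i.+1 < N -> commute a (s i) := @artin_asi _ _ _ _ _ gens i.
Let bsi i : 0 < i -> i.+1 < N -> commute b (s i) := @artin_bsi _ _ _ _ _ gens i.
Let ssS i : i.+2 < N -> braided (s i) (s i.+1) := @artin_ssS _ _ _ _ _ gens i.
Let ssc i j : i.+1 < j -> j.+1 < N -> commute (s i) (s j) := @artin_ssc _ _ _ _ _ gens i j.

Let pr m := \prod_(0 <= i < m) s i.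
Let pr1 m := \prod_(1 <= i < m) s i.

Definition artin_delta : G := a * b * \prod_(0 <= i < N.-1) s i.
Let d := artin_delta.

Definition artin_end c := if c then a else b.
(** Extends [s 0, ..., s (N - 2)] to all indices: it agrees with [s p] in that range ([artin_sgE])
    and, for N > 1, has period N ([artin_sg_per]), which closes the chain to a cycle. *)
Definition artin_sg p : G := s 0 ^ (d^-1 ^+ p).
(** The parity twist is forced: conjugation by [d] exchanges the two ends up to a conjugation by
    [s 0] ([end_d]), as [g] negates [f0]. With the twist, [artin_CS] has the same form as the
    recursion for [artin_B]. *)
Definition artin_C c p : G := artin_end (odd p (+) c) ^ (d^-1 ^+ p).
Fixpoint artin_Bk p k : G :=
  if k is k'.+1 then artin_Bk p k' ^ artin_sg (p + k'.+1) else artin_sg p.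
(** The counterpart of the reflection in [v p - v q]. For q <= p the truncated subtraction yields
    the junk value [artin_sg p]. *)
Definition artin_B p q := artin_Bk p (q - p.+1).

Notation sg := artin_sg.
Notation B := artin_B.
Notation CC := artin_C.

Let prS m : pr m.+1 = pr m * s m.
Proof. by rewrite /pr big_nat_recr. Qed.

Let pr1S m : pr1 m.+2 = pr1 m.+1 * s m.+1.
Proof. by rewrite /pr1 big_nat_recr. Qed.

Let prE m : 0 < m -> pr m = s 0 * pr1 m.
Proof. by move=> m0; rewrite /pr big_ltn. Qed.

Let end_s c i : 0 < i -> i.+1 < N -> commute (artin_end c) (s i).
Proof. by case: c; [exact: asi|exact: bsi]. Qed.

Let pr_comm x m : (forall i, i < m -> commute x (s i)) -> commute x (pr m).
Proof.
elim: m => [|m IH] h; first by rewrite /pr big_nil; apply: commute_sym; rewrite /commute mulg1 mul1g.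
rewrite prS; apply: commuteM; last exact: h.
by apply: IH => i im; apply: h; rewrite ltnS ltnW.
Qed.

Let pr1_comm x m : (forall i, 0 < i < m -> commute x (s i)) -> commute x (pr1 m).
Proof.
case: m => [|m]; first by rewrite /pr1 big_geq // /commute mulg1 mul1g.
elim: m => [|m IH] h; first by rewrite /pr1 big_geq // /commute mulg1 mul1g.
rewrite pr1S; apply: commuteM; last by apply: h; lia.
by apply: IH => i im; apply: h; lia.
Qed.

Let s_pr i m : i.+1 < m -> m < N -> s i.+1 * pr m = pr m * s i.
Proof.
elim: m => // m IH im mN; rewrite prS mulgA.
have [->|ni] := eqVneq m i.+1.
  rewrite prS mulgA -(_ : pr i * s i.+1 = s i.+1 * pr i); last first.
    by apply: commute_sym; apply: pr_comm => k ki; apply: commute_sym; apply: ssc; lia.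
  by rewrite -!mulgA; congr (_ * _); rewrite !mulgA; symmetry; apply: ssS; lia.
rewrite IH; try lia.
by rewrite -!mulgA; congr (_ * _); apply: ssc; lia.
Qed.

Let z_s i : 0 < i -> i.+1 < N -> commute (a * b) (s i).
Proof.
move=> i0 iN; apply: commute_sym; apply: commuteM; apply: commute_sym.
  exact: asi.
exact: bsi.
Qed.

Let d_s i : i.+2 < N -> d * s i = s i.+1 * d.
Proof.
move=> iN; rewrite /d /artin_delta -/(pr _) -mulgA -s_pr; try lia.
by rewrite [LHS]mulgA [RHS]mulgA z_s //; lia.
Qed.

Let pr1_pr k m : k < m -> m < N -> pr1 k.+1 * pr m = pr m * pr k.
Proof.
elim: k => [|k IH] km mN.
  by rewrite [pr1 1]big_geq // [pr 0]big_geq // mulg1 mul1g.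
by rewrite pr1S prS -mulgA s_pr // mulgA IH ?mulgA //; lia.
Qed.

(** The length four braid relation of type B_2 between [a * b] and [s 0], which arises by folding
    the fork formed by [a], [b] and [s 0]. *)
Let z_s0 t : 1 < N ->
  a * (b * (s 0 * (a * (b * (s 0 * t))))) = s 0 * (a * (b * (s 0 * (a * (b * t))))).
Proof.
move=> N1; have as_ := braidedA (as0 N1); have bs_ := braidedA (bs0 N1).
have ab_ := commuteA ab.
rewrite [in LHS]ab_ -[in LHS]ab_ (ab_ (s 0 * t)) bs_ -as_ -ab_ as_ -bs_.
by rewrite -(ab_ t).
Qed.

Let pr1_z m : m < N -> commute (a * b) (pr1 m).
Proof. by move=> mN; apply: pr1_comm => i im; apply: z_s; lia. Qed.

Let dd_s : 1 < N -> d * d * s N.-2 = s 0 * (d * d).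
Proof.
move=> N1; have N2 : N.-1 = N.-2.+1 by lia.
rewrite /d /artin_delta -/(pr _).
have pE := prE (_ : 0 < N.-1); rewrite pE; last by lia.
have c := commuteA (pr1_z (_ : N.-1 < N)); rewrite -!mulgA.
have ppE : pr1 N.-1 * (s 0 * (pr1 N.-1 * s N.-2)) = s 0 * (pr1 N.-1 * (s 0 * pr1 N.-1)).
  have E : pr1 N.-1 * pr N.-1 = pr N.-1 * pr N.-2 by rewrite {1}N2 pr1_pr //; lia.
  have ss : pr N.-2 * s N.-2 = pr N.-1 by rewrite -prS -N2.
  rewrite (mulgA (s 0) _ (s _)) (mulgA (s 0) (pr1 _) (s 0 * _)) -pE; last by lia.
  by rewrite mulgA E -mulgA ss.
have cab t : pr1 N.-1 * (a * (b * t)) = a * (b * (pr1 N.-1 * t)).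
  by rewrite !mulgA -(mulgA _ a) -pr1_z ?mulgA //; lia.
by rewrite cab ppE z_s0 // -cab.
Qed.

Let conj_dV x y : d * x = y * d -> x ^ d^-1 = y.
Proof. by move=> h; rewrite conjgE invgK mulgA h mulgK. Qed.

Lemma artin_sgD p k : sg (p + k) = sg p ^ (d^-1 ^+ k).
Proof. by rewrite /artin_sg expgnDr conjgM. Qed.

Lemma artin_sgE p : p.+1 < N -> sg p = s p.
Proof.
elim: p => [|p IH] pN; first by rewrite /artin_sg expg0 conjg1.
rewrite -addn1 artin_sgD expg1 IH; last by lia.
by rewrite addn1; apply: conj_dV; apply: d_s.
Qed.

Lemma artin_sg_per p : 1 < N -> sg (p + N) = sg p.
Proof.
move=> N1; suff E : sg N = s 0 by rewrite addnC artin_sgD E.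
have -> : N = N.-2 + 2 by lia.
rewrite artin_sgD artin_sgE; last by lia.
rewrite expg2 -invgM conjgE invgK mulgA dd_s //.
by rewrite mulgK.
Qed.

Let ends_s0 c : 1 < N -> braided (artin_end c) (s 0).
Proof. by case: c; [exact: as0|exact: bs0]. Qed.

Lemma artin_ends c : commute (artin_end c) (artin_end (~~ c)).
Proof. by case: c. Qed.

Let end_dE c : d = artin_end c * artin_end (~~ c) * pr N.-1.
Proof. by case: c => //=; rewrite -ab. Qed.

Let end_d c : 1 < N -> artin_end c ^ d^-1 = artin_end (~~ c) ^ s 0.
Proof.
move=> N1; set x := artin_end c; set y := artin_end (~~ c).
apply: conj_dV; rewrite conjgE (end_dE c) -/x -/y prE; last by lia.
apply: (mulgI (s 0)); rewrite -!mulgA mulVKg.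
have xP : commute (pr1 N.-1) x.
  by apply: commute_sym; apply: pr1_comm => i ?; apply: end_s; lia.
have xs := braidedA (ends_s0 c N1); have ys := braidedA (ends_s0 (~~ c) N1).
have xy := commuteA (artin_ends c).
rewrite -/x -/y in xs ys xy; rewrite xP.
by rewrite xy xs -ys -xy.
Qed.

Lemma artin_CS c p : 1 < N -> CC c p.+1 = CC c p ^ sg p.
Proof.
move=> N1; rewrite /artin_C /artin_sg -conjJg expgS conjgM end_d //.
by rewrite /= addNb negbK.
Qed.

(** Going round the cycle once exchanges the ends, the counterpart of [v (p + N) = - v p]. *)
Lemma artin_CN c : CC c N = artin_end (~~ c).
Proof.
have [N1|N1] := ltnP 1 N; last first.
  (* Type D_2: no [s i] is a generator, and [d] is just [a * b]. *)
  have -> : N = 1%N by lia.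
  rewrite /artin_C expg1 /=; apply: conj_dV.
  rewrite (end_dE c) (_ : N.-1 = 0%N); last by lia.
  by rewrite [pr 0]big_geq // mulg1 !mulgA; congr (_ * _); exact: artin_ends.
have CE m : m < N -> CC c m = artin_end c ^ pr m.
  elim: m => [|m IH] mN; first by rewrite /artin_C /= expg0 [pr 0]big_geq.
  by rewrite artin_CS ?IH ?artin_sgE ?prS ?conjgM //; lia.
rewrite -{1}(prednK N_gt0) artin_CS // CE; last by lia.
(* The product of the [s i] is [d] up to the two ends, which commute with [artin_end c]. Since
   [sg N.-1] is [s 0 ^ d], a common conjugation by [d] can be pulled out, and [end_d] undoes it. *)
have prd : pr N.-1 = (artin_end c * artin_end (~~ c))^-1 * d.
  by rewrite (end_dE c) mulKg.
have cc : commute (artin_end c) (artin_end c * artin_end (~~ c))^-1.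
  by apply: commuteV; apply: commuteM => //; exact: artin_ends.
rewrite prd (conjgM (artin_end c)). rewrite (commute_conjg cc).
have -> : sg N.-1 = s 0 ^ d.
  apply: (@conjg_inj _ d^-1); rewrite conjgK.
  have := artin_sgD N.-1 1; rewrite expg1 => <-.
  by rewrite addn1 prednK // -[N]add0n artin_sg_per // /artin_sg expg0 conjg1.
by rewrite -conjJg -{1}[c]negbK -end_d // conjgKV.
Qed.

Lemma artin_C_shift c p k : CC c (p + k) = CC (odd k (+) c) p ^ (d^-1 ^+ k).
Proof. by rewrite /artin_C -conjgM -expgnDr oddD addbA. Qed.

Lemma artin_C_per c p : CC c (p + N) = CC (~~ c) p.
Proof.
rewrite addnC artin_C_shift artin_CN /artin_C; congr (artin_end _ ^ _).
by rewrite addbN.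
Qed.

Lemma artin_C0 c : CC c 0 = artin_end c.
Proof. by rewrite /artin_C expg0 conjg1. Qed.

Let sg_comm i j : i.+1 < j -> j.+1 < i + N -> commute (sg i) (sg j).
Proof.
move=> ij jN; have -> : j = (j - i) + i by lia.
rewrite -{1}[i]add0n !artin_sgD; apply: commuteJ.
by rewrite !artin_sgE; [apply: ssc|..]; lia.
Qed.

Let sg_braid i : 2 < N -> braided (sg i) (sg i.+1).
Proof.
move=> N2; rewrite -{1}[i]add0n -add1n !artin_sgD; apply: braidedJ.
by rewrite !artin_sgE; [apply: ssS|..]; lia.
Qed.

Let C_sg c p q : p < q -> q.+1 < p + N -> commute (CC c p) (sg q).
Proof.
move=> pq qN; have -> : q = (q - p) + p by lia.
rewrite -{1}[p]add0n artin_C_shift !artin_sgD; apply: commuteJ.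
by rewrite artin_C0 artin_sgE; [apply: end_s|..]; lia.
Qed.

Let C_sg_braid c p : 1 < N -> braided (CC c p) (sg p).
Proof.
move=> N1; rewrite -[p]add0n artin_C_shift artin_sgD; apply: braidedJ.
by rewrite artin_C0 artin_sgE //; exact: ends_s0.
Qed.

Lemma artin_BS p : B p p.+1 = sg p.
Proof. by rewrite /artin_B subnn. Qed.

Lemma artin_Br p q : p < q -> B p q.+1 = B p q ^ sg q.
Proof.
move=> pq; rewrite /artin_B (_ : q.+1 - p.+1 = (q - p.+1).+1)%N; last by lia.
by rewrite /=; congr (_ ^ sg _); lia.
Qed.

Lemma artin_B_per p q : p < q -> q < p + N -> B (p + N) (q + N) = B p q.
Proof.
move=> pq qN; have N1 : 1 < N by lia.
elim: q pq qN => // q IH; rewrite ltnS leq_eqVlt => /orP[/eqP <-|pq] qN.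
  by rewrite addSn !artin_BS artin_sg_per.
rewrite addSn !artin_Br //; last by lia.
by rewrite IH ?artin_sg_per //; lia.
Qed.

Let B_comm p q x : p < q ->
  (forall i, p <= i < q -> commute x (sg i)) -> commute x (B p q).
Proof.
elim: q => // q IH; rewrite ltnS leq_eqVlt => /orP[/eqP <-|pq] h.
  by rewrite artin_BS; apply: h; lia.
rewrite artin_Br //; apply: commuteJr; last by apply: h; lia.
by apply: IH => // i pi; apply: h; lia.
Qed.

Lemma artin_B_disjoint p q r t : p < q -> q < r -> r < t -> t < p + N ->
  commute (B p q) (B r t).
Proof.
move=> pq qr rt tN; apply: B_comm => // i ri; apply: commute_sym.
by apply: B_comm => // j pj; apply: commute_sym; apply: sg_comm; lia.
Qed.

Lemma artin_B_split p q r : p < q -> q < r -> r < p + N ->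
  B p r = B p q ^ B q r.
Proof.
move=> pq; elim: r => // r IH; rewrite ltnS leq_eqVlt => /orP[/eqP <-|qr] rN.
  by rewrite artin_BS artin_Br.
rewrite artin_Br ?IH; try lia; rewrite artin_Br // conjJg; congr (_ ^ _).
rewrite commute_conjg //; apply: commute_sym; apply: B_comm => // i pi.
by apply: commute_sym; apply: sg_comm; lia.
Qed.

Let B_sg_braid p q : p < q -> q.+1 < p + N -> braided (B p q) (sg q).
Proof.
move=> pq; elim: q pq => // q IH; rewrite ltnS leq_eqVlt.
move=> /orP[/eqP <-|pq] qN; first by rewrite artin_BS; apply: sg_braid; lia.
(* By [braided_conj], [B p q ^ sg q] is also a conjugate of [sg q] by the inverse of [B p q], which
   commutes with [sg q.+1]; only the braid relation of two neighbours is left. *)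
rewrite artin_Br // braided_conj; last by apply: IH => //; lia.
apply: braided_Jl; first by apply: sg_braid; lia.
apply: commute_sym; apply: commuteV; apply: B_comm => // i pi.
by apply: commute_sym; apply: sg_comm; lia.
Qed.

Lemma artin_B_braid p q r : p < q -> q < r -> r < p + N ->
  braided (B p q) (B q r).
Proof.
move=> pq; elim: r => // r IH; rewrite ltnS leq_eqVlt => /orP[/eqP <-|qr] rN.
  by rewrite artin_BS; apply: B_sg_braid.
rewrite artin_Br //; apply: braided_sym; apply: braided_Jl.
  by apply: braided_sym; apply: IH => //; lia.
apply: B_comm => // i pi.
by apply: commute_sym; apply: sg_comm; lia.
Qed.

Lemma artin_B_nested p q r t : p < r -> r < t -> t < q -> q < p + N ->
  commute (B p q) (B r t).
Proof.
move=> lpr rt tq qN; apply: B_comm => // i ri; apply: commute_sym.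
have {ri} [pi iq] : p < i /\ i.+1 < q by lia.
elim: q iq qN {tq} => // q IH; rewrite ltnS leq_eqVlt => /orP[/eqP <-|iq] qN.
  rewrite !artin_Br //; last by lia.
  rewrite -conjgM.
  (* The element that conjugates [B p i] to [B p i.+2] also conjugates [sg i.+1] to [sg i], so the
     claim reduces to the disjoint pair [sg i.+1] and [B p i]. *)
  rewrite [X in commute X _](_ : _ = sg i.+1 ^ (sg i * sg i.+1)); last first.
    by symmetry; apply: conjg_eq; rewrite mulgA -sg_braid //; lia.
  apply: commuteJ; apply: B_comm => // j pj.
  by apply: commute_sym; apply: sg_comm; lia.
rewrite artin_Br; last by lia.
apply: commuteJr; first by apply: IH; lia.
by apply: sg_comm; lia.
Qed.

Lemma artin_B_tri p q r : p < q -> q < r -> r < p + N ->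
  B p q * B q r = B q r * B p r /\ B p r * B p q = B p q * B q r.
Proof.
move=> pq qr rN; rewrite (artin_B_split pq qr rN).
split; first by rewrite -conjgC.
exact: braided_conjM (artin_B_braid pq qr rN).
Qed.

Lemma artin_C_B c p q : p < q -> q < p + N ->
  CC c q = CC c p ^ B p q.
Proof.
move=> pq; elim: q pq => // q IH; rewrite ltnS leq_eqVlt.
move=> /orP[/eqP <-|pq] qN; first by rewrite artin_BS artin_CS //; lia.
rewrite artin_CS ?IH //; try lia; rewrite artin_Br // conjJg.
by rewrite (commute_conjg (C_sg _ _ _)).
Qed.

Let C_B_braid c p q : p < q -> q < p + N -> braided (CC c p) (B p q).
Proof.
move=> pq; elim: q pq => // q IH; rewrite ltnS leq_eqVlt.
move=> /orP[/eqP <-|pq] qN; first by rewrite artin_BS; apply: C_sg_braid; lia.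
rewrite artin_Br //; apply: braided_sym; apply: braided_Jl.
  by apply: braided_sym; apply: IH => //; lia.
by apply: commute_sym; exact: C_sg.
Qed.

Lemma artin_C_tri c p q : p < q -> q < p + N ->
  CC c p * B p q = B p q * CC c q /\ CC c q * CC c p = CC c p * B p q.
Proof.
move=> pq qN; rewrite (artin_C_B c pq qN); split; first by rewrite -conjgC.
exact: braided_conjM (C_B_braid c pq qN).
Qed.

Lemma artin_C_B_comm c p r t : p < r -> r < t -> t < p + N ->
  commute (CC c p) (B r t).
Proof. by move=> lpr rt tN; apply: B_comm => // i ri; apply: C_sg; lia. Qed.

Lemma artin_C_comm c p : commute (CC c p) (CC (~~ c) p).
Proof. by rewrite /artin_C addbN; apply: commuteJ; exact: artin_ends. Qed.

End ArtinD.

(** * Reflections and reflection length in Euclidean space *)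

Section Euclidean.
Local Open Scope ring_scope.
Variables (R : realType) (n : nat).
Implicit Types (w u t : 'M[R]_n) (x y a b v : 'cV[R]_n) (c : R).

Definition dot x y : R := (x^T *m y) 0 0.

Lemma dotE x y : dot x y = \sum_k x k 0 * y k 0.
Proof. by rewrite /dot !mxE; apply: eq_bigr => k _; rewrite !mxE. Qed.

Lemma dotC x y : dot x y = dot y x.
Proof. by rewrite !dotE; apply: eq_bigr => k _; rewrite mulrC. Qed.

Lemma dotDr x y v : dot x (y + v) = dot x y + dot x v.
Proof. by rewrite /dot mulmxDr mxE. Qed.

Lemma dotZr c x y : dot x (c *: y) = c * dot x y.
Proof. by rewrite /dot -scalemxAr mxE. Qed.

Lemma dotNr x y : dot x (- y) = - dot x y.
Proof. by rewrite /dot mulmxN mxE. Qed.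

Lemma dotBr x y v : dot x (y - v) = dot x y - dot x v.
Proof. by rewrite dotDr dotNr. Qed.

Lemma dot0r x : dot x 0 = 0.
Proof. by rewrite /dot mulmx0 mxE. Qed.

Lemma dotDl x y v : dot (x + y) v = dot x v + dot y v.
Proof. by rewrite dotC dotDr !(dotC v). Qed.

Lemma dotZl c x y : dot (c *: x) y = c * dot x y.
Proof. by rewrite dotC dotZr dotC. Qed.

Lemma dotNl x y : dot (- x) y = - dot x y.
Proof. by rewrite dotC dotNr dotC. Qed.

Lemma dotBl x y v : dot (x - y) v = dot x v - dot y v.
Proof. by rewrite dotDl dotNl. Qed.

Lemma dot_sumr (I : Type) (r : seq I) (P : pred I) (F : I -> 'cV[R]_n) x :
  dot x (\sum_(i <- r | P i) F i) = \sum_(i <- r | P i) dot x (F i).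
Proof. by elim/big_rec2: _ => [|i y z _ <-]; rewrite (dot0r, dotDr). Qed.

Lemma dot_eq0 x : (dot x x == 0) = (x == 0).
Proof.
apply/eqP/eqP => [|->]; last exact: dot0r.
rewrite dotE => /eqP; rewrite psumr_eq0; last by move=> k _; rewrite -expr2 sqr_ge0.
move=> /allP h; apply/matrixP => k j; rewrite ord1 mxE.
by apply/eqP; have := h k (mem_index_enum k); rewrite /= -expr2 sqrf_eq0.
Qed.

Lemma mulmx_cV_ext w u : (forall v, w *m v = u *m v) -> w = u.
Proof.
move=> h; apply/matrixP => i j; have := h (delta_mx j 0).
by rewrite -!colE => /matrixP/(_ i 0); rewrite !mxE.
Qed.

Lemma reflmxE a x : reflmx a *m x = x - (2 * dot a x / dot a a) *: a.
Proof.
rewrite /reflmx mulmxBl mul1mx -scalemxAl -mulmxA.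
rewrite [a^T *m x]mx11_scalar -/(dot a x) mul_mx_scalar scalerA -/(dot a a).
by congr (_ - _ *: _); ring.
Qed.

Lemma reflmx_tr a : (reflmx a)^T = reflmx a.
Proof. by rewrite /reflmx linearB /= trmx1 linearZ /= trmx_mul trmxK. Qed.

Lemma reflmx_id a x : dot a x = 0 -> reflmx a *m x = x.
Proof. by move=> h; rewrite reflmxE h mulr0 mul0r scale0r subr0. Qed.

Lemma reflmxZ c a : c != 0 -> reflmx (c *: a) = reflmx a.
Proof.
move=> c0; have [->|a0] := eqVneq a 0; first by rewrite scaler0.
have da : dot a a != 0 by rewrite dot_eq0.
apply: mulmx_cV_ext => x; rewrite !reflmxE !dotZl dotZr scalerA.
by congr (_ - _ *: _); field; rewrite da c0.
Qed.

Lemma reflmxN a : reflmx (- a) = reflmx a.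
Proof. by rewrite -scaleN1r reflmxZ // oppr_eq0 oner_eq0. Qed.

Lemma reflmxK a : reflmx a *m reflmx a = 1%:M.
Proof.
have [->|a0] := eqVneq a 0.
  by rewrite /reflmx mul0mx scaler0 subr0 mulmx1.
have da : dot a a != 0 by rewrite dot_eq0.
apply: mulmx_cV_ext => x; rewrite -mulmxA mul1mx !reflmxE dotBr dotZr.
rewrite -addrA -opprD -scalerDl; set c := (X in X *: _).
suff -> : c = 0 by rewrite scale0r subr0.
by rewrite /c; field.
Qed.

Definition orthmx w := w^T *m w = 1%:M.

Lemma orthmx_refl a : orthmx (reflmx a).
Proof. by rewrite /orthmx reflmx_tr reflmxK. Qed.

Lemma orthmx1 : orthmx 1%:M.
Proof. by rewrite /orthmx trmx1 mulmx1. Qed.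

Lemma orthmxM w u : orthmx w -> orthmx u -> orthmx (w *m u).
Proof.
by move=> hw hu; rewrite /orthmx trmx_mul mulmxA -(mulmxA _ _ w) hw mulmx1.
Qed.

Lemma orthmx_unit w : orthmx w -> w \in unitmx.
Proof. by move=> /mulmx1_unit[]. Qed.

Lemma orthmx_inv w : orthmx w -> invmx w = w^T.
Proof.
move=> h; have wU := orthmx_unit h.
by rewrite -[LHS]mul1mx -h mulmxK.
Qed.

Lemma orthmx_tr w : orthmx w -> orthmx w^T.
Proof. by move=> h; rewrite /orthmx trmxK; apply: mulmx1C. Qed.

Lemma dot_orth w x y : orthmx w -> dot (w *m x) (w *m y) = dot x y.
Proof.
by move=> h; rewrite /dot trmx_mul mulmxA -(mulmxA _ _ w) h mulmx1.
Qed.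

Lemma dot_trmx w x y : dot x (w *m y) = dot (w^T *m x) y.
Proof. by rewrite /dot trmx_mul trmxK mulmxA. Qed.

Lemma reflmx_conj w a : orthmx w -> w *m reflmx a *m w^T = reflmx (w *m a).
Proof.
move=> h; apply: mulmx_cV_ext => x; rewrite -!mulmxA !reflmxE mulmxBr.
rewrite mulmxA (mulmx1C h) mul1mx -scalemxAr dot_orth //.
by rewrite dot_trmx trmxK.
Qed.

Lemma reflmx_eq a b : dot a a = 2 -> dot b b = 2 -> reflmx a = reflmx b ->
  a = b \/ a = - b.
Proof.
move=> da db e; have := congr1 (mulmx^~ a) e.
rewrite !reflmxE da db mulfK ?pnatr_eq0 // => E.
have E2 : 2 *: a = dot b a *: b.
  have -> : dot b a = 2 * dot b a / 2 by rewrite mulrC mulKf // pnatr_eq0.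
  by apply/eqP; rewrite -subr_eq0; have /eqP := E; rewrite (inj_eq (addrI a)) eqr_opp -subr_eq0.
have := congr1 (dot a) E2; rewrite !dotZr da (dotC a) => E3.
have : (dot b a - 2) * (dot b a + 2) = 0 by move: E3; lra.
have a2 (y : 'cV[R]_n) (c : R) : c *: a = c *: y -> c != 0 -> a = y.
  by move=> h c0; apply: (scalerI c0).
move/eqP; rewrite mulf_eq0 subr_eq0 addr_eq0 => /orP[] /eqP h; [left|right];
  apply: (a2 _ 2) => //; rewrite ?pnatr_eq0 // E2 h //.
by rewrite scalerN scaleNr.
Qed.

(** Matrices act on columns, so fixed spaces are right kernels, while [<=] compares row spaces; this
    translates between the two. *)
Lemma submx_ker (A B : 'M[R]_n) :
  (forall v : 'cV_n, A *m v = 0 -> B *m v = 0) -> (B <= A)%MS.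
Proof.
move=> h; rewrite submxE; apply/eqP/mulmx_cV_ext => v.
by rewrite -mulmxA mul0mx; apply: h; rewrite mulmxA mulmx_coker mul0mx.
Qed.

Lemma rank_ker_le (A B : 'M[R]_n) :
  (forall v : 'cV_n, A *m v = 0 -> B *m v = 0) -> (\rank B <= \rank A)%N.
Proof. by move=> h; apply: mxrankS; exact: submx_ker. Qed.

Lemma rank_ker_lt (A B : 'M[R]_n) (v : 'cV_n) :
  (forall v : 'cV_n, A *m v = 0 -> B *m v = 0) ->
  B *m v = 0 -> A *m v != 0 -> (\rank B < \rank A)%N.
Proof.
move=> h Bv Av; have hr := rank_ker_le h.
rewrite ltn_neqAle hr andbT; apply/eqP => rAB.
have sAB : (A <= B)%MS.
  have sBA := submx_ker h.
  have := mxrank_leqif_eq sBA; rewrite /leqif rAB eqxx => -[_ e].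
  by have /andP[] := esym e.
have [C AC] := submxP sAB.
by move/eqP: Av; apply; rewrite AC -mulmxA Bv mulmx0.
Qed.

(** The codimension of the fixed space; [refl_lengthE] identifies it with the reflection length on
    the group. *)
Definition codim w : nat := \rank (w - 1%:M).
Definition moved w a : Prop := exists v, w *m v = v + a.

Lemma fix_subr1P w v : (w - 1%:M) *m v = 0 <-> w *m v = v.
Proof.
rewrite mulmxBl mul1mx; split => [/eqP|->]; last by rewrite subrr.
by rewrite subr_eq0 => /eqP.
Qed.

Lemma codim1 : codim 1%:M = 0%N.
Proof. by rewrite /codim subrr mxrank0. Qed.

Lemma codim_eq0 w : codim w = 0%N -> w = 1%:M.
Proof. by move=> /eqP; rewrite mxrank_eq0 subr_eq0 => /eqP. Qed.

Lemma codimM w u : (codim (w *m u) <= codim w + codim u)%N.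
Proof.
rewrite /codim (_ : w *m u - 1%:M = (w - 1%:M) *m u + (u - 1%:M)); last first.
  by rewrite mulmxBl mul1mx addrA subrK.
apply: leq_trans (mxrank_add _ _) _.
by rewrite leq_add2r; apply: mxrankM_maxl.
Qed.

Lemma codim_conj w u : orthmx u -> codim (u *m w *m u^T) = codim w.
Proof.
move=> hu; have uU := orthmx_unit hu; have utU := orthmx_unit (orthmx_tr hu).
rewrite /codim.
have -> : u *m w *m u^T - 1%:M = u *m (w - 1%:M) *m u^T.
  by rewrite mulmxBr mulmxBl mulmx1 (mulmx1C hu).
rewrite mxrankMfree; last by rewrite row_free_unit.
by rewrite eqmxMfull // row_full_unit.
Qed.

Lemma codim_refl_le a : (codim (reflmx a) <= 1)%N.
Proof.
rewrite /codim /reflmx addrC addKr mxrank_opp.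
apply: leq_trans (mxrankS (scalemx_sub _ (submx_refl _))) _.
by apply: leq_trans (mxrankM_maxr _ _) _; exact: rank_leq_row.
Qed.

Lemma codim_refl a : a != 0 -> codim (reflmx a) = 1%N.
Proof.
move=> a0; apply/eqP; rewrite eqn_leq codim_refl_le lt0n; apply/eqP => /codim_eq0 e.
have := congr1 (mulmx^~ a) e; rewrite reflmxE mul1mx mulfK ?dot_eq0 // => /eqP.
rewrite -subr_eq0 addrAC subrr add0r oppr_eq0 scaler_eq0 (negPf a0).
by rewrite pnatr_eq0.
Qed.

Lemma moved_orth w v a x : orthmx w -> w *m v = v + a -> w *m x = x -> dot a x = 0.
Proof.
move=> h wv wx; have := dot_orth v x h; rewrite wv wx dotDl => /eqP.
by rewrite -subr_eq0 addrAC subrr add0r => /eqP.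
Qed.

Lemma moved_norm w v a : orthmx w -> w *m v = v + a -> 2 * dot a v = - dot a a.
Proof.
by move=> h wv; have := dot_orth v v h; rewrite wv !dotDl !dotDr (dotC v a); lra.
Qed.

Lemma refl_moved w v a : orthmx w -> w *m v = v + a -> a != 0 ->
  reflmx a *m w *m v = v.
Proof.
move=> h wv a0; have da : dot a a != 0 by rewrite dot_eq0.
rewrite -mulmxA wv reflmxE dotDr.
have -> : 2 * (dot a v + dot a a) / dot a a = 1.
  by have := moved_norm h wv; rewrite mulrDr => ->; field.
by rewrite scale1r addrK.
Qed.

(** Vectors fixed by [w] are orthogonal to [a], hence stay fixed, and the preimage [v] becomes fixed
    in addition, because the reflection takes [w *m v] back to [v]. One reflection cannot gain more
    than one dimension. *)
Lemma codim_refl_moved w a : orthmx w -> a != 0 -> moved w a ->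
  (codim (reflmx a *m w)).+1 = codim w.
Proof.
move=> h a0 [v wv].
have lt : (codim (reflmx a *m w) < codim w)%N.
  apply: (@rank_ker_lt _ _ v).
  - move=> x /fix_subr1P wx; apply/fix_subr1P; rewrite -mulmxA wx; apply: reflmx_id.
    exact: (moved_orth h wv wx).
  - by apply/fix_subr1P; exact: refl_moved.
  - by rewrite mulmxBl mul1mx wv addrC addKr.
apply/eqP; rewrite eqn_leq lt andTb.
rewrite -[w in (codim w <= _)%N]mul1mx -(reflmxK a) -mulmxA.
apply: leq_trans (codimM _ _) _.
by rewrite -add1n leq_add2r codim_refl_le.
Qed.

Lemma moved_codim_refl w a : a != 0 ->
  (codim (reflmx a *m w) < codim w)%N -> moved w a.
Proof.
move=> a0 lt.
(* A vector fixed by [reflmx a *m w] but not by [w] is moved by [w] along [a]; it then only has to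
   be rescaled. *)
have [v [tv wv]] : exists v, reflmx a *m w *m v = v /\ w *m v <> v.
  apply: contrapT => H.
  move: lt; rewrite ltnNge => /negP; apply; apply: rank_ker_le => v /fix_subr1P tv.
  by apply/fix_subr1P; apply: contrapT => wv; apply: H; exists v.
have wvE : w *m v = reflmx a *m v by rewrite -[in RHS]tv !mulmxA reflmxK mul1mx.
move: wv; rewrite wvE reflmxE; set c := (X in X *: a) => wv.
have c0 : c != 0 by apply/eqP => c0; apply: wv; rewrite c0 scale0r subr0.
exists (- c^-1 *: v); rewrite -scalemxAr wvE reflmxE -/c scalerBr.
by congr (_ + _); rewrite scaleNr opprK scalerA mulVf // scale1r.
Qed.

(* [reflmx a *m reflmx b] is below [w] exactly when [b] is moved by [w] and
   orthogonal to a preimage [v] of [a] under [w - 1]. *)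
Lemma codim_refl2 w v a b : orthmx w -> w *m v = v + a -> a != 0 -> b != 0 ->
  (codim (reflmx b *m (reflmx a *m w))).+2 = codim w <->
  moved w b /\ dot b v = 0.
Proof.
move=> h wv a0 b0; set w1 := reflmx a *m w.
have h1 : orthmx w1 by apply: orthmxM => //; exact: orthmx_refl.
have cw : (codim w1).+1 = codim w by apply: codim_refl_moved => //; exists v.
have w1v : w1 *m v = v by exact: refl_moved.
split=> [E|[[u wu] bv]].
  have [u w1u] : moved w1 b by apply: moved_codim_refl => //; lia.
  split; last exact: (moved_orth h1 w1u w1v).
  have wu : w *m u = reflmx a *m (u + b) by rewrite -w1u !mulmxA reflmxK mul1mx.
  move: wu; rewrite reflmxE; set c := (X in X *: a) => wu.
  exists (u + c *: v); rewrite mulmxDr -scalemxAr wu wv.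
  by apply/matrixP => i j; rewrite !mxE; ring.
rewrite -cw; congr _.+1; apply: codim_refl_moved => //; exists u.
rewrite /w1 -mulmxA wu reflmx_id // -wu.
have := dot_orth v u h; rewrite wv wu dotDl !dotDr (dotC v b) bv.
by lra.
Qed.

(** Adjacency in the other order, expressed by the same preimage [v] of [a]: if [u] is a preimage of
    [b], invariance of the form gives <a, u> = - <b, w v>, so [codim_refl2] applies with [a] and [b]
    exchanged. *)
Lemma codim_refl2' w v a b : orthmx w -> w *m v = v + a -> a != 0 -> b != 0 ->
  moved w b -> dot b (w *m v) = 0 ->
  (codim (reflmx a *m (reflmx b *m w))).+2 = codim w.
Proof.
move=> h wv a0 b0 [u wu] bwv.
apply/(codim_refl2 h wu) => //; split; first by exists v.
have := dot_orth v u h; rewrite wu [in dot _ (u + b)]dotDr (dotC _ b) bwv wv dotDl.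
by lra.
Qed.

End Euclidean.

(** * Signed vectors and the group of type D *)

Section SignedVectors.
Local Open Scope ring_scope.
Variables (R : realType) (n : nat).
Implicit Types (w u t r : 'M[R]_n) (x y a b v f : 'cV[R]_n) (c : R).

Local Notation e := (@basis_vec R n).

Lemma dot_basis i x : dot (e i) x = x i 0.
Proof.
rewrite dotE (bigD1 i) //= big1 ?addr0 => [|k /negPf ki]; rewrite mxE ?ki ?mul0r //.
by rewrite !eqxx mul1r.
Qed.

Lemma basisE i k j : e i k j = (k == i)%:R.
Proof. by rewrite mxE ord1 eqxx andbT. Qed.

Lemma mulmx_basis_ext w u : (forall i, w *m e i = u *m e i) -> w = u.
Proof.
move=> h; apply/matrixP => i j; have := h j.
by rewrite -!colE => /matrixP/(_ i 0); rewrite !mxE.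
Qed.

Definition signed x : Prop := exists i, x = e i \/ x = - e i.

Lemma signed_basis i : signed (e i). Proof. by exists i; left. Qed.

Lemma signedN x : signed x -> signed (- x).
Proof. by move=> [i [->|->]]; exists i; [right|left]; rewrite ?opprK. Qed.

Lemma signed_norm x : signed x -> dot x x = 1.
Proof. by move=> [i [->|->]]; rewrite ?dotNl ?dotNr ?opprK dot_basis basisE eqxx. Qed.

Lemma signed_dot x y : signed x -> signed y ->
  [\/ dot x y = 0, x = y | x = - y].
Proof.
move=> [i xE] [j yE]; have [ij|ij] := eqVneq i j.
  by rewrite -ij in yE; case: xE yE => -> [->|->]; rewrite ?opprK;
    [constructor 2|constructor 3|constructor 3|constructor 2].
constructor 1; case: xE yE => -> [->|->];
  by rewrite ?dotNl ?dotNr dot_basis basisE (negPf ij) ?oppr0.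
Qed.

Definition is_root a : Prop :=
  exists x y, [/\ signed x, signed y, dot x y = 0 & a = x - y].

Lemma root_norm a : is_root a -> dot a a = 2.
Proof.
move=> [x [y [sx sy xy ->]]].
by rewrite dotBl !dotBr (signed_norm sx) (signed_norm sy) (dotC y) xy; ring.
Qed.

Lemma root_neq0 a : is_root a -> a != 0.
Proof. by move=> /root_norm h; rewrite -dot_eq0 h pnatr_eq0. Qed.

Lemma is_rootN a : is_root a -> is_root (- a).
Proof.
by move=> [x [y [sx sy xy ->]]]; exists y, x; split; rewrite // ?opprB // dotC.
Qed.

Lemma reflmx_swap x y v : signed x -> signed y -> dot x y = 0 ->
  reflmx (x - y) *m v = v - (dot x v - dot y v) *: (x - y).
Proof.
move=> sx sy xy; rewrite reflmxE root_norm; last by exists x, y.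
by rewrite mulrAC mulfV ?mul1r ?pnatr_eq0 // dotBl.
Qed.

Lemma reflmx_swapl x y : signed x -> signed y -> dot x y = 0 ->
  reflmx (x - y) *m x = y.
Proof.
move=> sx sy xy; rewrite reflmx_swap // signed_norm // dotC xy subr0 scale1r.
by rewrite opprB addrC subrK.
Qed.

Lemma reflmx_swapr x y : signed x -> signed y -> dot x y = 0 ->
  reflmx (x - y) *m y = x.
Proof. by move=> sx sy xy; rewrite -opprB reflmxN reflmx_swapl // dotC. Qed.

Lemma reflmx_swap_id x y v : dot x v = 0 -> dot y v = 0 ->
  reflmx (x - y) *m v = v.
Proof. by move=> xv yv; apply: reflmx_id; rewrite dotBl xv yv subr0. Qed.

Definition pm1 x : Prop := forall k, x k 0 = 1 \/ x k 0 = -1.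

(** Evenness of the number of sign changes, stated without naming the underlying permutation: on
    vectors with entries 1 and -1, an even signed permutation preserves the product of the
    entries. *)
Definition pm1_preserving w : Prop :=
  forall x, pm1 x -> pm1 (w *m x) /\ \prod_k (w *m x) k 0 = \prod_k x k 0.

Definition monomial w : Prop := forall x, signed x -> signed (w *m x).

(** The conditions on the transpose make closure under inverses immediate. *)
Definition even_signed_perm w : Prop :=
  [/\ orthmx w, monomial w /\ monomial w^T
    & pm1_preserving w /\ pm1_preserving w^T].

Lemma even_signed_permM w u :
  even_signed_perm w -> even_signed_perm u -> even_signed_perm (w *m u).
Proof.
move=> [ow [mw mw'] [pw pw']] [ou [mu mu'] [pu pu']]; split.
- exact: orthmxM.
- split=> x sx; rewrite ?trmx_mul -mulmxA; first by apply: mw; exact: mu.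
  by apply: mu'; exact: mw'.
- split=> x px; rewrite ?trmx_mul -mulmxA.
    by have [q <-] := pu _ px; exact: pw.
  by have [q <-] := pw' _ px; exact: pu'.
Qed.

Lemma signed_reflmx a x : is_root a -> signed x -> signed (reflmx a *m x).
Proof.
move=> [u [v [su sv uv ->]]] sx.
case: (signed_dot su sx) => [ux|<-|ux].
- case: (signed_dot sv sx) => [vx|<-|vx]; first by rewrite reflmx_swap_id.
    by rewrite reflmx_swapr.
  have -> : x = - v by rewrite vx opprK.
  by rewrite mulmxN reflmx_swapr //; exact: signedN.
- by rewrite reflmx_swapl.
have -> : x = - u by rewrite ux opprK.
by rewrite mulmxN reflmx_swapl //; exact: signedN.
Qed.

Lemma root_basis a : is_root a ->
  exists i j c, [/\ i != j, c = 1 \/ c = -1 & reflmx a = reflmx (e i - c *: e j)].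
Proof.
move=> [x [y [[i xE] [j yE] xy ->]]].
have ij : i != j.
  apply/eqP => ij; move: xy; rewrite -ij in yE.
  case: xE yE => -> [->|->]; rewrite ?dotNl ?dotNr dot_basis basisE eqxx => /eqP;
    by rewrite ?oppr_eq0 oner_eq0.
case: xE yE => -> [->|->]; exists i, j.
- by exists 1; split => //; [left|rewrite scale1r].
- by exists (-1); split => //; [right|rewrite scaleN1r].
- by exists (-1); split => //; [right|rewrite scaleN1r opprK -reflmxN opprD !opprK].
- by exists 1; split => //; [left|rewrite scale1r -reflmxN opprD !opprK].
Qed.

Lemma even_signed_perm_refl a : is_root a -> even_signed_perm (reflmx a).
Proof.
move=> ra; have ma : monomial (reflmx a) by move=> x; exact: signed_reflmx.
split; rewrite ?reflmx_tr //; first exact: orthmx_refl.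
suff pa : pm1_preserving (reflmx a) by [].
have [i [j [c [ij c1 ->]]]] := root_basis ra.
have cc : c * c = 1 by case: c1 => ->; rewrite ?mulrNN mulr1.
move=> y py; set z := _ *m y.
have zE k : z k 0 = if k == i then c * y j 0 else if k == j then c * y i 0 else y k 0.
  have daa : dot (e i - c *: e j) (e i - c *: e j) = 2.
    rewrite !dotBl !dotBr !dotZl !dotZr !dot_basis !basisE !eqxx (negPf ij) eq_sym (negPf ij).
    by rewrite !mulr0 mulr1 !subr0 sub0r opprK cc.
  have -> : z k 0 = y k 0 - (y i 0 - c * y j 0) * ((k == i)%:R - c * (k == j)%:R).
    rewrite /z reflmxE daa mulrAC divff ?pnatr_eq0 // mul1r dotBl dotZl !dot_basis.
    by rewrite !mxE !andbT.
  have [->|ki] := eqVneq k i; first by rewrite (negPf ij) /=; ring.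
  have [->|kj] := eqVneq k j; last by rewrite /=; ring.
  by rewrite /= mulr1 sub0r mulrN opprK mulrBl mulrAC cc; ring.
have pmM (p q : R) : (p = 1 \/ p = -1) -> (q = 1 \/ q = -1) -> p * q = 1 \/ p * q = -1.
  by move=> [->|->] [->|->]; rewrite ?mulrNN ?mulr1 ?mul1r; by [left|right].
split.
  by move=> k; rewrite zE; case: ifP => _; [|case: ifP => _ //]; apply: pmM.
rewrite (bigD1 i) //= (bigD1 j) 1?eq_sym //= [in RHS](bigD1 i) //= [in RHS](bigD1 j) 1?eq_sym //=.
rewrite !zE eqxx (eq_sym j i) (negPf ij) eqxx.
rewrite (eq_bigr (fun k => y k 0)); last first.
  by move=> k /andP[/negPf ki /negPf kj]; rewrite zE ki kj.
set p := \prod_(_ | _) _.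
have -> : c * y j 0 * (c * y i 0 * p) = (c * c) * (y i 0 * (y j 0 * p)) by ring.
by rewrite cc mul1r.
Qed.

End SignedVectors.

(** * The group of type D: its reflections and its length function *)

Section GroupD.
Local Open Scope ring_scope.
Variables (R : realType) (n : nat).
Implicit Types (w u t r : 'M[R]_n) (x y a b v f : 'cV[R]_n) (c : R).
Local Notation e := (@basis_vec R n).
Local Notation W := (groupD R n).

Lemma groupD_mxgroup : mxgroup W.
Proof.
split.
- by move=> G [[G1 _ _] _].
- by move=> u v uW vW G GP; case: (GP) => -[_ GM _] _; apply: GM; [exact: uW|exact: vW].
- by move=> u uW G GP; case: (GP) => -[_ _ GV] _; apply: GV; exact: uW.
Qed.

Lemma groupD1 : W 1%:M. Proof. by case: groupD_mxgroup. Qed.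

Lemma groupDM u w : W u -> W w -> W (u *m w).
Proof. by case: groupD_mxgroup => _ h _; exact: h. Qed.

Lemma groupDV w : W w -> W (invmx w).
Proof. by case: groupD_mxgroup => _ _ h; exact: h. Qed.

Lemma groupD_gen i j (b : bool) : i != j ->
  W (reflmx (if b then e i - e j else e i + e j)).
Proof.
move=> ij G [_ GS]; apply: GS; exists i, j; split=> //.
by case: b; [left|right].
Qed.

Lemma groupD_root a : is_root a -> W (reflmx a).
Proof.
move=> /root_basis[i [j [c [ij [->|->] ->]]]].
  by rewrite scale1r; exact: (groupD_gen true).
by rewrite scaleN1r opprK; exact: (groupD_gen false).
Qed.

Lemma even_signed_perm1 : even_signed_perm (1%:M : 'M[R]_n).
Proof.
have m1 : @monomial R n 1%:M by move=> x sx; rewrite mul1mx.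
have p1 : @pm1_preserving R n 1%:M by move=> x sx; rewrite mul1mx.
by split; rewrite ?trmx1 //; exact: orthmx1.
Qed.

Lemma groupD_even w : W w -> even_signed_perm w.
Proof.
apply; split.
  split; [exact: even_signed_perm1|exact: even_signed_permM|].
  move=> u eu; have [ou [mu mu'] [pu pu']] := eu; rewrite orthmx_inv //.
  by split; rewrite ?trmxK //; exact: orthmx_tr.
move=> r [i [j [ij rE]]]; case: rE => ->; apply: even_signed_perm_refl.
  exists (e i), (e j); split=> //; try exact: signed_basis.
  by rewrite dot_basis basisE (negPf ij).
exists (e i), (- e j); rewrite opprK; split=> //; try exact: signed_basis.
  by apply: signedN; exact: signed_basis.
by rewrite dotNr dot_basis basisE (negPf ij) oppr0.
Qed.

Lemma groupD_orth w : W w -> orthmx w.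
Proof. by move=> /groupD_even[]. Qed.

Lemma groupD_signed w x : W w -> signed x -> signed (w *m x).
Proof. by move=> /groupD_even[_ [h _] _]; exact: h. Qed.

Lemma groupD_is_root w a : W w -> is_root a -> is_root (w *m a).
Proof.
move=> wW [x [y [sx sy xy ->]]]; exists (w *m x), (w *m y).
split; [exact: groupD_signed|exact: groupD_signed| |by rewrite mulmxBr].
by rewrite dot_orth //; exact: groupD_orth.
Qed.

(** This reflection changes a single sign, which the all-ones vector detects. *)
Lemma groupD_nbasis i : ~ W (reflmx (e i)).
Proof.
move=> /groupD_even[_ _ [h _]].
have [|_] := h (const_mx 1); first by move=> k; left; rewrite mxE.
have E k : (reflmx (e i) *m (const_mx 1 : 'cV[R]_n)) k 0 = if k == i then -1 else 1 :> R.
  rewrite reflmxE !dot_basis basisE eqxx !mxE andbT.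
  by case: eqP => _; rewrite ?mulr0 ?subr0 // !mulr1 divr1; ring.
rewrite (eq_bigr _ (fun k _ => E k)) (bigD1 i) //= eqxx big1 => [|k /negPf ->] //.
rewrite big1 => [|k _]; last by rewrite mxE.
by rewrite mulr1 => /eqP; rewrite -subr_eq0 -opprD oppr_eq0 -[1 + 1]/(2%:R) pnatr_eq0.
Qed.

(** If the i-th coordinate of [a] is nonzero, the reflection moves [e i] along [a] to another signed
    vector, so [a] is proportional to a difference of signed vectors. The image [- e i] is excluded
    by [groupD_nbasis]. *)
Lemma groupD_root_vector a : root_vectors W a ->
  exists2 b, is_root b & exists2 c, c != 0 & a = c *: b.
Proof.
move=> [a0 Wa].
have [i ai] : exists i, a i 0 != 0.
  apply: contrapT => h; move/eqP: a0; apply; apply/matrixP => i j.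
  by rewrite ord1 mxE; apply/eqP/negPn/negP => ai; apply: h; exists i.
have := groupD_signed Wa (signed_basis R i); rewrite reflmxE.
rewrite dotC dot_basis; set c := (X in X *: a) => sr.
have c0 : c != 0.
  by rewrite /c !mulf_neq0 ?invr_eq0 ?dot_eq0 ?pnatr_eq0.
have aE : a = c^-1 *: (e i - (e i - c *: a)).
  by rewrite opprB addrC subrK scalerA mulVf // scale1r.
case: (signed_dot (signed_basis R i) sr) => h.
- exists (e i - (e i - c *: a)); first by exists (e i), (e i - c *: a); split=> //; exact: signed_basis.
  by exists c^-1; rewrite ?invr_eq0.
- by move/eqP: a0; case; rewrite aE -h subrr scaler0.
exfalso; apply: (@groupD_nbasis i).
have aE2 : a = (c^-1 * 2) *: e i.
  have sE : e i - c *: a = - e i by rewrite [in RHS]h opprK.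
  by rewrite {1}aE sE opprK -scalerA -[2%:R]/(1 + 1) scalerDl scale1r.
by rewrite -(@reflmxZ R n (c^-1 * 2)) -?aE2 // mulf_neq0 ?invr_eq0 ?pnatr_eq0.
Qed.

Lemma reflectionsE r : reflections W r <-> exists2 a, is_root a & r = reflmx a.
Proof.
split=> [[a /groupD_root_vector[b rb [c c0 ->]] <-]|[a ra ->]].
  by exists b => //; rewrite reflmxZ.
by exists a => //; split; [exact: root_neq0|exact: groupD_root].
Qed.

Lemma moved_root_signed w x : W w -> signed x -> dot x (w *m x) = 0 ->
  is_root (w *m x - x) /\ moved w (w *m x - x).
Proof.
move=> wW sx xwx; split; last by exists x; rewrite addrC subrK.
by exists (w *m x), x; rewrite dotC; split=> //; exact: groupD_signed.
Qed.

Lemma diagonal_moved w x y : signed x -> signed y -> dot x y = 0 ->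
  w *m x = - x -> w *m y = - y -> is_root (x - y) /\ moved w (x - y).
Proof.
move=> sx sy xy wx wy; split; first by exists x, y.
exists (- 2^-1 *: (x - y)); rewrite -scalemxAr mulmxBr wx wy.
by apply/matrixP => i j; rewrite !mxE; field.
Qed.

(** Either some [e i] goes to an orthogonal vector and w (e i) - e i is a moved root, or [w] is
    diagonal. In the second case a sign -1 occurs, by evenness a second one does too, and the
    difference of the two basis vectors is moved. *)
Lemma exists_moved_root w : W w -> w != 1%:M -> exists2 a, is_root a & moved w a.
Proof.
move=> wW w1.
have [[i h]|nd] := pselect (exists i, dot (e i) (w *m e i) = 0).
  have [r m] := moved_root_signed wW (signed_basis R i) h.
  by exists (w *m e i - e i).
have dg i : w *m e i = e i \/ w *m e i = - e i.
  case: (signed_dot (groupD_signed wW (signed_basis R i)) (signed_basis R i)); [|by left|by right].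
  by rewrite dotC => h; case: nd; exists i.
have [i wi] : exists i, w *m e i = - e i.
  apply: contrapT => h; move/eqP: w1; apply; apply: mulmx_basis_ext => i.
  by rewrite mul1mx; case: (dg i) => // wi; case: h; exists i.
have [[j [ji wj]]|h] := pselect (exists j, j != i /\ w *m e j = - e j).
  have ij : dot (e i) (e j) = 0 by rewrite dot_basis basisE eq_sym (negPf ji).
  have [r m] := diagonal_moved (signed_basis R i) (signed_basis R j) ij wi wj.
  by exists (e i - e j).
case: (@groupD_nbasis i); suff <- : w = reflmx (e i) by [].
apply: mulmx_basis_ext => j; rewrite reflmxE !dot_basis !basisE eqxx.
have [<-|ij] := eqVneq i j.
  rewrite wi mulr1 divr1 -[2%:R]/(1 + 1) scalerDl scale1r opprD addrA subrr.
  by rewrite add0r.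
rewrite mulr0 mul0r scale0r subr0; case: (dg j) => // wj.
by case: h; exists j; rewrite eq_sym.
Qed.

Lemma codim_mxprod (s : seq 'M[R]_n) :
  (forall r, r \in s -> reflections W r) -> (codim (mxprod s) <= size s)%N.
Proof.
elim: s => [|r s IH] h; first by rewrite /mxprod big_nil codim1.
rewrite /mxprod big_cons; apply: leq_trans (codimM _ _) _.
rewrite /= -add1n leq_add //; last by apply: IH => t ts; apply: h; rewrite inE ts orbT.
have /reflectionsE[a _ ->] : reflections W r by apply: h; rewrite mem_head.
exact: codim_refl_le.
Qed.

Lemma codim_factor w : W w -> refl_product W (codim w) w.
Proof.
move: {2}(codim w) (erefl (codim w)) => k; elim: k w => [|k IH] w kE wW.
  by exists [::]; rewrite kE (codim_eq0 kE) /mxprod big_nil.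
have [|a ra ma] := exists_moved_root wW.
  by apply/eqP => w1; move: kE; rewrite w1 codim1.
have := codim_refl_moved (groupD_orth wW) (root_neq0 ra) ma.
rewrite kE => -[k1].
have [] := IH _ k1 (groupDM (groupD_root ra) wW).
rewrite k1 => s [<- hs wE]; exists (reflmx a :: s); split=> //.
  move=> r; rewrite inE => /predU1P[->|]; last exact: hs.
  by apply/reflectionsE; exists a.
by rewrite /mxprod big_cons -/(mxprod s) -wE mulmxA reflmxK mul1mx.
Qed.

(** Carter's lemma for this group: codimension is subadditive, so no factorization is shorter, and
    splitting off moved roots produces one of exactly this length. *)
Lemma refl_lengthE w : W w -> refl_length W w = codim w.
Proof.
move=> wW; have [s [sz hs wE]] := codim_factor wW.
have min k : refl_product W k w -> (codim w <= k)%N.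
  by move=> [s' [<- hs' ->]]; exact: codim_mxprod.
rewrite /refl_length; case: xgetP => [k _ [pk hk]|/(_ (codim w))].
  by apply/eqP; rewrite eqn_leq min // hk //; exists s.
by case; split=> //; exists s.
Qed.

Lemma refl_leE u w : W u -> W w ->
  refl_le W u w <-> codim w = (codim u + codim (invmx u *m w))%N.
Proof.
move=> uW wW; have vW := groupDM (groupDV uW) wW.
by rewrite /refl_le !refl_lengthE //; split=> [[]|h].
Qed.

End GroupD.

(** * Reduced factorizations below an element *)

Section Factorizations.
Local Open Scope ring_scope.
Variables (R : realType) (n : nat).
Implicit Types (w u t r g : 'M[R]_n) (x y a b v : 'cV[R]_n) (s : seq 'M[R]_n).
Local Notation W := (groupD R n).
Local Notation T := (@reflmx R n).

(** The order [refl_le] in terms of ranks, with the transpose as the inverse; see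
    [below_refl_le]. *)
Definition below u w : Prop :=
  [/\ W u, W w & codim w = (codim u + codim (u^T *m w))%N].

Lemma below_refl_le u w : refl_le W u w <-> below u w.
Proof.
split=> [h|[uW wW h]]; last by apply/refl_leE => //; rewrite orthmx_inv //; exact: groupD_orth.
have [uW wW _] := h; split=> //.
by have /(refl_leE uW wW) := h; rewrite orthmx_inv //; exact: groupD_orth.
Qed.

Lemma groupD_tr w : W w -> W w^T.
Proof. by move=> wW; rewrite -orthmx_inv; [exact: groupDV|exact: groupD_orth]. Qed.

Lemma mulmx_trK u w : W u -> u *m (u^T *m w) = w.
Proof. by move=> /groupD_orth h; rewrite mulmxA (mulmx1C h) mul1mx. Qed.

Lemma below_codimW u w : W u -> W w ->
  (codim u + codim (u^T *m w) <= codim w)%N -> below u w.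
Proof.
move=> uW wW h; split=> //; apply/eqP; rewrite eqn_leq h andbT.
by rewrite -{1}(mulmx_trK w uW) codimM.
Qed.

Lemma below_trans w u g : below u w -> below w g -> below u g.
Proof.
move=> [uW wW e1] [_ gW e2]; apply: below_codimW => //.
have -> : u^T *m g = (u^T *m w) *m (w^T *m g) by rewrite -mulmxA mulmx_trK.
by have := codimM (u^T *m w) (w^T *m g); lia.
Qed.

Lemma below_quotient w u g : below u w -> below w g -> below (u^T *m w) g.
Proof.
move=> [uW wW e1] [_ gW e2].
have xW : W (u^T *m w) by apply: groupDM => //; exact: groupD_tr.
apply: below_codimW => //.
(* The second factor is a conjugate of [u], so its codimension is that of [u]. *)
have -> : (u^T *m w)^T *m g = (w^T *m g) *m (g^T *m u *m g).
  by rewrite trmx_mul trmxK -!mulmxA mulmx_trK.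
have := codimM (w^T *m g) (g^T *m u *m g).
have := codim_conj u (orthmx_tr (groupD_orth gW)); rewrite trmxK => ->.
by lia.
Qed.

Lemma below_refl w : W w -> below w w.
Proof. by move=> wW; split=> //; rewrite (groupD_orth wW) codim1 addn0. Qed.

Lemma below_refl_moved a w : is_root a -> W w -> below (T a) w <-> moved w a.
Proof.
move=> ra wW; have a0 := root_neq0 ra; split=> [[_ _]|m].
  rewrite reflmx_tr codim_refl // => h; apply: moved_codim_refl => //; lia.
apply: below_codimW => //; first exact: groupD_root.
by rewrite reflmx_tr codim_refl // -(codim_refl_moved (groupD_orth wW) a0 m).
Qed.

Lemma below_refl2 a b w : is_root a -> is_root b -> W w ->
  below (T a *m T b) w /\ codim (T a *m T b) = 2%N <->
  (codim (T b *m (T a *m w))).+2 = codim w.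
Proof.
move=> ra rb wW; have trE : (T a *m T b)^T *m w = T b *m (T a *m w).
  by rewrite trmx_mul !reflmx_tr mulmxA.
have abW : W (T a *m T b) by apply: groupDM; exact: groupD_root.
split=> [[[_ _]]|e]; first by rewrite trE => -> ->.
have cl : (codim (T a *m T b) <= 2)%N.
  by apply: leq_trans (codimM _ _) _; rewrite !codim_refl //; exact: root_neq0.
have wE : codim w = codim ((T a *m T b) *m (T b *m (T a *m w))).
  by rewrite -trE mulmx_trK.
have := codimM (T a *m T b) (T b *m (T a *m w)); rewrite -wE => h.
have c2 : codim (T a *m T b) = 2%N by lia.
by split=> //; split=> //; rewrite trE; lia.
Qed.

Definition factors s w : Prop :=
  [/\ forall r, r \in s -> reflections W r, mxprod s = w & size s = codim w].

Lemma factorsP w : W w -> exists s, factors s w.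
Proof. by move=> /codim_factor[s [sz hs wE]]; exists s. Qed.

Lemma factors_nil w : factors [::] w -> w = 1%:M.
Proof. by move=> [_ <- _]; rewrite /mxprod big_nil. Qed.

Lemma factors_consP t s w : W w ->
  factors (t :: s) w <->
  exists a, [/\ t = T a, is_root a, moved w a & factors s (T a *m w)].
Proof.
move=> wW; split=> [[hs wE sz]|[a [-> ra ma [hs wE sz]]]].
  have /reflectionsE[a ra tE] := hs t (mem_head _ _); exists a.
  have hs' r : r \in s -> reflections W r by move=> rs; apply: hs; rewrite inE rs orbT.
  have sE : mxprod s = T a *m w.
    by rewrite -wE tE /mxprod big_cons mulmxA reflmxK mul1mx.
  have ma : moved w a.
    apply: moved_codim_refl; first exact: root_neq0.
    by rewrite -sE -sz /= ltnS; exact: codim_mxprod.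
  split=> //; split=> //; apply/eqP; rewrite -eqSS.
  by rewrite (codim_refl_moved (groupD_orth wW) (root_neq0 ra) ma) -sz.
split.
- by move=> r; rewrite inE => /predU1P[->|/hs//]; apply/reflectionsE; exists a.
- by rewrite /mxprod big_cons -/(mxprod s) wE mulmxA reflmxK mul1mx.
- by rewrite /= sz (codim_refl_moved (groupD_orth wW) (root_neq0 ra) ma).
Qed.

Lemma mxprod_cat s1 s2 : mxprod (s1 ++ s2) = mxprod s1 *m mxprod s2.
Proof.
rewrite /mxprod; elim: s1 => [|r s IH]; first by rewrite big_nil mul1mx.
by rewrite /= !big_cons IH mulmxA.
Qed.

Lemma factors_cat s1 s2 u w : below u w -> factors s1 u ->
  factors s2 (u^T *m w) -> factors (s1 ++ s2) w.
Proof.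
move=> [uW wW e] [h1 p1 z1] [h2 p2 z2]; split.
- by move=> r; rewrite mem_cat => /orP[/h1|/h2].
- by rewrite mxprod_cat p1 p2 mulmx_trK.
- by rewrite size_cat z1 z2 -e.
Qed.

Lemma root_through x b : signed x -> is_root b -> dot b x <> 0 ->
  exists z, [/\ signed z, dot x z = 0 & b = x - z \/ b = z - x].
Proof.
move=> sx [p [q [sp sq pq bE]]]; rewrite bE dotBl => bx.
case: (signed_dot sx sp) => [xp|xE|xE].
- case: (signed_dot sx sq) => [xq|xE|xE].
  + by case: bx; rewrite !(dotC _ x) xp xq subrr.
  + by exists p; split; [|rewrite xE dotC|right; rewrite xE].
  + by exists (- p); split; [exact: signedN|rewrite dotNr xp oppr0|left; rewrite xE opprK addrC].
- by exists q; split; [|rewrite xE|left; rewrite xE].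
- exists (- q); split; [exact: signedN|by rewrite xE dotNl dotNr pq !oppr0|].
  by right; rewrite xE opprK addrC.
Qed.

Lemma root_dot2 x y b : signed x -> signed y -> dot x y = 0 -> is_root b ->
  dot b x <> 0 -> dot b y <> 0 -> T b = T (y - x) \/ T b = T (y + x).
Proof.
move=> sx sy xy rb bx bY; have [z [sz xz bE]] := root_through sx rb bx.
have TE : T b = T (x - z) by case: bE => -> //; rewrite -opprB reflmxN.
rewrite TE; case: (signed_dot sz sy) => [zy|->|->].
- by case: bY; case: bE => ->; rewrite dotBl xy zy subrr.
- by left; rewrite -opprB reflmxN.
- by right; rewrite opprK addrC.
Qed.

Lemma moved_neg x a w : W w -> moved w a -> signed x -> dot a x <> 0 ->
  w *m x = x \/ w *m x = - x -> w *m x = - x.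
Proof.
by move=> wW [v wv] sx ax [wx|//]; case: ax; apply: moved_orth wv wx; exact: groupD_orth.
Qed.

Lemma moved_of_neg a w : w *m a = - a -> moved w a /\ w *m (- 2^-1 *: a) = - 2^-1 *: a + a.
Proof.
move=> wa; suff h : w *m (- 2^-1 *: a) = - 2^-1 *: a + a by split=> //; exists (- 2^-1 *: a).
by rewrite -scalemxAr wa; apply/matrixP => i j; rewrite !mxE; field.
Qed.

(** * Independence of the product from the reduced factorization *)

Section Transfer.
Variables (G : groupType) (phi : 'M[R]_n -> G) (g : 'M[R]_n).
Hypothesis phi_dual : forall a b, is_root a -> is_root b ->
  (codim (T b *m (T a *m g))).+2 = codim g ->
  (phi (T a) * phi (T b) = phi (T b) * phi (T b *m T a *m T b))%g.
Hypothesis no_neg3 : forall w x y z, below w g ->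
  signed x -> signed y -> signed z -> dot x y = 0 -> dot x z = 0 -> dot y z = 0 ->
  w *m x = - x -> w *m y = - y -> w *m z = - z -> False.

Definition factor_value s : G := (\prod_(r <- s) phi r)%g.

(* In the induction step, [Q a b] says that factorizations starting with [T a] and [T b]
   have the same value; all letters are linked to the reflection in [w x - x]. *)
Lemma factor_value_unique w : below w g ->
  forall s s', factors s w -> factors s' w -> factor_value s = factor_value s'.
Proof.
have [k] := ubnP (codim w); elim: k w => // k IHk w; rewrite ltnS => wk wg.
have wW : W w by case: wg.
have ow := groupD_orth wW; have gW : W g by case: wg.
pose Q a b := forall s s', factors s (T a *m w) -> factors s' (T b *m w) ->
  (phi (T a) * factor_value s = phi (T b) * factor_value s')%g.
have IH u a s s' : is_root a -> moved w a -> u = T a *m w ->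
    factors s u -> factors s' u -> factor_value s = factor_value s'.
  move=> ra ma ->; apply: IHk.
    by rewrite (leq_trans _ wk) // (codim_refl_moved ow (root_neq0 ra) ma).
  have := below_quotient (iffRL (below_refl_moved ra wW) ma) wg.
  by rewrite reflmx_tr.
have Qrefl a b : is_root a -> moved w a -> T a = T b -> Q a b.
  move=> ra ma Tab s s'; rewrite -Tab => fs fs'; congr (_ * _)%g.
  exact: (IH _ _ _ _ ra ma erefl fs fs').
have Qsym a b : Q a b -> Q b a by move=> q s s' fs fs'; rewrite (q s' s).
have Qtrans b a c : is_root b -> Q a b -> Q b c -> Q a c.
  move=> rb qab qbc s s' fs fs'.
  have [t ft] := factorsP (groupDM (groupD_root rb) wW).
  by rewrite (qab s t) // (qbc t s').
have moved2 a b : is_root a -> is_root b -> moved w a ->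
    (codim (T b *m (T a *m w))).+2 = codim w -> moved w b /\ moved (T a *m w) b.
  move=> ra rb [v wv] e; split.
    by have [] := iffLR (codim_refl2 ow wv (root_neq0 ra) (root_neq0 rb)) e.
  apply: moved_codim_refl; first exact: root_neq0.
  have := codim_refl_moved ow (root_neq0 ra); rewrite -e => /(_ (ex_intro _ v wv)) [->].
  by [].
have adj a b : is_root a -> is_root b -> moved w a ->
    (codim (T b *m (T a *m w))).+2 = codim w -> Q a b.
  move=> ra rb ma e s s' fs fs'.
  have [mb mab] := moved2 _ _ ra rb ma e.
  have aW := groupD_root ra; have bW := groupD_root rb.
  have [t ft] := factorsP (groupDM bW (groupDM aW wW)).
  have ftb : factors (T b :: t) (T a *m w).
    by apply/factors_consP; [exact: groupDM|exists b].
  (* With a common tail [t], w = T a T b t = T b T c t. The induction hypothesis replaces the given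
     tails by these, and [phi_dual] compares the two initial pairs. *)
  pose c := T b *m a; have rc : is_root c by exact: groupD_is_root.
  have TcE : T c = T b *m T a *m T b.
    by rewrite /c -reflmx_conj ?reflmx_tr //; exact: orthmx_refl.
  have cbw : T c *m (T b *m w) = T b *m (T a *m w).
    by rewrite TcE -!mulmxA (mulmxA (T b) (T b) w) reflmxK mul1mx.
  have ftc : factors (T c :: t) (T b *m w).
    apply/factors_consP; first exact: groupDM.
    exists c; split; rewrite ?cbw //; apply: moved_codim_refl; first exact: root_neq0.
    rewrite cbw; have := codim_refl_moved ow (root_neq0 rb) mb.
    by rewrite -e => -[->].
  rewrite (IH _ _ _ _ ra ma erefl fs ftb) (IH _ _ _ _ rb mb erefl fs' ftc).
  rewrite /factor_value !big_cons !mulgA TcE; congr (_ * _)%g.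
  apply: phi_dual => //; apply/below_refl2 => //.
  have [uw u2] := iffRL (below_refl2 ra rb wW) e.
  by split=> //; exact: below_trans wg.
have conn a b : is_root a -> moved w a -> is_root b -> moved w b -> Q a b.
  have [[x [sx xwx]]|nd] := pselect (exists x, signed x /\ dot x (w *m x) = 0).
    have [ra0 ma0] := moved_root_signed wW sx xwx.
    set a0 := w *m x - x in ra0 ma0.
    have wx : w *m x = x + a0 by rewrite addrC subrK.
    have swx : signed (w *m x) by exact: groupD_signed.
    (* The vector [x] is a preimage of [a0], so [c] is adjacent to [a0] as soon as it is orthogonal
       to [x] or to [w *m x]. A root orthogonal to neither is, up to sign, the difference or the sum
       of these two vectors, and the difference is [a0] itself. *)
    have hub c : is_root c -> moved w c ->
        Q a0 c \/ T c = T (w *m x + x).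
      move=> rc mc.
      have [cx|cx] := pselect (dot c x = 0).
        left; apply: adj => //.
        by apply/(codim_refl2 ow wx) => //; exact: root_neq0.
      have [cwx|cwx] := pselect (dot c (w *m x) = 0).
        left; apply: Qsym; apply: adj => //.
        by apply: (codim_refl2' ow wx) => //; exact: root_neq0.
      have [Tc|] := root_dot2 sx swx xwx rc cx cwx; last by right.
      by left; apply: Qrefl => //; rewrite Tc.
    have hub_all c : is_root c -> moved w c -> Q a0 c.
      move=> rc mc; have [//|Tc] := hub c rc mc.
      have cW := groupDM (groupD_root rc) wW.
      have cw := codim_refl_moved ow (root_neq0 rc) mc.
      (* For the exceptional [c], the first letter of a factorization of [T c *m w] is a neighbour
         of [c]. It differs from [T c], since otherwise the codimension would not drop by two, hence
         it is linked to [a0]. If there is no letter, [w] is a single reflection. *)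
      have [[|t s] fs] := factorsP cW.
        have w1 := factors_nil fs; have wE : w = T c.
          by rewrite -[LHS]mul1mx -(reflmxK c) -mulmxA w1 mulmx1.
        apply: Qrefl => //; rewrite -wE.
        have : codim (T a0 *m w) = 0%N.
          apply/eqP; rewrite -eqSS (codim_refl_moved ow (root_neq0 ra0) ma0).
          by rewrite wE codim_refl //; exact: root_neq0.
        by move=> /codim_eq0 e; rewrite -[RHS]mul1mx -(reflmxK a0) -mulmxA e mulmx1.
      have [d [_ rd md _]] := iffLR (factors_consP _ _ cW) fs.
      have e : (codim (T d *m (T c *m w))).+2 = codim w.
        rewrite -cw; congr _.+1; apply: codim_refl_moved => //.
          exact: groupD_orth.
        exact: root_neq0.
      have [mwd _] := moved2 _ _ rc rd mc e.
      have Qcd := adj _ _ rc rd mc e.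
      have [Qd|Td] := hub d rd mwd; first exact: Qtrans rd Qd (Qsym _ _ Qcd).
      by move: e; rewrite Td -Tc mulmxA reflmxK mul1mx; lia.
    by move=> ra ma rb mb; apply: (Qtrans a0) => //; [apply: Qsym|]; exact: hub_all.
  (* The diagonal case: a moved root is a difference of two negated signed vectors, and by [no_neg3]
     there is room for only one such pair up to sign. The moved reflections are then among those in
     z - y and z + y, which are orthogonal roots and therefore adjacent if both occur. *)
  have dg x : signed x -> w *m x = x \/ w *m x = - x.
    move=> sx; case: (signed_dot (groupD_signed wW sx) sx); [|by left|by right].
    by rewrite dotC => h; case: nd; exists x.
  move=> ra ma rb mb.
  have [y [z [sy sz yz aE]]] := ra.
  have ay : dot a y <> 0.
    by rewrite aE dotBl (signed_norm sy) dotC yz subr0; apply/eqP; rewrite oner_eq0.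
  have az : dot a z <> 0.
    by rewrite aE dotBl (signed_norm sz) yz sub0r; apply/eqP; rewrite oppr_eq0 oner_eq0.
  have wy := moved_neg wW ma sy ay (dg y sy).
  have wz := moved_neg wW ma sz az (dg z sz).
  have wa : w *m a = - a by rewrite aE mulmxBr wy wz opprB addrC opprK.
  have [_ wv] := moved_of_neg wa.
  have [ab|ab] := pselect (dot b a = 0).
    apply: adj => //; apply/(codim_refl2 ow wv); try exact: root_neq0.
    by rewrite dotZr ab mulr0.
  apply: Qrefl => //.
  have [p [q [sp sq pq bE]]] := rb.
  have bp : dot b p <> 0.
    by rewrite bE dotBl (signed_norm sp) dotC pq subr0; apply/eqP; rewrite oner_eq0.
  have bq : dot b q <> 0.
    by rewrite bE dotBl (signed_norm sq) pq sub0r; apply/eqP; rewrite oppr_eq0 oner_eq0.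
  (* A negated [x] orthogonal to [b] would be orthogonal to [p] and to [q], giving three negated
     mutually orthogonal vectors. *)
  have neg_dot x : signed x -> w *m x = - x -> dot b x <> 0.
    move=> sx wx bx.
    have xu (u : 'cV[R]_n) : signed u -> dot b u <> 0 -> dot x u = 0.
      move=> su bu; case: (signed_dot sx su) => // xE; case: bu.
        by rewrite -xE.
      by rewrite -[u]opprK -xE dotNr bx oppr0.
    apply: (no_neg3 wg sx sp sq) => //; try exact: xu.
      exact: (moved_neg wW mb sp bp (dg p sp)).
    exact: (moved_neg wW mb sq bq (dg q sq)).
  have [->|Tb] := root_dot2 sy sz yz rb (neg_dot y sy wy) (neg_dot z sz wz).
    by rewrite aE -opprB reflmxN.
  have rzy : is_root (z + y).
    exists z, (- y); split=> //; [exact: signedN|by rewrite dotNr dotC yz oppr0|by rewrite opprK].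
  case: ab; have [->|->] := reflmx_eq (root_norm rb) (root_norm rzy) Tb.
    by rewrite aE dotDl !dotBr (signed_norm sy) (signed_norm sz) (dotC z) yz; ring.
  by rewrite aE dotNl dotDl !dotBr (signed_norm sy) (signed_norm sz) (dotC z) yz; ring.
move=> [|t s] [|t' s'] fs fs'; rewrite /factor_value ?big_nil //.
- by case: fs => _ _ /= e; case: fs' => _ _ /=; rewrite -e.
- by case: fs' => _ _ /= e; case: fs => _ _ /=; rewrite -e.
have [a [-> ra ma fa]] := iffLR (factors_consP _ _ wW) fs.
have [b [-> rb mb fb]] := iffLR (factors_consP _ _ wW) fs'.
by rewrite !big_cons; apply: conn.
Qed.

End Transfer.
End Factorizations.

(** * Coxeter frames *)

(** The dual relations in terms of indices, [B p q] and [C p] standing for the reflections in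
    [v p - v q] and [f0 - v p]. Each field is one relative position of two noncrossing arcs, where
    [B p q] joins two points of a circle and [C p] joins a point to the centre. *)
Record dual_system (N : nat) (G : groupType) (B : nat -> nat -> G) (C : nat -> G) : Prop :=
  DualSystem {
    dual_B_tri p q r : p < q -> q < r -> r < p + N ->
      (B p q * B q r = B q r * B p r /\ B p r * B p q = B p q * B q r)%g;
    dual_B_disjoint p q r t : p < q -> q < r -> r < t -> t < p + N ->
      commute (B p q) (B r t);
    dual_B_nested p q r t : p < r -> r < t -> t < q -> q < p + N ->
      commute (B p q) (B r t);
    dual_C_tri p q : p < q -> q < p + N ->
      (C p * B p q = B p q * C q /\ C q * C p = C p * B p q)%g;
    dual_C_B p r t : p < r -> r < t -> t < p + N -> commute (C p) (B r t);
    dual_C_C p : commute (C p) (C (p + N))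
  }.

Section Frame.
Local Open Scope ring_scope.
Variables (R : realType) (n N : nat).
Local Notation W := (groupD R n).
Local Notation T := (@reflmx R n).

(* [g] acts as the signed permutation [f0][v 0, ..., v (N-1)], in the notation of the paper. *)
Record coxeter_frame (g : 'M[R]_n) (f0 : 'cV[R]_n) (v : nat -> 'cV[R]_n) : Prop :=
  CoxeterFrame {
    frame_gt0 : (0 < N)%N;
    frame_group : W g;
    frame_center : g *m f0 = - f0;
    frame_next p : g *m v p = v p.+1;
    frame_half p : v (p + N)%N = - v p;
    frame_signed0 : signed f0;
    frame_signed p : signed (v p);
    frame_orth0 p : dot f0 (v p) = 0;
    frame_orth p q : (p < q)%N -> (q < p + N)%N -> dot (v p) (v q) = 0;
    frame_complete x : signed x -> [\/ x = f0, x = - f0 | exists p, x = v p]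
  }.

Variables (g : 'M[R]_n) (f0 : 'cV[R]_n) (v : nat -> 'cV[R]_n).
Hypothesis fr : coxeter_frame g f0 v.

Let N_gt0 : (0 < N)%N := frame_gt0 fr.
Let vN p : v (p + N)%N = - v p := frame_half fr p.
Let sf0 : signed f0 := frame_signed0 fr.
Let sv p : signed (v p) := frame_signed fr p.
Let f0v p : dot f0 (v p) = 0 := frame_orth0 fr p.
Let vv p q : (p < q)%N -> (q < p + N)%N -> dot (v p) (v q) = 0 := @frame_orth _ _ _ fr p q.
Let vf0 p : dot (v p) f0 = 0. Proof. by rewrite dotC. Qed.
Let v1 p : dot (v p) (v p) = 1. Proof. exact: signed_norm. Qed.
Let f01 : dot f0 f0 = 1. Proof. exact: signed_norm. Qed.

Let vNN p : v (p + N + N)%N = v p. Proof. by rewrite !vN opprK. Qed.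

Let TB p q := T (v p - v q).
Let TC p := T (f0 - v p).

Let vv_ne p q : (p <= q)%N -> (q < p + N + N)%N -> q <> p -> q <> (p + N)%N ->
  dot (v p) (v q) = 0.
Proof.
move=> pq qN n1 n2; have [h|h] := ltnP q (p + N); first by apply: vv => //; lia.
have qE : q = (q - N + N)%N by lia.
by rewrite qE vN dotNr vv ?oppr0 //; lia.
Qed.

(** Congruence modulo [M] is witnessed by multiples added on both sides, which avoids negative
    numbers. In the witness, the summand [p * M] makes the truncated subtraction of [p] exact. *)
Let window m M p : (0 < M)%N -> exists r k l,
  (p <= r < p + M)%N /\ (m + k * M = r + l * M)%N.
Proof.
move=> M0; exists (p + (m + p * M - p) %% M)%N, p, ((m + p * M - p) %/ M)%N; split.
  by rewrite leq_addr ltn_add2l ltn_mod.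
have h : (p <= m + p * M)%N by nia.
by have := divn_eq (m + p * M - p) M; lia.
Qed.

Let v_shift p k : v (p + k * (N + N))%N = v p.
Proof.
elim: k => [|k IH]; first by rewrite addn0.
by rewrite (_ : _ + _ = p + k * (N + N) + N + N)%N ?vNN // mulSn; lia.
Qed.

Let TB_shift p q k : TB (p + k * N) (q + k * N) = TB p q.
Proof.
elim: k => [|k IH]; first by rewrite !addn0.
rewrite mulSn !(addnCA _ N) !(addnC N) /TB !vN -opprD reflmxN -[RHS]IH.
by [].
Qed.

Lemma frame_reflB_window r s p : (r < s)%N -> (s < r + N)%N -> exists r' s',
  [/\ (p <= r' < p + N)%N, (r' < s')%N, (s' < r' + N)%N & TB r s = TB r' s'].
Proof.
move=> rs sN; have [r' [k [l [h e]]]] := window r p N_gt0.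
exists r', (r' + (s - r))%N; split; [by []|lia|lia|].
by rewrite -(TB_shift r s k) -(TB_shift r' _ l) -e; congr TB; lia.
Qed.

Lemma frame_window m p : exists r, (p <= r < p + N + N)%N /\ v m = v r.
Proof.
have NN : (0 < N + N)%N by lia.
have [r [k [l [h e]]]] := window m p NN; exists r; split; first by rewrite -addnA.
by rewrite -(v_shift m k) e v_shift.
Qed.

Lemma frame_root_cases a : is_root a ->
  (exists r s, [/\ (r < s)%N, (s < r + N)%N & T a = TB r s]) \/
  (exists r, T a = TC r).
Proof.
move=> [x [y [sx sy xy ->]]].
have nf z : signed z -> z = f0 \/ z = - f0 \/ exists p, z = v p.
  by move=> sz; case: (frame_complete fr sz); tauto.
have ne0 : (1 : R) <> 0 by apply/eqP; rewrite oner_eq0.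
have nf1 : - (1 : R) <> 0 by apply/eqP; rewrite oppr_eq0 oner_eq0.
case: (nf x sx) (nf y sy) xy => [->|[->|[p ->]]] [->|[->|[m ->]]];
  rewrite ?dotNl ?dotNr ?opprK ?f01 // => xy.
- by right; exists m.
- by right; exists (m + N)%N; rewrite /TC vN -reflmxN opprD !opprK.
- by right; exists p; rewrite /TC -reflmxN opprB.
- by right; exists (p + N)%N; rewrite /TC vN !opprK addrC.
have [s [/andP[ps sN] ms]] := frame_window m p; rewrite ms in xy *; left.
have sp : s <> p by move=> e; move: xy; rewrite e v1.
have spN : s <> (p + N)%N by move=> e; move: xy; rewrite e vN dotNr v1.
have [h|h] := ltnP s (p + N); first by exists p, s; split=> //; lia.
exists s, (p + N + N)%N; split; try lia.
by rewrite /TB vNN -reflmxN opprB.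
Qed.

(** The source of all preimages under g - 1: by telescoping, - S p q is one of [v p - v q], and half
    of S p (p + N) - f0 is one of [f0 - v p]. Inner products with these sums reduce adjacency below
    [g] to comparisons of indices. *)
Let S p q := \sum_(p <= m < q) v m.

Let g_S p q : (p <= q)%N -> g *m S p q = S p q + v q - v p.
Proof.
move=> pq; rewrite /S; elim: q pq => [|q IH].
  by rewrite leqn0 => /eqP ->; rewrite big_geq // mulmx0 add0r subrr.
rewrite leq_eqVlt => /orP[/eqP <-|]; first by rewrite big_geq // mulmx0 add0r subrr.
rewrite ltnS => pq; rewrite big_nat_recr //= mulmxDr IH // (frame_next fr).
by rewrite addrAC.
Qed.

Let dot_S p q r : (q <= p + N)%N -> (p <= r < p + N)%N -> dot (v r) (S p q) = (r < q)%:R.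
Proof.
move=> qN rp; rewrite /S dot_sumr; have [rq|rq] := ltnP r q.
  rewrite (bigD1_seq r) ?iota_uniq ?mem_index_iota /= ?v1; try lia.
  rewrite big_nat_cond big1 ?addr0 // => m /andP[mpq mr].
  by have [h|h] := ltnP r m; [apply: vv|rewrite dotC; apply: vv]; lia.
rewrite big_nat big1 // => m mpq.
by rewrite dotC; apply: vv; lia.
Qed.

Let dot_S' p q r : (q <= p + N)%N -> (p + N <= r < p + N + N)%N ->
  dot (v r) (S p q) = - (r - N < q)%:R.
Proof.
move=> qN rp; have rE : r = (r - N + N)%N by lia.
by rewrite {1}rE vN dotNl dot_S //; lia.
Qed.

Let preB p q : (p <= q)%N -> g *m (- S p q) = - S p q + (v p - v q).
Proof. by move=> pq; rewrite mulmxN g_S // !opprD opprK addrA addrAC. Qed.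

Let preC p : g *m (2^-1 *: (S p (p + N) - f0)) = 2^-1 *: (S p (p + N) - f0) + (f0 - v p).
Proof.
rewrite -scalemxAr mulmxBr g_S ?leq_addr // (frame_center fr) vN.
by apply/matrixP => i j; rewrite !mxE; field.
Qed.

Let ow : orthmx g. Proof. exact: groupD_orth (frame_group fr). Qed.

Let rootB p q : (p < q)%N -> (q < p + N)%N -> is_root (v p - v q).
Proof. by move=> pq qN; exists (v p), (v q); split=> //; exact: vv. Qed.

Let rootC p : is_root (f0 - v p).
Proof. by exists f0, (v p). Qed.

(** At most one of three orthogonal signed vectors is [f0] up to sign, so two of them lie on the
    long cycle, say [v p] and [v q]. Then the commuting reflections in [v p - v q] and [v p + v q]
    would have a product below [w], hence below [g], but <v p + v q, S p q> is 1 and not 0. *)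
Lemma frame_no_neg3 w x y z : below w g ->
  signed x -> signed y -> signed z -> dot x y = 0 -> dot x z = 0 -> dot y z = 0 ->
  w *m x = - x -> w *m y = - y -> w *m z = - z -> False.
Proof.
move=> wg sx sy sz xy xz yz wx wy wz.
have wW : W w by case: wg.
have two p m : dot (v p) (v m) = 0 -> w *m v p = - v p -> w *m v m = - v m -> False.
  move=> pm wp wm.
  have [s [/andP[ps sN] ms]] := frame_window m p; rewrite ms in pm wm.
  have sp : s <> p by move=> e; move: pm; rewrite e v1 => /eqP; rewrite oner_eq0.
  have spN : s <> (p + N)%N.
    by move=> e; move: pm; rewrite e vN dotNr v1 => /eqP; rewrite oppr_eq0 oner_eq0.
  have [q [pq qN pq0 wq]] : exists q, [/\ (p < q)%N, (q < p + N)%N, dot (v p) (v q) = 0 &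
      w *m v q = - v q].
    have [h|h] := ltnP s (p + N); first by exists s; split=> //; lia.
    have [q e] : exists q, s = (q + N)%N by exists (s - N)%N; lia.
    exists q; move: pm wm; rewrite e vN dotNr mulmxN => /eqP.
    rewrite oppr_eq0 => /eqP pm /(congr1 -%R); rewrite !opprK => wm.
    by split=> //; lia.
  have rb : is_root (v p + v q).
    by exists (v p), (- v q); rewrite dotNr pq0 oppr0 opprK; split=> //; exact: signedN.
  have ra := rootB pq qN.
  have wa : w *m (v p - v q) = - (v p - v q) by rewrite mulmxBr wp wq opprB addrC opprK.
  have wb : w *m (v p + v q) = - (v p + v q) by rewrite mulmxDr wp wq opprD.
  have [_ pa] := moved_of_neg wa; have [mb _] := moved_of_neg wb.
  have ba : dot (v p + v q) (v p - v q) = 0.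
    by rewrite dotDl !dotBr !v1 (dotC (v q)) pq0 subr0 sub0r subrr.
  have e : (codim (T (v p + v q) *m (T (v p - v q) *m w))).+2 = codim w.
    apply/(codim_refl2 (groupD_orth wW) pa); try exact: root_neq0.
    by split=> //; rewrite dotZr ba mulr0.
  have [uw u2] := iffRL (below_refl2 ra rb wW) e.
  have eg : (codim (T (v p + v q) *m (T (v p - v q) *m g))).+2 = codim g.
    apply: (iffLR (below_refl2 ra rb (frame_group fr))).
    by split=> //; exact: below_trans wg.
  have [_] := iffLR (codim_refl2 ow (preB (ltnW pq)) (root_neq0 ra) (root_neq0 rb)) eg.
  rewrite dotNr dotDl !dot_S ?pq ?ltnn; try lia.
  by move=> /eqP; rewrite oppr_eq0 addr0 oner_eq0.
have nf u : signed u -> w *m u = - u -> dot f0 u = 0 -> exists2 p, u = v p & w *m v p = - v p.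
  move=> su wu fu; case: (frame_complete fr su) fu wu => [->|->|[p ->]].
  - by rewrite f01 => /eqP; rewrite oner_eq0.
  - by rewrite dotNr f01 => /eqP; rewrite oppr_eq0 oner_eq0.
  - by exists p.
have two' u u' : signed u -> signed u' -> dot u u' = 0 -> dot f0 u = 0 -> dot f0 u' = 0 ->
    w *m u = - u -> w *m u' = - u' -> False.
  move=> su su' uu fu fu' wu wu'; have [p uE wp] := nf u su wu fu.
  have [q uE' wq] := nf u' su' wu' fu'.
  by apply: (two p q) => //; rewrite -uE -uE'.
have f0o u u' : signed u -> signed u' -> dot u u' = 0 -> dot f0 u <> 0 -> dot f0 u' = 0.
  move=> su su' uu; case: (frame_complete fr su) uu => [->|->|[p ->]] //.
    by rewrite dotNl => /eqP; rewrite oppr_eq0 => /eqP.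
have [fx|fx] := pselect (dot f0 x = 0); last first.
  by apply: (two' y z) => //; exact: (f0o x).
have [fy|fy] := pselect (dot f0 y = 0); first exact: (two' x y).
by apply: (two' x z) => //; exact: (f0o y).
Qed.

Lemma frame_rootB p q : (p < q)%N -> (q < p + N)%N -> is_root (v p - v q).
Proof. exact: rootB. Qed.

Lemma frame_rootC p : is_root (f0 - v p).
Proof. exact: rootC. Qed.

Lemma frame_movedB p q : (p < q)%N -> moved g (v p - v q).
Proof. by move=> /ltnW pq; exists (- S p q); exact: preB. Qed.

Lemma frame_movedC p : moved g (f0 - v p).
Proof. by exists (2^-1 *: (S p (p + N) - f0)); exact: preC. Qed.

Lemma frame_pairBB p q r s : (p < q)%N -> (q <= r)%N -> (r < s)%N -> (s < p + N)%N ->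
  (codim (T (v r - v s) *m (T (v p - v q) *m g))).+2 = codim g.
Proof.
move=> pq qr rs sN; apply/(codim_refl2 ow (preB (ltnW pq))).
- by apply: root_neq0; apply: rootB => //; lia.
- by apply: root_neq0; apply: rootB => //; lia.
split; first exact: frame_movedB.
rewrite dotNr dotBl !dot_S; try lia.
have -> : (r < q)%N = false by lia.
have -> : (s < q)%N = false by lia.
by rewrite subrr oppr0.
Qed.

Lemma frame_pairCB p r s : (p <= r)%N -> (r < s)%N -> (s < p + N)%N ->
  (codim (T (v r - v s) *m (T (f0 - v p) *m g))).+2 = codim g.
Proof.
move=> pr rs sN; apply/(codim_refl2 ow (preC p)).
- exact: root_neq0 (rootC p).
- by apply: root_neq0; apply: rootB => //; lia.
split; first exact: frame_movedB.
rewrite dotZr dotBl !dotBr !vf0 !dot_S; try lia.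
have -> : (r < p + N)%N = true by lia.
have -> : (s < p + N)%N = true by lia.
by rewrite subrr mulr0.
Qed.

Lemma frame_pairCC p : (codim (T (f0 - v (p + N)) *m (T (f0 - v p) *m g))).+2 = codim g.
Proof.
apply/(codim_refl2 ow (preC p)); try exact: root_neq0 (rootC _).
split; first exact: frame_movedC.
have f0S : dot f0 (S p (p + N)) = 0 by rewrite /S dot_sumr big1.
rewrite dotZr dotBl !dotBr f0S f01 vf0 vN dotNl dot_S ?leqnn //; try lia.
have -> : (p < p + N)%N = true by lia.
by rewrite subr0 sub0r opprK addNr mulr0.
Qed.

(** A fixed vector is orthogonal to every moved root, in particular to f0 - v p and f0 + v p, hence
    to [f0] and to all [v p], which exhaust the signed vectors. *)
Lemma frame_codim : codim g = n.
Proof.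
apply/eqP; rewrite eqn_leq rank_leq_row /= -{1}(mxrank1 R n).
apply: rank_ker_le => u /fix_subr1P gu; rewrite mul1mx.
have orth a : moved g a -> dot a u = 0 by move=> [x gx]; exact: moved_orth ow gx gu.
have h0 := orth _ (frame_movedC 0); have h1 := orth _ (frame_movedC (0 + N)).
rewrite vN opprK dotDl in h1; rewrite dotBl in h0.
have f0u : dot f0 u = 0 by move: h0 h1; lra.
have vu p : dot (v p) u = 0.
  by have := orth _ (frame_movedC p); rewrite dotBl f0u sub0r => /eqP; rewrite oppr_eq0 => /eqP.
apply/matrixP => i j; rewrite ord1 mxE -dot_basis.
have [->|->|[p ->]] := frame_complete fr (signed_basis R i) => //.
by rewrite dotNl f0u oppr0.
Qed.

(** The letters follow the order of the generators in [artin_delta]. Since [v N] is - v 0, the first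
    two reflections are those in f0 + v 0 and f0 - v 0. *)
Definition frame_word : seq 'M[R]_n :=
  [:: T (f0 - v N), T (f0 - v 0) & [seq T (v i - v i.+1) | i <- iota 0 N.-1]].

Let chain m := mxprod [seq T (v i - v i.+1) | i <- iota 0 m].

Let chainS m : chain m.+1 = chain m *m T (v m - v m.+1).
Proof.
have iotaE : iota 0 m.+1 = iota 0 m ++ [:: m] by rewrite -addn1 iotaD.
rewrite /chain iotaE map_cat mxprod_cat; congr (_ *m _).
by rewrite /= /mxprod big_cons big_nil mulmx1.
Qed.

Let chain_id m x : (forall i, (i <= m)%N -> dot (v i) x = 0) -> chain m *m x = x.
Proof.
elim: m => [|m IH] h; first by rewrite /chain /mxprod big_nil mul1mx.
rewrite chainS -mulmxA reflmx_swap_id ?h // IH // => i im.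
by apply: h; lia.
Qed.

Let chain_last m : (m < N)%N -> chain m *m v m = v 0.
Proof.
elim: m => [|m IH] mN; first by rewrite /chain /mxprod big_nil mul1mx.
by rewrite chainS -mulmxA reflmx_swapr ?IH //; [lia|apply: vv; lia].
Qed.

Let chain_next m j : (m < N)%N -> (j < m)%N -> chain m *m v j = v j.+1.
Proof.
elim: m => // m IH mN jm; rewrite chainS -mulmxA.
have [->|jn] := eqVneq j m.
  rewrite reflmx_swapl //; last by apply: vv; lia.
  by apply: chain_id => i im; apply: vv; lia.
rewrite reflmx_swap_id ?IH //; try lia; by rewrite dotC; apply: vv; lia.
Qed.

Lemma frame_factors : n = N.+1 -> factors frame_word g.
Proof.
move=> nN; split.
- move=> r; rewrite !inE => /orP[/eqP ->|/orP[/eqP ->|/mapP[i iN ->]]];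
    apply/reflectionsE.
  + by exists (f0 - v N) => //; exact: rootC.
  + by exists (f0 - v 0) => //; exact: rootC.
  + by exists (v i - v i.+1) => //; apply: rootB => //; move: iN; rewrite mem_iota; lia.
- have E x : mxprod frame_word *m x = T (f0 - v N) *m (T (f0 - v 0) *m (chain N.-1 *m x)).
    by rewrite /mxprod !big_cons -!mulmxA.
  have vNE : v N = - v 0 by rewrite -[N]add0n vN.
  have Ef0 : mxprod frame_word *m f0 = g *m f0.
    rewrite E chain_id // reflmx_swapl // (frame_center fr).
    by rewrite -[v 0]opprK -vNE mulmxN reflmx_swapr.
  have Ev j : (j < N)%N -> mxprod frame_word *m v j = g *m v j.
    move=> jN; rewrite E (frame_next fr); have [jE|jE] := eqVneq j N.-1.
      by rewrite jE chain_last ?prednK // reflmx_swapr // reflmx_swapl.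
    rewrite chain_next; try lia.
    rewrite [X in _ *m X]reflmx_swap_id //; last by apply: vv; lia.
    by rewrite reflmx_swap_id // vNE dotNl vv ?oppr0 //; lia.
  apply: mulmx_basis_ext => i.
  have [->|->|[p ->]] := frame_complete fr (signed_basis R i) => //.
    by rewrite !mulmxN Ef0.
  have [r [/andP[_ rN] ->]] := frame_window p 0.
  have [h|h] := ltnP r N; first exact: Ev.
  have -> : v r = - v (r - N)%N by rewrite -vN subnK.
  by rewrite !mulmxN Ev //; lia.
- by rewrite frame_codim /= size_map size_iota; lia.
Qed.

Lemma frame_v_inj p q : (p <= q < p + N + N)%N -> v p = v q -> q = p.
Proof.
move=> pq /(congr1 (dot (v p))); rewrite v1.
have [//|qp] := eqVneq q p; have [->|qN] := eqVneq q (p + N)%N.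
  by rewrite vN dotNr v1 => /eqP; rewrite -subr_eq0 opprK -[1 + 1]/(2%:R) pnatr_eq0.
by rewrite vv_ne; try lia; move=> /eqP; rewrite oner_eq0.
Qed.

Lemma frame_reflB_inj p q r s : (p < q)%N -> (q < p + N)%N -> (r < s)%N -> (s < r + N)%N ->
  T (v p - v q) = T (v r - v s) ->
  exists k l, (p + k * N = r + l * N)%N /\ (q + k * N = s + l * N)%N.
Proof.
move=> pq qN rs sN; have [r' [k [l [h e]]]] := window r p N_gt0.
have -> : v r - v s = v (r + 0)%N - v s by rewrite addn0.
rewrite addn0 -/(TB r s) -(TB_shift r s k).
have -> : TB (r + k * N) (s + k * N) = TB r' (r' + (s - r)).
  rewrite -(TB_shift r' (r' + (s - r)) l) e; congr TB; lia.
have {h} [h1 h2] : (r' <= r' + (s - r) /\ p <= r' < p + N)%N by lia.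
set s' := (r' + (s - r))%N; have s'E : (s + k * N = s' + l * N)%N by lia.
have rs' : (r' < s')%N by lia.
have sN' : (s' < r' + N)%N by lia.
move=> TE; suff [rE sE] : r' = p /\ s' = q by exists l, k; lia.
have [E|E] := reflmx_eq (root_norm (rootB pq qN)) (root_norm (rootB rs' sN')) TE;
  have := congr1 (dot (v p)) E; rewrite ?dotNr !dotBr v1 (vv pq qN) subr0.
  have [rp|rp] := eqVneq r' p.
    move=> _; split=> //; move: E; rewrite rp => /addrI /oppr_inj vE.
    have [h|h] := leqP q s'; first by apply: frame_v_inj vE; lia.
    by symmetry; apply: frame_v_inj (esym vE); lia.
  rewrite [dot (v p) (v r')]vv; try lia.
  have [sE _|sE] := eqVneq s' (p + N)%N; last first.
    by rewrite vv_ne; try lia; rewrite subrr => /eqP; rewrite oner_eq0.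
  (* Here [v r'] would equal - v q although both indices lie strictly between p and p + N. *)
  have := congr1 (dot (v r')) E; rewrite !dotBr v1 sE vN dotNr (dotC _ (v p)) (vv (_ : p < r')%N); try lia.
  rewrite oppr0 subr0 sub0r => /eqP; have [<-|rq] := eqVneq r' q.
    by rewrite v1 -subr_eq0 -opprD oppr_eq0 -[1 + 1]/(2%:R) pnatr_eq0.
  have [h|h] := ltnP r' q; first by rewrite vv ?oppr0 1?eq_sym ?oner_eq0 //; lia.
  by rewrite dotC vv ?oppr0 1?eq_sym ?oner_eq0 //; lia.
have [rp|rp] := eqVneq r' p.
  rewrite rp v1 vv; try lia.
  by rewrite subr0 => /eqP; rewrite -subr_eq0 opprK -[1 + 1]/(2%:R) pnatr_eq0.
rewrite vv; try lia; have [->|sE] := eqVneq s' (p + N)%N.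
  by rewrite vN dotNr v1 sub0r !opprK => /eqP; rewrite -subr_eq0 opprK -[1 + 1]/(2%:R) pnatr_eq0.
by rewrite vv_ne; try lia; rewrite subrr oppr0 => /eqP; rewrite oner_eq0.
Qed.

(** The period is 2N: a shift by N merely negates [v p - v q], but it turns f0 - v p into f0 + v p,
    whose reflection is a different one. *)
Lemma frame_reflC_inj p q : T (f0 - v p) = T (f0 - v q) ->
  exists k l, (p + k * (N + N) = q + l * (N + N))%N.
Proof.
move=> TE; have NN : (0 < N + N)%N by lia.
have [q' [k [l [h e]]]] := window q p NN.
have vE : v p = v q.
  have [E|E] := reflmx_eq (root_norm (rootC p)) (root_norm (rootC q)) TE.
    by move/addrI/oppr_inj: E.
  have := congr1 (dot f0) E; rewrite dotNr !dotBr f01 !f0v subr0 => /eqP.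
  by rewrite -subr_eq0 opprK -[1 + 1]/(2%:R) pnatr_eq0.
suff qE : q' = p by exists l, k; rewrite -qE.
apply: frame_v_inj; first by rewrite -addnA.
by rewrite vE -(v_shift q k) e v_shift.
Qed.

Lemma frame_reflB_neq_reflC p q r : (p < q)%N -> (q < p + N)%N -> T (v p - v q) <> T (f0 - v r).
Proof.
move=> pq qN TE; have := reflmx_eq (root_norm (rootB pq qN)) (root_norm (rootC r)) TE.
case=> /(congr1 (dot f0)); rewrite ?dotNr !dotBr f01 !f0v !subr0 => /esym/eqP;
  by rewrite ?oppr_eq0 oner_eq0.
Qed.

(** * The dual relations for all pairs of reflections with product below the Coxeter element *)

Section Dual.
Variables (G : groupType) (B : nat -> nat -> G) (C : nat -> G) (phi : 'M[R]_n -> G).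
Hypothesis ds : dual_system N B C.
Hypothesis phiB : forall p q, (p < q)%N -> (q < p + N)%N -> phi (T (v p - v q)) = B p q.
Hypothesis phiC : forall p, phi (T (f0 - v p)) = C p.

Let conjT a b x : is_root b -> T b *m a = x -> T b *m T a *m T b = T x.
Proof. by move=> rb <-; rewrite -reflmx_conj ?reflmx_tr //; exact: orthmx_refl. Qed.

Let conjTN a b x : is_root b -> T b *m a = - x -> T b *m T a *m T b = T x.
Proof. by move=> rb h; rewrite (conjT rb h) reflmxN. Qed.

(* Rewriting with [phiB] and [phiC] would send unification into the matrix operations. *)
Let phi_eq (t1 t2 t3 t4 : 'M[R]_n) (z1 z2 z3 z4 : G) :
  phi t1 = z1 -> phi t2 = z2 -> phi t3 = z3 -> phi t4 = z4 -> (z1 * z2 = z3 * z4)%g ->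
  (phi t1 * phi t2 = phi t3 * phi t4)%g.
Proof. by move=> -> -> -> ->. Qed.

Let phi_comm (t1 t2 : 'M[R]_n) (z1 z2 : G) :
  phi t1 = z1 -> phi t2 = z2 -> commute z1 z2 -> commute (phi t1) (phi t2).
Proof. by move=> -> ->. Qed.

Let swapl p q : (p < q)%N -> (q < p + N)%N -> T (v p - v q) *m v p = v q.
Proof. by move=> pq qN; apply: reflmx_swapl => //; exact: vv. Qed.

Let swapr p q : (p < q)%N -> (q < p + N)%N -> T (v p - v q) *m v q = v p.
Proof. by move=> pq qN; apply: reflmx_swapr => //; exact: vv. Qed.

Let swapC p : T (f0 - v p) *m f0 = v p.
Proof. exact: reflmx_swapl. Qed.

Let swapCr p : T (f0 - v p) *m v p = f0.
Proof. exact: reflmx_swapr. Qed.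

Let commT a b : is_root b -> dot a b = 0 -> commute (phi (T a)) (phi (T b)) ->
  (phi (T a) * phi (T b) = phi (T b) * phi (T b *m T a *m T b))%g.
Proof.
by move=> rb ab h; rewrite (@conjT a b a) // reflmx_id // dotC.
Qed.

Let vvn p q : p <> q -> (p < q + N)%N -> (q < p + N)%N -> dot (v p) (v q) = 0.
Proof.
by move=> pq pN qN; have [h|h] := ltnP p q; [exact: vv|rewrite dotC; apply: vv; lia].
Qed.

Let dual_rel a b : Prop :=
  (codim (T b *m (T a *m g))).+2 = codim g ->
  (phi (T a) * phi (T b) = phi (T b) * phi (T b *m T a *m T b))%g.

(** Orthogonality to the preimage - S p q becomes a condition on arcs. For s < p + N it says that r
    < q iff s < q, so the second arc is nested in the first or comes after it. For s >= p + N it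
    forces q <= r and q + N <= s, so the second arc contains the first one shifted by N. Arcs with a
    common end give a triangle relation, all others commute. *)
Let dual_BB p q r s : (p < q)%N -> (q < p + N)%N -> (p <= r < p + N)%N ->
  (r < s)%N -> (s < r + N)%N -> dual_rel (v p - v q) (v r - v s).
Proof.
move=> pq qN rp rs sN e; set a := v p - v q in e *; set b := v r - v s in e *.
have ra : is_root a := rootB pq qN; have rb : is_root b := rootB rs sN.
have [_] := iffLR (codim_refl2 ow (preB (ltnW pq)) (root_neq0 ra) (root_neq0 rb)) e.
rewrite dotNr dotBl dot_S ?(ltnW qN) // => /eqP; rewrite oppr_eq0 => /eqP.
have [sp|sp] := ltnP s (p + N).
  rewrite dot_S; [|lia|lia] => /eqP.
  rewrite subr_eq0 eqr_nat => /eqP h.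
  have [sq|sq] := ltnP s q.
    have [rpE|rpE] := eqVneq r p.
      rewrite /b rpE in rs *; rewrite (@conjT _ _ (v s - v q)); last 2 first.
      - by apply: rootB => //; lia.
      - rewrite mulmxBr swapl ?reflmx_swap_id ?vvn //; lia.
      by apply: (phi_eq (phiB _ _) (phiB _ _) (phiB _ _) (phiB _ _)); try lia; apply: (proj2 (dual_B_tri ds _ _ _)); lia.
    apply: commT => //; first by rewrite /a /b dotBl !dotBr ?vvn ?subrr //; lia.
    by apply: (phi_comm (phiB _ _) (phiB _ _)) => //; apply: (dual_B_nested ds); lia.
  have qr : (q <= r)%N by case: (ltnP r q) h; case: (ltnP s q) => //; lia.
  have [rq|rq] := eqVneq r q.
    rewrite /b rq in rs sN *; rewrite (@conjT _ _ (v p - v s)); last 2 first.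
    - exact: rootB.
    - rewrite mulmxBr swapl // reflmx_swap_id ?vvn //; lia.
    by apply: (phi_eq (phiB _ _) (phiB _ _) (phiB _ _) (phiB _ _)); try lia; apply: (proj1 (dual_B_tri ds _ _ _)); lia.
  apply: commT => //; first by rewrite /a /b dotBl !dotBr ?vvn ?subrr //; lia.
  by apply: (phi_comm (phiB _ _) (phiB _ _)) => //; apply: (dual_B_disjoint ds); lia.
rewrite dot_S' ?opprK; [|lia|lia] => h.
have [qr sq] : (q <= r)%N /\ (q + N <= s)%N.
  move: h; case: (ltnP r q); case: (ltnP (s - N) q) => ? ?; try lia;
    by move=> /eqP; rewrite ?addr0 ?add0r -?natrD pnatr_eq0.
have aE : T a = T (v (p + N)%N - v (q + N)%N).
  by have := TB_shift p q 1; rewrite /TB !mul1n => ->.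
have [sE|sE] := eqVneq s (q + N)%N; last first.
  rewrite aE; apply: commT => //; first by rewrite /b dotBl !dotBr ?vvn ?subrr //; lia.
  apply: (phi_comm (phiB _ _) (phiB _ _)); try lia.
  by apply: commute_sym; apply: (dual_B_nested ds); lia.
rewrite aE /b sE in rs sN *; rewrite (@conjTN _ _ (v r - v (p + N)%N)); last 2 first.
- exact: rootB.
- by rewrite mulmxBr swapr // reflmx_swap_id ?opprB ?vvn //; lia.
apply: (phi_eq (phiB _ _) (phiB _ _) (phiB _ _) (phiB _ _)); try lia.
by have [|||-> ->] := dual_B_tri ds (p := r) (q := p + N) (r := q + N); try lia.
Qed.

Let dual_CB p r s : (p <= r < p + N)%N -> (r < s)%N -> (s < r + N)%N ->
  dual_rel (f0 - v p) (v r - v s).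
Proof.
move=> rp rs sN e; have ra := rootC p; have rb := rootB rs sN.
have [_] := iffLR (codim_refl2 ow (preC p) (root_neq0 ra) (root_neq0 rb)) e.
rewrite dotZr => /eqP; rewrite mulf_eq0 invr_eq0 pnatr_eq0 /= => /eqP.
rewrite dotBl !dotBr !vf0 !subr0 dot_S //.
have -> /= : (r < p + N)%N = true by lia.
have [sp|sp] := ltnP s (p + N); last first.
  rewrite dot_S' ?opprK; [|lia|lia].
  have -> : (s - N < p + N)%N = true by lia.
  by move=> /eqP; rewrite -natrD pnatr_eq0.
move=> _; have [rpE|rpE] := eqVneq r p.
  rewrite rpE in rs *; rewrite (@conjT _ _ (f0 - v s)); last 2 first.
  - by apply: rootB => //; lia.
  - by rewrite mulmxBr swapl ?reflmx_swap_id //; lia.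
  by apply: (phi_eq (phiC _) (phiB _ _) (phiB _ _) (phiC _)); try lia; apply: (proj1 (dual_C_tri ds _ _)); lia.
apply: commT => //; first by rewrite dotBl !dotBr !f0v ?vvn ?subrr //; lia.
by apply: (phi_comm (phiC _) (phiB _ _)) => //; apply: (dual_C_B ds); lia.
Qed.

Let dual_BC p q s : (p < q)%N -> (q < p + N)%N -> (p <= s < p + N + N)%N ->
  dual_rel (v p - v q) (f0 - v s).
Proof.
move=> pq qN sp e; have ra := rootB pq qN; have rb := rootC s.
have [_] := iffLR (codim_refl2 ow (preB (ltnW pq)) (root_neq0 ra) (root_neq0 rb)) e.
have f0S : dot f0 (S p q) = 0 by rewrite /S dot_sumr big1.
rewrite dotNr dotBl f0S sub0r opprK => {e}.
have shift k : T (v p - v q) = T (v (p + k * N)%N - v (q + k * N)%N).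
  by rewrite -/(TB _ _) -(TB_shift p q k).
(* The arc from p to q may be shifted by multiples of N, whereas [s] may not. The number [k] is
   chosen so that the shifted arc lies in the window that starts at [s], or ends at [s] in [touch]
   below. *)
have comm k : (s < p + k * N)%N -> (q + k * N < s + N)%N ->
    (phi (T (v p - v q)) * phi (T (f0 - v s)) =
     phi (T (f0 - v s)) * phi (T (f0 - v s) *m T (v p - v q) *m T (f0 - v s)))%g.
  move=> h1 h2; rewrite (shift k); apply: commT => //.
    by rewrite dotBl !dotBr !vf0 ?vvn ?subrr //; lia.
  apply: (phi_comm (phiB _ _) (phiC _)); try lia.
  by apply: commute_sym; apply: (dual_C_B ds); lia.
have touch k : s = (q + k * N)%N ->
    (phi (T (v p - v q)) * phi (T (f0 - v s)) =
     phi (T (f0 - v s)) * phi (T (f0 - v s) *m T (v p - v q) *m T (f0 - v s)))%g.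
  move=> ->; rewrite (shift k) (@conjTN _ _ (f0 - v (p + k * N)%N)) //; last first.
    by rewrite mulmxBr swapCr reflmx_swap_id ?f0v ?opprB // vvn //; lia.
  apply: (phi_eq (phiB _ _) (phiC _) (phiC _) (phiC _)); try lia.
  by have [||-> ->] := dual_C_tri ds (p := p + k * N) (q := q + k * N); try lia.
have [sN|sN] := ltnP s (p + N).
  rewrite dot_S; [|lia|lia]; have [sq|sq _] := ltnP s q.
    by move=> /eqP; rewrite oner_eq0.
  have [sE|sE] := eqVneq s q; first by apply: (touch 0%N); lia.
  by apply: (comm 1%N); lia.
rewrite dot_S'; [|lia|lia]; have [sq|sq _] := ltnP (s - N) q.
  by move=> /eqP; rewrite oppr_eq0 oner_eq0.
have [sE|sE] := eqVneq s (q + N)%N; first by apply: (touch 1%N); lia.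
by apply: (comm 2%N); lia.
Qed.

Let dual_CC p s : (p <= s < p + N + N)%N -> dual_rel (f0 - v p) (f0 - v s).
Proof.
move=> sp e; have ra := rootC p; have rb := rootC s.
have [_] := iffLR (codim_refl2 ow (preC p) (root_neq0 ra) (root_neq0 rb)) e.
have f0S : dot f0 (S p (p + N)) = 0 by rewrite /S dot_sumr big1.
rewrite dotZr => /eqP; rewrite mulf_eq0 invr_eq0 pnatr_eq0 /= => /eqP.
rewrite dotBl !dotBr f0S f01 vf0 subr0 sub0r.
have [sN|sN] := ltnP s (p + N).
  rewrite dot_S; [|lia|lia]; have -> : (s < p + N)%N = true by lia.
  by move=> /eqP; rewrite -opprD oppr_eq0 -[1 + _]/(2%:R) pnatr_eq0.
move=> _; have [sE|sE] := eqVneq s (p + N)%N.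
  rewrite sE; apply: commT => //.
    by rewrite dotBl !dotBr f0v vf0 f01 vN dotNr v1 subr0 sub0r opprK subrr.
  by apply: (phi_comm (phiC _) (phiC _)); exact: (dual_C_C ds).
(* Now [s] lies strictly between p + N and p + 2N; a shift of p by the full period puts it behind
   [s] at distance less than N, as [dual_C_tri] requires. *)
have Tp : T (f0 - v p) = T (f0 - v (p + N + N)%N) by rewrite vNN.
rewrite Tp (@conjT _ _ (v s - v (p + N + N)%N)) //; last first.
  rewrite mulmxBr swapC reflmx_swap_id // vvn //; lia.
apply: (phi_eq (phiC _) (phiC _) (phiC _) (phiB _ _)); try lia.
by apply: (proj2 (dual_C_tri ds _ _)); lia.
Qed.

Lemma frame_phi_dual a b : is_root a -> is_root b ->
  (codim (T b *m (T a *m g))).+2 = codim g ->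
  (phi (T a) * phi (T b) = phi (T b) * phi (T b *m T a *m T b))%g.
Proof.
move=> /frame_root_cases[[p [q [pq qN ->]]]|[p ->]] /frame_root_cases[[r [s [rs sN]]]|[s]].
- by have [r' [s' [rp rs' sN' ->]]] := frame_reflB_window p rs sN => ->; exact: dual_BB.
- by have [s' [sp vs]] := frame_window s p => ->; rewrite /TC vs; exact: dual_BC.
- by have [r' [s' [rp rs' sN' ->]]] := frame_reflB_window p rs sN => ->; exact: dual_CB.
- by have [s' [sp vs]] := frame_window s p => ->; rewrite /TC vs; exact: dual_CC.
Qed.

End Dual.
End Frame.

(** * Generators of the poset group *)

Section PosetGroup.
Local Open Scope ring_scope.
Variables (R : realType) (n : nat) (g : 'M[R]_n).
Local Notation W := (groupD R n).
Local Notation T := (@reflmx R n).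
Local Notation Gam := (poset_group W g).
Implicit Types (w u t r : 'M[R]_n) (x y a b : 'cV[R]_n) (s : seq 'M[R]_n).
Hypothesis gW : W g.

(* The generator [{w}], extended by [1] to the identity and to matrices outside the interval. *)
Definition poset_gen w : Gam :=
  match pselect (poset_interval W g w) with
  | left h => pres_gen (@poset_rel R n W g) (SigSub (mem_set h))
  | right _ => 1%g
  end.
Local Notation tk := poset_gen.

Lemma poset_genE (w : poset_interval W g) : tk (val w) = pres_gen (@poset_rel R n W g) w.
Proof.
rewrite /poset_gen; case: pselect => [h|[]]; last exact: set_mem (valP w).
by congr pres_gen; apply: val_inj.
Qed.

Lemma poset_gen1 : tk 1%:M = 1%g.
Proof. by rewrite /poset_gen; case: pselect => // -[]. Qed.

Lemma in_poset w : below w g -> w <> 1%:M -> exists p : poset_interval W g, val p = w.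
Proof.
move=> wg w1; have h : poset_interval W g w by split=> //; apply/below_refl_le.
by exists (SigSub (mem_set h)).
Qed.

Lemma poset_genM u w : below u w -> below w g -> (tk u * tk (u^T *m w))%g = tk w.
Proof.
move=> uw wg; have uW : W u by case: uw.
have [->|u1] := eqVneq u 1%:M; first by rewrite poset_gen1 mul1g trmx1 mul1mx.
have [e|v1] := eqVneq (u^T *m w) 1%:M.
  by rewrite e poset_gen1 mulg1 -[w](mulmx_trK w uW) e mulmx1.
have w1 : w <> 1%:M.
  move=> w1; move: uw => [_ _]; rewrite w1 codim1 => /esym/eqP.
  by rewrite addn_eq0 => /andP[/eqP/codim_eq0/eqP]; rewrite (negPf u1).
have [p1 e1] := in_poset (below_trans uw wg) (elimN eqP u1).
have [p2 e2] := in_poset (below_quotient uw wg) (elimN eqP v1).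
have [p3 e3] := in_poset wg w1.
rewrite -e2 -e1 -e3 !poset_genE.
have := @pres_rel _ (@poset_rel R n W g) [:: p1; p2] [:: p3].
rewrite !big_cons !big_nil !mulg1; apply.
exists p1, p2, p3; split=> //; first by apply/below_refl_le; rewrite e1 e3.
by rewrite e2 e1 e3 orthmx_inv //; exact: groupD_orth.
Qed.

Lemma poset_gen_factors w s : below w g -> factors s w -> tk w = (\prod_(r <- s) tk r)%g.
Proof.
elim: s w => [|t s IH] w wg fs; first by rewrite (factors_nil fs) poset_gen1 big_nil.
have wW : W w by case: wg.
have [a [-> ra ma fs']] := iffLR (factors_consP _ _ wW) fs.
have aw := iffRL (below_refl_moved ra wW) ma.
rewrite big_cons -(poset_genM aw wg) reflmx_tr -(IH (T a *m w)) //.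
by have := below_quotient aw wg; rewrite reflmx_tr.
Qed.

(** Each side is the generator of the rank two element [T a *m T b], read off from different
    factorizations. The premise of the second equality says that the conjugate times [T a] is a
    further factorization of it. *)
Lemma poset_gen_dual a b : is_root a -> is_root b ->
  (codim (T b *m (T a *m g))).+2 = codim g ->
  (tk (T a) * tk (T b) = tk (T b) * tk (T b *m T a *m T b) /\
   (T b *m T a *m T b *m (T a *m T b) = T a ->
    tk (T b *m T a *m T b) * tk (T a) = tk (T a) * tk (T b)))%g.
Proof.
move=> ra rb e; have aW := groupD_root ra; have bW := groupD_root rb.
have [ug u2] := iffRL (below_refl2 ra rb gW) e.
have uW : W (T a *m T b) by case: ug.
have below_u c : is_root c -> codim (T c *m (T a *m T b)) = 1%N -> below (T c) (T a *m T b).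
  move=> rc c1; apply: below_codimW => //; first exact: groupD_root.
  by rewrite reflmx_tr c1 u2 codim_refl //; exact: root_neq0.
have rc : is_root (T b *m a) by exact: groupD_is_root.
have Tc : T b *m T a *m T b = T (T b *m a).
  by rewrite -reflmx_conj ?reflmx_tr //; exact: orthmx_refl.
have ab : below (T a) (T a *m T b).
  by apply: below_u => //; rewrite mulmxA reflmxK mul1mx codim_refl //; exact: root_neq0.
have ba : below (T b) (T a *m T b).
  by apply: below_u => //; rewrite mulmxA Tc codim_refl //; exact: root_neq0.
have := poset_genM ab ug; rewrite reflmx_tr mulmxA reflmxK mul1mx => ->.
have := poset_genM ba ug; rewrite reflmx_tr mulmxA => ->; split=> // h.
have ca : below (T (T b *m a)) (T a *m T b).
  by apply: below_u => //; rewrite -Tc h codim_refl //; exact: root_neq0.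
by have := poset_genM ca ug; rewrite reflmx_tr -Tc h.
Qed.

Lemma poset_gen_commute a b : is_root a -> is_root b -> dot a b = 0 ->
  (codim (T b *m (T a *m g))).+2 = codim g -> commute (tk (T a)) (tk (T b)).
Proof.
move=> ra rb ab e; have [h _] := poset_gen_dual ra rb e; rewrite /commute h.
by rewrite -[in X in _ *m _ *m X](reflmx_tr b) reflmx_conj ?reflmx_id // ?(dotC b) //; exact: orthmx_refl.
Qed.

(** The roots x - y, y - z, x - z form a system of type A_2. Writing a, b, c for their generators,
    ab = bc = ca, whence aba = bca = bab. *)
Lemma poset_gen_braid x y z : signed x -> signed y -> signed z ->
  dot x y = 0 -> dot x z = 0 -> dot y z = 0 ->
  (codim (T (y - z) *m (T (x - y) *m g))).+2 = codim g ->
  (tk (T (x - y)) * tk (T (y - z)) = tk (T (y - z)) * tk (T (x - z)))%g /\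
  braided (tk (T (x - y))) (tk (T (y - z))).
Proof.
move=> sx sy sz xy xz yz e.
have ra : is_root (x - y) by exists x, y.
have rb : is_root (y - z) by exists y, z.
have conjE a b c : T b *m a = c -> T b *m T a *m T b = T c.
  by move=> <-; rewrite -reflmx_conj ?reflmx_tr //; exact: orthmx_refl.
have cE : T (y - z) *m T (x - y) *m T (y - z) = T (x - z).
  by apply: conjE; rewrite mulmxBr reflmx_swapl // reflmx_swap_id // dotC.
have [h1 h2] := poset_gen_dual ra rb e; rewrite cE in h1 h2; split=> //.
rewrite /braided h1 -!mulgA h2 //.
have -> : T (x - z) *m (T (x - y) *m T (y - z)) = T (x - z) *m T (x - y) *m T (x - z) *m (T (x - z) *m T (y - z)).
  by rewrite -!mulmxA (mulmxA (T (x - z)) (T (x - z))) reflmxK mul1mx.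
have -> : T (x - z) *m T (x - y) *m T (x - z) = T (y - z).
  by rewrite -[y - z]opprB reflmxN; apply: conjE; rewrite mulmxBr reflmx_swapl // reflmx_swap_id // dotC.
rewrite mulmxA; apply: conjE.
by rewrite mulmxBr reflmx_swapr // reflmx_swap_id // dotC.
Qed.

(** Since [T (g *m a)] is the conjugate of [T a] by [g], the element h = g T a is also T (g a) g.
    Both h T a and T (g a) h are factorizations of [g], and comparing them gives the conjugation
    formula. *)
Lemma poset_gen_conj a : is_root a -> moved g a ->
  (tk (T a) ^ (tk g)^-1 = tk (T (g *m a)))%g.
Proof.
move=> ra [u gu]; have og := groupD_orth gW.
have rga : is_root (g *m a) by exact: groupD_is_root.
have mga : moved g (g *m a) by exists (g *m u); rewrite -mulmxDr -gu.
have b1 := iffRL (below_refl_moved rga gW) mga.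
have b2 := below_quotient b1 (below_refl gW).
have gg := below_refl gW.
have E1 := poset_genM b1 gg; have E2 := poset_genM b2 gg.
rewrite reflmx_tr in E1 E2.
have TE : (T (g *m a) *m g)^T *m g = T a.
  rewrite trmx_mul reflmx_tr -mulmxA -reflmx_conj // -!mulmxA og mulmx1.
  by rewrite !mulmxA og mul1mx.
rewrite TE in E2; rewrite conjgE invgK mulgA -{1}E1 -(mulgA _ _ (tk (T a))) E2.
by rewrite mulgK.
Qed.

End PosetGroup.

(** * The isomorphism for a Coxeter frame *)

Section ArtinPresented.
Local Open Scope group_scope.
Variable N : nat.
Hypothesis N_gt0 : 0 < N.

(** Generators indexed by [nat], so that indices can be shifted freely; for k > N the default of
    [inord] is taken. *)
Definition artin_gen (k : nat) : artinD N.+1 := pres_gen (@artinD_rel N.+1) (inord k).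
Local Notation x := artin_gen.

Lemma artin_relE (l r : seq nat) :
  (forall i : nat -> 'I_N.+1, (forall k, k < N.+1 -> i k = k :> nat) ->
    artinD_rel (map i l) (map i r)) ->
  \prod_(k <- l) x k = \prod_(k <- r) x k.
Proof.
move=> h; have := pres_rel (h (fun k => inord k) (fun k kN => inordK kN)).
by rewrite !big_map.
Qed.

Lemma artin_gen_commute j k :
  (forall i : nat -> 'I_N.+1, (forall k, k < N.+1 -> i k = k :> nat) ->
    artinD_rel [:: i j; i k] [:: i k; i j]) -> commute (x j) (x k).
Proof.
move=> h; have := @artin_relE [:: j; k] [:: k; j].
by rewrite !big_cons !big_nil !mulg1; apply.
Qed.

Lemma artin_gen_braid j k :
  (forall i : nat -> 'I_N.+1, (forall k, k < N.+1 -> i k = k :> nat) ->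
    artinD_rel [:: i j; i k; i j] [:: i k; i j; i k]) -> braided (x j) (x k).
Proof.
move=> h; have := @artin_relE [:: j; k; j] [:: k; j; k].
by rewrite !big_cons !big_nil !mulg1 !mulgA; apply.
Qed.

Local Notation s i := (x i.+2).

Lemma artin_gen_ab : commute (x 0) (x 1).
Proof.
apply: artin_gen_commute => i iE.
by apply: (@artinD_12 _ (i 0%N) (i 1%N)); rewrite ?iE.
Qed.

Lemma artin_gen_as0 : 1 < N -> braided (x 0) (s 0).
Proof.
move=> N1; apply: artin_gen_braid => i iE.
by apply: (@artinD_13 _ (i 0) (i 2)); rewrite ?iE.
Qed.

Lemma artin_gen_bs0 : 1 < N -> braided (x 1) (s 0).
Proof.
move=> N1; apply: artin_gen_braid => i iE.
by apply: (@artinD_braid _ (i 1%N) (i 2%N)); rewrite ?iE //; lia.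
Qed.

Lemma artin_gen_asi i : 0 < i -> i.+1 < N -> commute (x 0) (s i).
Proof.
move=> i0 iN; apply: artin_gen_commute => f fE.
by apply: (@artinD_1i _ (f 0) (f i.+2)); rewrite ?fE //; lia.
Qed.

Lemma artin_gen_bsi i : 0 < i -> i.+1 < N -> commute (x 1) (s i).
Proof.
move=> i0 iN; apply: artin_gen_commute ; try lia.
move=> f fE.
by apply: (@artinD_comm _ (f 1%N) (f i.+2)); rewrite ?fE //; lia.
Qed.

Lemma artin_gen_ssS i : i.+2 < N -> braided (s i) (s i.+1).
Proof.
move=> iN; apply: artin_gen_braid ; try lia.
move=> f fE.
by apply: (@artinD_braid _ (f i.+2) (f i.+3)); rewrite ?fE //; lia.
Qed.

Lemma artin_gen_ssc i j : i.+1 < j -> j.+1 < N -> commute (s i) (s j).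
Proof.
move=> ij jN; apply: artin_gen_commute ; try lia.
move=> f fE.
by apply: (@artinD_comm _ (f i.+2) (f j.+2)); rewrite ?fE //; lia.
Qed.

Lemma artinD_generators : artin_generators N (x 0) (x 1) (fun i => s i).
Proof.
split=> //; [exact: artin_gen_ab|exact: artin_gen_as0|exact: artin_gen_bs0| | | |].
- exact: artin_gen_asi.
- exact: artin_gen_bsi.
- exact: artin_gen_ssS.
- exact: artin_gen_ssc.
Qed.

End ArtinPresented.

Lemma artin_dual_system (G : groupType) (N : nat) (a b : G) (s : nat -> G) :
  artin_generators N a b s ->
  dual_system N (artin_B N a b s) (artin_C N a b s false).
Proof.
move=> gens; split.
- by move=> p q r; exact: artin_B_tri.
- by move=> p q r t; exact: artin_B_disjoint.
- by move=> p q r t; exact: artin_B_nested.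
- by move=> p q; exact: artin_C_tri.
- by move=> p r t; exact: artin_C_B_comm.
- by move=> p; rewrite artin_C_per //; apply: artin_C_comm.
Qed.

Section Isomorphism.
Local Open Scope ring_scope.
Variables (R : realType) (n N : nat) (g : 'M[R]_n) (f0 : 'cV[R]_n) (v : nat -> 'cV[R]_n).
Hypothesis nN : n = N.+1.
Hypothesis fr : coxeter_frame N g f0 v.
Local Notation W := (groupD R n).
Local Notation T := (@reflmx R n).
Local Notation Gam := (poset_group W g).
Local Notation tk := (poset_gen g).

Let gW : W g := frame_group fr.
Let N_gt0 : (0 < N)%N := frame_gt0 fr.

(* The reflection corresponding to the generator x_(k+1). *)
Definition simple_refl (k : nat) : 'M[R]_n :=
  if k is k'.+1 then if k' is k''.+1 then T (v k'' - v k''.+1) else T (f0 - v 0)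
  else T (f0 - v N).
Local Notation sr := simple_refl.

Let fsg0 : signed f0 := frame_signed0 fr.
Let fsg p : signed (v p) := frame_signed fr p.
Let f0v p : dot f0 (v p) = 0 := frame_orth0 fr p.
Let vv p q : (p < q)%N -> (q < p + N)%N -> dot (v p) (v q) = 0 := @frame_orth _ _ _ _ _ _ fr p q.

Let T_shift i k : T (v (i + k * N)%N - v (i.+1 + k * N)%N) = T (v i - v i.+1).
Proof.
elim: k => [|k IH]; first by rewrite !addn0.
by rewrite mulSn !(addnCA _ N) !(addnC N) !(frame_half fr) -opprD reflmxN IH.
Qed.

Let triC p q : (p < q)%N -> (q < p + N)%N ->
  (tk (T (f0 - v p)) * tk (T (v p - v q)) = tk (T (v p - v q)) * tk (T (f0 - v q)))%g /\
  braided (tk (T (f0 - v p))) (tk (T (v p - v q))).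
Proof.
by move=> pq qN; apply: poset_gen_braid => //; [exact: vv|exact: (frame_pairCB fr)].
Qed.

Let triB p q r : (p < q)%N -> (q < r)%N -> (r < p + N)%N ->
  (tk (T (v p - v q)) * tk (T (v q - v r)) = tk (T (v q - v r)) * tk (T (v p - v r)))%g /\
  braided (tk (T (v p - v q))) (tk (T (v q - v r))).
Proof.
move=> pq qr rN; apply: poset_gen_braid => //; try by apply: vv; lia.
exact: (frame_pairBB fr).
Qed.

Let commC p r : (p < r)%N -> (r.+1 < p + N)%N ->
  commute (tk (T (f0 - v p))) (tk (T (v r - v r.+1))).
Proof.
move=> pr rN; apply: (poset_gen_commute gW).
- exact: (frame_rootC fr).
- by apply: (frame_rootB fr); lia.
- by rewrite dotBl !dotBr !f0v !vv ?subrr //; lia.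
- by apply: (frame_pairCB fr); lia.
Qed.

Let commB p r : (p.+1 < r)%N -> (r.+1 < p + N)%N ->
  commute (tk (T (v p - v p.+1))) (tk (T (v r - v r.+1))).
Proof.
move=> pr rN; apply: (poset_gen_commute gW).
- by apply: (frame_rootB fr); lia.
- by apply: (frame_rootB fr); lia.
- by rewrite dotBl !dotBr !vv ?subrr //; lia.
- by apply: (frame_pairBB fr); lia.
Qed.

Lemma simple_refl_root k : (k < N.+1)%N -> exists a, [/\ is_root a, moved g a & sr k = T a].
Proof.
case: k => [|[|k]] kN; [exists (f0 - v N)|exists (f0 - v 0)|exists (v k - v k.+1)]; split=> //.
- exact: (frame_rootC fr).
- exact: (frame_movedC fr).
- exact: (frame_rootC fr).
- exact: (frame_movedC fr).
- by apply: (frame_rootB fr); lia.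
- exact: (frame_movedB fr).
Qed.

Let commCC : commute (tk (sr 0)) (tk (sr 1)).
Proof.
apply: commute_sym; apply: (poset_gen_commute gW).
- exact: (frame_rootC fr).
- exact: (frame_rootC fr).
- rewrite dotBl !dotBr -{1 2}[N]add0n (frame_half fr) !dotNr (dotC _ f0) !f0v.
  by rewrite !(signed_norm _) // oppr0 subr0 sub0r opprK subrr.
- by rewrite /sr -{1}[N]add0n; exact: (frame_pairCC fr).
Qed.

Lemma poset_generators : artin_generators N (tk (sr 0)) (tk (sr 1)) (fun i => tk (sr i.+2)).
Proof.
(* The generator [a] belongs to [f0 - v N], whose window starts at N, so the other roots are shifted
   there. *)
have sN i : T (v i - v i.+1) = T (v (i + N)%N - v (i.+1 + N)%N) by rewrite -(T_shift i 1) !mul1n.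
split; [exact: N_gt0|exact: commCC| | | | | |].
- by move=> N1; rewrite /sr sN add0n; apply: (proj2 (triC _ _)); lia.
- by move=> N1; apply: (proj2 (triC _ _)); lia.
- by move=> i i0 iN; rewrite /sr sN addSn; apply: commC; lia.
- by move=> i i0 iN; apply: commC; lia.
- by move=> i iN; apply: (proj2 (triB _ _ _)); lia.
- by move=> i j ij jN; apply: commB; lia.
Qed.

Let gens := artinD_generators N_gt0.
Local Notation x k := (artin_gen N k).
Local Notation A := (artinD N.+1).
Local Notation BA := (artin_B N (x 0) (x 1) (fun i => x i.+2)).
Local Notation CA := (artin_C N (x 0) (x 1) (fun i => x i.+2) false).

Definition artin_lift_rel (t : 'M[R]_n) (z : A) : Prop :=
  (exists p q, [/\ (p < q)%N, (q < p + N)%N, t = T (v p - v q) & z = BA p q]) \/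
  (exists p, t = T (f0 - v p) /\ z = CA p).

(** A reflection has many index pairs, hence the detour through a relation. The default 1 is taken
    only outside the reflections of the group. *)
Definition artin_lift t : A := xget 1%g [set z | artin_lift_rel t z]%classic.

Let BA_shift p q k : (p < q)%N -> (q < p + N)%N -> BA (p + k * N) (q + k * N) = BA p q.
Proof.
move=> pq qN; elim: k => [|k IH]; first by rewrite !addn0.
rewrite mulSn !(addnCA _ N) !(addnC N) (artin_B_per gens) ?IH //; lia.
Qed.

Let CA_shift p k : CA (p + k * (N + N)) = CA p.
Proof.
elim: k => [|k IH]; first by rewrite addn0.
have -> : (p + k.+1 * (N + N) = p + k * (N + N) + N + N)%N by rewrite mulSn; lia.
by rewrite !(artin_C_per gens).
Qed.

(** Indices of the same reflection differ by the geometric periods, which are also periods of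
    [artin_B] and [artin_C]. *)
Lemma artin_lift_rel_inj t z z' : artin_lift_rel t z -> artin_lift_rel t z' -> z = z'.
Proof.
case=> [[p [q [pq qN -> ->]]]|[p [-> ->]]].
  case=> [[r [s [rs sN TE ->]]]|[r [TE _]]]; last by case: (frame_reflB_neq_reflC fr pq qN TE).
  have [k [l [h1 h2]]] := frame_reflB_inj fr pq qN rs sN TE.
  by rewrite -(BA_shift k pq qN) -(BA_shift l rs sN) h1 h2.
case=> [[r [s [rs sN TE ->]]]|[r [TE ->]]]; first by case: (frame_reflB_neq_reflC fr rs sN (esym TE)).
have [k [l h]] := frame_reflC_inj fr TE.
by rewrite -(CA_shift p k) -(CA_shift r l) h.
Qed.

Lemma artin_liftE t z : artin_lift_rel t z -> artin_lift t = z.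
Proof.
move=> h; apply: (artin_lift_rel_inj _ h).
by apply: (@xgetPex _ 1%g [set z0 | artin_lift_rel t z0]%classic); exists z.
Qed.

Lemma artin_liftB p q : (p < q)%N -> (q < p + N)%N -> artin_lift (T (v p - v q)) = BA p q.
Proof. by move=> pq qN; apply: artin_liftE; left; exists p, q. Qed.

Lemma artin_liftC p : artin_lift (T (f0 - v p)) = CA p.
Proof. by apply: artin_liftE; right; exists p. Qed.

Lemma artin_lift_simple k : (k < N.+1)%N -> artin_lift (sr k) = x k.
Proof.
case: k => [_|[_|k kN]]; rewrite /sr.
- by rewrite artin_liftC (artin_CN gens).
- by rewrite artin_liftC artin_C0.
- by rewrite artin_liftB ?artin_BS ?(artin_sgE gens) //; lia.
Qed.

Let value_unique w s s' : below w g -> factors s w -> factors s' w ->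
  factor_value artin_lift s = factor_value artin_lift s'.
Proof.
move=> wg; apply: (@factor_value_unique _ _ _ _ g) => //.
  move=> a b ra rb; apply: (frame_phi_dual fr (artin_dual_system gens)) => //.
    exact: artin_liftB.
  exact: artin_liftC.
by move=> w0 x y z; exact: (frame_no_neg3 fr).
Qed.

(** Independence of the factorization makes the value on [{w}] well defined, and the defining
    relations then hold because reduced factorizations of [w1] and of its quotient in [w3]
    concatenate to one of [w3]. *)
Lemma poset_to_artin : exists F : UMagmaMorphism.type Gam A,
  forall w s, below w g -> factors s w -> F (tk w) = factor_value artin_lift s.
Proof.
have fac (w : poset_interval W g) : exists s, factors s (val w).
  by apply: factorsP; have [[]] := set_mem (valP w).
pose f w := factor_value artin_lift (projT1 (cid (fac w))).
have fE w s : factors s (val w) -> f w = factor_value artin_lift s.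
  move=> fs; rewrite /f; case: cid => s' /= fs'; apply: value_unique fs' fs.
  by apply/below_refl_le; have [] := set_mem (valP w).
have [|F FE] := @pres_homP _ (@poset_rel R n W g) A f.
  move=> l r [w1 [w2 [w3 [h12 w2E -> ->]]]].
  rewrite !big_cons !big_nil !mulg1.
  have [s1 fs1] := fac w1; have [s2 fs2] := fac w2.
  have b13 := iffLR (below_refl_le _ _) h12.
  have w1W : W (val w1) by case: b13.
  have fs3 : factors (s1 ++ s2) (val w3).
    by apply: factors_cat b13 fs1 _; rewrite -orthmx_inv -?w2E //; exact: groupD_orth.
  by rewrite (fE _ _ fs1) (fE _ _ fs2) (fE _ _ fs3) /factor_value big_cat.
exists F => w s wg fs; have [w1|w1] := eqVneq w 1%:M.
  rewrite w1 poset_gen1 gmulf1; case: fs => _ _; rewrite w1 codim1 => /size0nil ->.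
  by rewrite /factor_value big_nil.
have [p pw] := in_poset wg (elimN eqP w1).
by rewrite -pw poset_genE FE; apply: fE; rewrite pw.
Qed.

Lemma artin_to_poset : exists F : UMagmaMorphism.type A Gam,
  forall k, (k < N.+1)%N -> F (x k) = tk (sr k).
Proof.
have PG := poset_generators.
have [|F FE] := @pres_homP _ (@artinD_rel N.+1) Gam (fun i => tk (sr i)).
  have cm (i j : 'I_N.+1) l r : commute (tk (sr i)) (tk (sr j)) -> commute_rel i j l r ->
      (\prod_(k <- l) tk (sr k) = \prod_(k <- r) tk (sr k))%g.
    by move=> c [-> ->]; rewrite !big_cons !big_nil !mulg1.
  have br (i j : 'I_N.+1) l r : braided (tk (sr i)) (tk (sr j)) -> braid_rel i j l r ->
      (\prod_(k <- l) tk (sr k) = \prod_(k <- r) tk (sr k))%g.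
    by move=> c [-> ->]; rewrite !big_cons !big_nil !mulg1 !mulgA.
  have commS (i j : 'I_N.+1) : (0 < i)%N -> (i.+1 < j)%N -> commute (tk (sr i)) (tk (sr j)).
    move=> i0 ij; have jN := ltn_ord j; have -> : j = (j - 2).+2 :> nat by lia.
    have [i1|i1] := eqVneq (i : nat) 1%N; first by rewrite i1; apply: (artin_bsi PG); lia.
    have -> : i = (i - 2).+2 :> nat by lia.
    by apply: (artin_ssc PG); lia.
  move=> l r; case=> {l r} i j l r.
  - move=> i0 j1; apply: cm; have -> : i = 0%N :> nat by lia.
    have -> : j = 1%N :> nat by lia.
    exact: artin_ab PG.
  - move=> i0 j1; have jN := ltn_ord j; apply: br; have -> : i = 0%N :> nat by lia.
    have -> : j = 2%N :> nat by lia.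
    by apply: artin_as0 PG _; lia.
  - move=> i0 j1; have jN := ltn_ord j; apply: cm; have -> : i = 0%N :> nat by lia.
    have -> : j = (j - 2).+2 :> nat by lia.
    by apply: (artin_asi PG); lia.
  - move=> iN ij; apply: br; have jN := ltn_ord j.
    have -> : j = i.+1 :> nat by lia.
    have [i1|i1] := eqVneq (i : nat) 1%N; first by rewrite i1; apply: (artin_bs0 PG); lia.
    have -> : i = (i - 2).+2 :> nat by lia.
    by apply: (artin_ssS PG); lia.
  - move=> i0 j0 ij; apply: cm; case: ij => ij; first by apply: commS; lia.
    by apply: commute_sym; apply: commS; lia.
exists F => k kN; rewrite FE inordK //.
Qed.

(** * The Artin elements of all reflections go to the corresponding poset generators *)

Section Inverse.
Variable F : UMagmaMorphism.type A Gam.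
Hypothesis FE : forall k, (k < N.+1)%N -> F (x k) = tk (sr k).
Local Notation d := (artin_delta N (x 0) (x 1) (fun i => x i.+2)).
Local Notation sgA := (artin_sg N (x 0) (x 1) (fun i => x i.+2)).
Local Notation CAc := (artin_C N (x 0) (x 1) (fun i => x i.+2)).

Lemma poset_hom_delta : F d = tk g.
Proof.
rewrite (poset_gen_factors (below_refl gW) (frame_factors fr nN)).
rewrite /frame_word !big_cons big_map /artin_delta !gmulfM !FE ?ltnS // -mulgA.
congr (_ * (_ * _))%g; rewrite gmulf_prod /index_iota subn0.
rewrite big_seq_cond [RHS]big_seq_cond; apply: eq_bigr => i.
by rewrite mem_iota andbT => iN; rewrite FE //; lia.
Qed.

Let F_conj t a : is_root a -> moved g a -> F t = tk (T a) -> F (t ^ d^-1)%g = tk (T (g *m a)).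
Proof.
by move=> ra ma Ft; rewrite gmulfJ gmulfV poset_hom_delta Ft; exact: poset_gen_conj.
Qed.

Lemma poset_hom_sg p : (1 < N)%N -> F (sgA p) = tk (T (v p - v p.+1)).
Proof.
move=> N1; elim: p => [|p IH]; first by rewrite (artin_sgE gens) // FE.
have ra : is_root (v p - v p.+1) by apply: (frame_rootB fr); lia.
rewrite -[p.+1]addn1 artin_sgD expg1 (F_conj ra _ IH); last exact: (frame_movedB fr).
by rewrite mulmxBr !(frame_next fr) addn1.
Qed.

Lemma poset_hom_C c p : F (CAc c p) = tk (T (f0 - v (p + (if c then N else 0)))).
Proof.
elim: p c => [|p IH] c; first by rewrite artin_C0; case: c; rewrite /= ?addn0 FE.
rewrite -[p.+1]addn1 artin_C_shift expg1.
rewrite (F_conj (frame_rootC fr _) (frame_movedC fr _) (IH _)).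
(* As [g] negates [f0], the image of f0 - v m is f0 + v (m + 1) up to sign: the index gains N, which
   compensates the parity flip of the end in [artin_C]. *)
rewrite mulmxBr (frame_center fr) (frame_next fr) -reflmxN opprB opprK addrC.
case: c => /=; first by rewrite (frame_half fr) opprK addn0 addn1.
by rewrite addn0 -addSn (frame_half fr) addn1.
Qed.

Lemma poset_hom_B p q : (p < q)%N -> (q < p + N)%N -> F (BA p q) = tk (T (v p - v q)).
Proof.
move=> pq; elim: q pq => // q IH; rewrite ltnS leq_eqVlt => /orP[/eqP <-|pq] qN.
  by rewrite artin_BS poset_hom_sg //; lia.
rewrite artin_Br // gmulfJ IH ?poset_hom_sg //; try lia.
by apply: conjg_eq; apply: (proj1 (triB _ _ _)); lia.
Qed.

Lemma poset_hom_lift a : is_root a -> F (artin_lift (T a)) = tk (T a).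
Proof.
move=> /(frame_root_cases fr)[[r [s [rs sN ->]]]|[r ->]]; first by rewrite artin_liftB // poset_hom_B.
by rewrite artin_liftC poset_hom_C addn0.
Qed.

Lemma poset_hom_factors w s : below w g -> factors s w -> F (factor_value artin_lift s) = tk w.
Proof.
move=> wg fs; rewrite (poset_gen_factors wg fs) /factor_value gmulf_prod.
rewrite big_seq_cond [RHS]big_seq_cond; apply: eq_bigr => r; rewrite andbT => rs.
by have [/(_ r rs)/reflectionsE[a ra ->] _ _] := fs; exact: poset_hom_lift.
Qed.

End Inverse.

Theorem frame_isomorphic : isomorphic Gam (artinD n).
Proof.
rewrite [X in artinD X]nN.
have [P PE] := poset_to_artin; have [F FE] := artin_to_poset.
exists P; exists F => z.
  suff : (F \o P) =1 id by move/(_ z).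
  apply: (@pres_hom_id _ _ (F \o P)) => w.
  have wg : below (val w) g by apply/below_refl_le; have [] := set_mem (valP w).
  have wW : W (val w) by case: wg.
  have [s fs] := factorsP wW.
  by rewrite /= -poset_genE (PE _ _ wg fs) (poset_hom_factors FE wg fs).
suff : (P \o F) =1 id by move/(_ z).
apply: (@pres_hom_id _ _ (P \o F)) => i.
have -> : pres_gen (@artinD_rel N.+1) i = x i by rewrite /artin_gen inord_val.
have [a [ra ma srE]] := simple_refl_root (ltn_ord i).
have fs : factors [:: T a] (T a).
  split=> //; last by rewrite codim_refl //; exact: root_neq0.
    by move=> r; rewrite inE => /eqP ->; apply/reflectionsE; exists a.
  by rewrite /mxprod big_cons big_nil mulmx1.
rewrite /= FE // srE (PE _ _ (iffRL (below_refl_moved ra gW) ma) fs).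
by rewrite /factor_value big_seq1 -srE artin_lift_simple.
Qed.

End Isomorphism.

(** * Coxeter elements have Coxeter frames *)

Section StandardProducts.
Local Open Scope ring_scope.
Variables (R : realType) (n : nat).
Local Notation W := (groupD R n).
Local Notation T := (@reflmx R n).
Local Notation e := (@basis_vec R n).

Lemma reflmx_comm (a b : 'cV[R]_n) : dot a b = 0 -> T a *m T b = T b *m T a.
Proof.
move=> ab; apply: mulmx_cV_ext => x; rewrite -!mulmxA !reflmxE !dotBr !dotZr.
by rewrite ab (dotC b a) ab !mulr0 !subr0 addrAC.
Qed.

Variable f : nat -> 'cV[R]_n.
Hypothesis fs : forall i, (i < n)%N -> signed (f i).
Hypothesis ff : forall i j, (i < n)%N -> (j < n)%N -> i <> j -> dot (f i) (f j) = 0.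

(** The simple roots of type D in the signed basis [f]. Nodes 0 and 1 are the prongs of the fork,
    both attached to node 2. *)
Definition standard_root (k : nat) : 'cV[R]_n :=
  if k is k'.+1 then f k - f k' else f 0 + f 1.
Local Notation bet := standard_root.
Local Notation prodT ks := (mxprod [seq T (bet k) | k <- ks]).

(* The product [K] of the first [M + 1] standard reflections, in some order, acts as
   [c][u 0, ..., u (M - 1)] with [u 0 = f M]. *)
Definition cycle_shape (M : nat) (K : 'M[R]_n) (c : 'cV[R]_n) (u : nat -> 'cV[R]_n) : Prop :=
  [/\ [/\ u 0 = f M, u M = - u 0 & forall i, (i < M)%N -> K *m u i = u i.+1],
      [/\ signed c, K *m c = - c & forall i, (i < M)%N -> dot c (u i) = 0],
      [/\ forall i, (i < M)%N -> signed (u i) &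
          forall i j, (i < j)%N -> (j < M)%N -> dot (u i) (u j) = 0] &
      forall j, (M < j < n)%N ->
        [/\ K *m f j = f j, dot (f j) c = 0 & forall i, (i < M)%N -> dot (f j) (u i) = 0]].

(** The swap of [f M] and [f M.+1] inserts one vector into the long cycle, because [K] fixes
    [f M.+1] and the cycle starts at [f M]. *)
Lemma cycle_shape_step M K c u (b : bool) : (0 < M)%N -> (M.+1 < n)%N -> cycle_shape M K c u ->
  let t := T (f M.+1 - f M) in
  exists u', cycle_shape M.+1 (if b then K *m t else t *m K) c u'.
Proof.
move=> M0 mn [[u0 uM Ku] [sc Kc cu] [su uu] Kf] t.
have sm := fs mn; have sm1 : signed (f M) by apply: fs; lia.
have mm : dot (f M.+1) (f M) = 0 by apply: ff => //; lia.
have [Kfm fmc fmu] : [/\ K *m f M.+1 = f M.+1, dot (f M.+1) c = 0 &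
    forall i, (i < M)%N -> dot (f M.+1) (u i) = 0] by apply: Kf; lia.
have fm1c : dot (f M) c = 0 by rewrite -u0 dotC cu.
have fm1u i : (0 < i)%N -> (i < M)%N -> dot (f M) (u i) = 0 by rewrite -u0; exact: uu.
have tc : t *m c = c by exact: reflmx_swap_id.
have tu i : (0 < i)%N -> (i < M)%N -> t *m u i = u i.
  by move=> i0 iM; apply: reflmx_swap_id; [exact: fmu|exact: fm1u].
have tm : t *m f M.+1 = f M by exact: reflmx_swapl.
have tm1 : t *m f M = f M.+1 by exact: reflmx_swapr.
have tf j : (M.+1 < j < n)%N -> t *m f j = f j.
  by move=> jn; apply: reflmx_swap_id; apply: ff; lia.
have Kfj j : (M.+1 < j < n)%N -> [/\ K *m f j = f j, dot (f j) c = 0 &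
    forall i, (i < M)%N -> dot (f j) (u i) = 0] by move=> jn; apply: Kf; lia.
have fjm j : (M.+1 < j < n)%N -> dot (f j) (f M.+1) = 0 by move=> jn; apply: ff; lia.
have suM i : (i < M.+1)%N -> signed (u i).
  rewrite ltnS leq_eqVlt => /predU1P[->|]; last exact: su.
  by rewrite uM; apply: signedN; exact: su.
have dcM x : (forall i, (i < M)%N -> dot x (u i) = 0) -> forall i, (i < M.+1)%N -> dot x (u i) = 0.
  move=> h i; rewrite ltnS leq_eqVlt => /predU1P[->|]; last exact: h.
  by rewrite uM dotNr h // oppr0.
have Kt x : K *m t *m x = K *m (t *m x) by rewrite mulmxA.
have tK x : t *m K *m x = t *m (K *m x) by rewrite mulmxA.
have tuM : t *m u M = - f M.+1 by rewrite uM u0 mulmxN tm1.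
case: b.
(* The new cycle is [f M.+1, u 1, ..., u M.-1, - f M]: the vector [f M.+1] takes the place of [u 0],
   and [- f M] is appended. *)
- pose u' i := if i == 0%N then f M.+1 else if i == M.+1 then - f M.+1 else u i.
  have u'E i : (0 < i)%N -> (i < M.+1)%N -> u' i = u i.
    by move=> i0 iM; rewrite /u'; case: eqP => [|_]; [lia|case: eqP => //; lia].
  have u'0 : u' 0%N = f M.+1 by [].
  have u'M : u' M.+1 = - f M.+1 by rewrite /u' eqxx.
  have xu x : dot x (f M.+1) = 0 -> (forall i, (i < M)%N -> dot x (u i) = 0) ->
      forall i, (i < M.+1)%N -> dot x (u' i) = 0.
    by move=> h0 h [|i] iM; [rewrite u'0|rewrite u'E //; exact: dcM].
  exists u'; split.
  + split; [exact: u'0|by rewrite u'M u'0|].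
    case=> [_|i iM]; first by rewrite u'0 u'E // Kt tm -u0 Ku.
    rewrite u'E // Kt; have [->|iM'] := eqVneq i.+1 M.
      by rewrite tuM mulmxN Kfm u'M.
    by rewrite tu ?u'E ?Ku //; lia.
  + split; [exact: sc|by rewrite Kt tc|].
    by apply: xu => //; rewrite dotC.
  + split; first by case=> [|i] iM; [rewrite u'0|rewrite u'E //; exact: suM].
    case=> [|i] j ij jM; first by rewrite u'0 u'E //; apply: dcM.
    rewrite !u'E; try lia.
    have [jE|jE] := eqVneq j M; last by apply: uu; lia.
    by rewrite jE uM dotNr dotC uu ?oppr0 //; lia.
  + move=> j jn; have [h1 h2 h3] := Kfj j jn; split; [by rewrite Kt tf|exact: h2|].
    by apply: xu => //; exact: fjm.
(* With the swap on the left the new cycle is [f M.+1, u 0, ..., u M.-1]. *)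
pose u' i := if i is j.+1 then if j == M then - f M.+1 else u j else f M.+1.
have u'S i : (i < M)%N -> u' i.+1 = u i by move=> iM; rewrite /u'; case: eqP => //; lia.
have u'0 : u' 0%N = f M.+1 by [].
have u'M : u' M.+1 = - f M.+1 by rewrite /u' eqxx.
have xu x : dot x (f M.+1) = 0 -> (forall i, (i < M)%N -> dot x (u i) = 0) ->
    forall i, (i < M.+1)%N -> dot x (u' i) = 0.
  by move=> h0 h [|i] iM; [rewrite u'0|rewrite u'S //; exact: h].
exists u'; split.
- split; [exact: u'0|by rewrite u'M u'0|].
  case=> [_|i iM]; first by rewrite u'0 u'S // tK Kfm tm u0.
  rewrite u'S // tK Ku //; have [->|iM'] := eqVneq i.+1 M; first by rewrite tuM u'M.
  by rewrite tu ?u'S //; lia.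
- split; [exact: sc|by rewrite tK Kc mulmxN tc|].
  by apply: xu => //; rewrite dotC.
- split; first by case=> [|i] iM; [rewrite u'0|rewrite u'S //; exact: su].
  case=> [|i] [|j] // ij jM; first by rewrite u'0 u'S //; apply: fmu.
  by rewrite !u'S ?uu //; lia.
- move=> j jn; have [h1 h2 h3] := Kfj j jn; split; [by rewrite tK h1 tf|exact: h2|].
  by apply: xu => //; exact: fjm.
Qed.

Lemma prodT_cat k1 k2 : prodT (k1 ++ k2) = prodT k1 *m prodT k2.
Proof. by rewrite map_cat mxprod_cat. Qed.

Lemma prodT_cons k ks : prodT (k :: ks) = T (bet k) *m prodT ks.
Proof. by rewrite /= /mxprod big_cons. Qed.

(** The condition 1 < M excludes the fork, where node 0 is attached to node 2. *)
Lemma standard_root_orth M k : (M.+1 < n)%N -> (k < M)%N -> (1 < M)%N ->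
  dot (bet k) (bet M.+1) = 0.
Proof.
move=> Mn kM M1; case: k kM => [|k] kM; rewrite /bet.
  by rewrite dotDl !dotBr !ff ?subrr ?addr0 //; lia.
by rewrite dotBl !dotBr !ff ?subrr //; lia.
Qed.

Lemma standard_root_fix k j : (k < j)%N -> (1 < j < n)%N -> dot (bet k) (f j) = 0.
Proof.
case: k => [|k] kj jn; rewrite /bet; first by rewrite dotDl !ff ?addr0 //; lia.
by rewrite dotBl !ff ?subrr //; lia.
Qed.

Lemma prodT_comm M ks : (M.+1 < n)%N -> all (fun k => (k < M) && (1 < M))%N ks ->
  prodT ks *m T (bet M.+1) = T (bet M.+1) *m prodT ks.
Proof.
move=> Mn; elim: ks => [|k ks IH]; first by rewrite /= /mxprod big_nil mul1mx mulmx1.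
move=> /= /andP[/andP[kM M1] h]; rewrite prodT_cons -mulmxA IH // mulmxA reflmx_comm ?mulmxA //.
exact: standard_root_orth.
Qed.

Lemma cycle_shape_base ks : (1 < n)%N -> perm_eq ks [:: 0; 1]%N ->
  exists c u, cycle_shape 1 (prodT ks) c u.
Proof.
move=> n1 pks; have sz := perm_size pks; have ms := perm_mem pks; have us := perm_uniq pks.
exists (f 0), (fun i => if i == 0%N then f 1%N else - f 1%N).
have o01 : dot (f 1%N) (f 0%N) = 0 by apply: ff; lia.
have f0s : signed (f 0) by apply: fs; lia.
have f1s : signed (f 1%N) by apply: fs.
have bE : bet 0 = f 1%N - - f 0 by rewrite opprK addrC.
have o01' : dot (f 1%N) (- f 0%N) = 0 by rewrite dotNr o01 oppr0.
have f0n := signedN f0s.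
have A1 : T (bet 0) *m f 0 = - f 1%N.
  by rewrite -[in X in _ *m X](opprK (f 0)) mulmxN bE reflmx_swapr.
have A2 : T (bet 0) *m f 1%N = - f 0 by rewrite bE reflmx_swapl.
have A3 : T (bet 1) *m f 1%N = f 0 by exact: reflmx_swapl.
have A4 : T (bet 1) *m f 0 = f 1%N by exact: reflmx_swapr.
have tf k j : (k < 2)%N -> (1 < j < n)%N -> T (bet k) *m f j = f j.
  by move=> k2 jn; apply: reflmx_id; apply: standard_root_fix; lia.
have K01 : T (bet 0) *m T (bet 1) = T (bet 1) *m T (bet 0).
  apply: reflmx_comm; rewrite dotDl !dotBr (dotC (f 0) (f 1%N)) o01 !signed_norm //.
  by rewrite sub0r subr0 addNr.
have KE : prodT ks = T (bet 0) *m T (bet 1).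
  case: ks sz ms us {pks} => [|a [|b []]] //= _ ms us.
  have h0 := ms 0%N; have h1 := ms 1%N; rewrite !inE /= in h0 h1.
  rewrite /mxprod !big_cons big_nil mulmx1.
  have [[-> ->]|[-> ->]] : (a = 0 /\ b = 1 \/ a = 1 /\ b = 0)%N by lia.
    by [].
  by rewrite K01.
rewrite KE; split.
- split=> //; case=> // _ /=.
  by rewrite -mulmxA A3 A1.
- split=> //; first by rewrite -mulmxA A4 A2.
  by case=> // _; rewrite dotC.
- split; first by case.
  by move=> i j ij; case: j ij.
- move=> j jn; split; [by rewrite -mulmxA !tf|by apply: ff; lia|].
  by case=> // _; apply: ff; lia.
Qed.

(** The one order in which the last reflection commutes past neither neighbour. The product negates
    [f 1], so the central vector is [f 1] here and not [f 0]. *)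
Lemma cycle_shape_sandwich a b : (2 < n)%N -> perm_eq [:: a; b] [:: 0; 1]%N ->
  exists c u, cycle_shape 2 (prodT [:: a; 2; b]%N) c u.
Proof.
move=> n2 pab; have us := perm_uniq pab.
have ms := perm_mem pab; have h0 := ms 0%N; have h1 := ms 1%N; rewrite !inE /= in h0 h1.
have o i j : (i < 3)%N -> (j < 3)%N -> i <> j -> dot (f i) (f j) = 0 by move=> *; apply: ff; lia.
have s i : (i < 3)%N -> signed (f i) by move=> *; apply: fs; lia.
have [o10 o20 o21] : [/\ dot (f 1%N) (f 0) = 0, dot (f 2%N) (f 0) = 0 & dot (f 2%N) (f 1%N) = 0].
  by split; apply: o.
have [o01 o02 o12] : [/\ dot (f 0) (f 1%N) = 0, dot (f 0) (f 2%N) = 0 & dot (f 1%N) (f 2%N) = 0].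
  by split; apply: o.
have [f0s f1s f2s] : [/\ signed (f 0), signed (f 1%N) & signed (f 2%N)] by split; apply: s.
have bE : bet 0 = f 1%N - - f 0 by rewrite opprK addrC.
have o01' : dot (f 1%N) (- f 0%N) = 0 by rewrite dotNr o10 oppr0.
have f0n := signedN f0s.
have A1 : T (bet 0) *m f 0 = - f 1%N.
  by rewrite -[in X in _ *m X](opprK (f 0)) mulmxN bE reflmx_swapr.
have A2 : T (bet 0) *m f 1%N = - f 0 by rewrite bE reflmx_swapl.
have A3 : T (bet 1) *m f 1%N = f 0 by exact: reflmx_swapl.
have A4 : T (bet 1) *m f 0 = f 1%N by exact: reflmx_swapr.
have A5 : T (bet 2) *m f 2%N = f 1%N by exact: reflmx_swapl.
have A6 : T (bet 2) *m f 1%N = f 2%N by exact: reflmx_swapr.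
have A7 : T (bet 0) *m f 2%N = f 2%N by apply: reflmx_id; rewrite /bet dotDl o02 o12 addr0.
have A8 : T (bet 1) *m f 2%N = f 2%N by apply: reflmx_id; rewrite /bet dotBl o02 o12 subr0.
have A9 : T (bet 2) *m f 0 = f 0 by apply: reflmx_id; rewrite /bet dotBl o20 o10 subr0.
have tf k j : (k < 3)%N -> (2 < j < n)%N -> T (bet k) *m f j = f j.
  by move=> k2 jn; apply: reflmx_id; apply: standard_root_fix; lia.
have KE x : prodT [:: a; 2; b]%N *m x = T (bet a) *m (T (bet 2) *m (T (bet b) *m x)).
  by rewrite /= /mxprod !big_cons big_nil mulmx1 -!mulmxA.
have main (y : 'cV[R]_n) : y = f 0 \/ y = - f 0 -> prodT [:: a; 2; b]%N *m f 2%N = y ->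
    prodT [:: a; 2; b]%N *m y = - f 2%N -> prodT [:: a; 2; b]%N *m f 1%N = - f 1%N ->
    exists c u, cycle_shape 2 (prodT [:: a; 2; b]%N) c u.
  move=> yE K2 Ky K1; exists (f 1%N), (fun i => if i == 0%N then f 2%N else if i == 1%N then y else - f 2%N).
  have yo x : dot x (f 0) = 0 -> dot x y = 0 by case: yE => ->; rewrite ?dotNr => ->; rewrite ?oppr0.
  split.
  - by split=> //; case=> [|[|]].
  - by split=> //; case=> [|[|]] // _ /=; exact: yo.
  - split; first by case=> [|[|]] // _ /=; case: yE => ->.
    by move=> [|[|i]] [|[|j]] // _ _ /=; exact: yo.
  - move=> j jn; split; [by rewrite KE !tf //; lia|by apply: ff; lia|].
    by case=> [|[|]] // _ /=; [apply: ff; lia|apply: yo; apply: ff; lia].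
have [[aE bE']|[aE bE']] : (a = 0 /\ b = 1 \/ a = 1 /\ b = 0)%N by move: us; rewrite /=; lia.
  apply: (main (- f 0)); [by right| | |]; rewrite KE aE bE'.
  - by rewrite A8 A5 A2.
  - by rewrite mulmxN A4 mulmxN A6 mulmxN A7.
  - by rewrite A3 A9 A1.
apply: (main (f 0)); [by left| | |]; rewrite KE aE bE'.
- by rewrite A7 A5 A3.
- by rewrite A1 mulmxN A6 mulmxN A8.
- by rewrite A2 mulmxN A9 mulmxN A4.
Qed.

(** Induction by removing the largest index M + 1. For M > 1 only index M fails to commute with it,
    so it can be moved to the end of the word away from M, where [cycle_shape_step] applies. For M =
    1 both 0 and 1 obstruct, which leaves the sandwich. *)
Lemma cycle_shape_prod M ks : (0 < M)%N -> (M < n)%N -> perm_eq ks (iota 0 M.+1) ->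
  exists c u, cycle_shape M (prodT ks) c u.
Proof.
elim: M ks => // M IH ks _ Mn pks.
have [M0|M0] := posnP M.
  by move: Mn pks; rewrite M0; exact: cycle_shape_base.
have : M.+1 \in ks by rewrite (perm_mem pks) mem_iota; lia.
move=> Mks; case/splitPr: Mks pks => A B pks.
have pAB : perm_eq (A ++ B) (iota 0 M.+1).
  have iE : iota 0 M.+2 = iota 0 M.+1 ++ [:: M.+1] by rewrite -[in LHS]addn1 iotaD.
  have pA : perm_eq (A ++ M.+1 :: B) (M.+1 :: (A ++ B)).
    exact: (permEl (perm_catCA A [:: M.+1] B)).
  have pI : perm_eq (iota 0 M.+1 ++ [:: M.+1]) (M.+1 :: iota 0 M.+1) by rewrite perm_catC.
  rewrite iE in pks; rewrite -(perm_cons M.+1) perm_sym.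
  by rewrite perm_sym (perm_trans _ (perm_trans pks pI)) // perm_sym.
have AB k : (k \in A ++ B) = (k < M.+1)%N by rewrite (perm_mem pAB) mem_iota.
have uAB : uniq (A ++ B) by rewrite (perm_uniq pAB) iota_uniq.
have [c [u sh]] := IH _ M0 (ltnW Mn) pAB.
have tE : bet M.+1 = f M.+1 - f M by [].
have right : all (fun k => (k < M) && (1 < M))%N B -> exists c u, cycle_shape M.+1 (prodT (A ++ M.+1 :: B)) c u.
  move=> hB; have [u' sh'] := cycle_shape_step true M0 Mn sh; exists c, u'.
  by rewrite prodT_cat prodT_cons -prodT_comm // mulmxA -prodT_cat.
have left : all (fun k => (k < M) && (1 < M))%N A -> exists c u, cycle_shape M.+1 (prodT (A ++ M.+1 :: B)) c u.
  move=> hA; have [u' sh'] := cycle_shape_step false M0 Mn sh; exists c, u'.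
  by rewrite prodT_cat prodT_cons mulmxA prodT_comm // -mulmxA -prodT_cat.
have [M1|M1] := ltnP 1 M; last first.
  have ME : M = 1%N by lia.
  rewrite {}ME in pAB left right Mn *; have sz := perm_size pAB; move: sz; rewrite size_cat /=.
  case: A pAB left right {uAB AB sh pks} => [|a [|a' A]] pAB left right; first by move=> _; exact: left.
    case: B pAB {left} right => [|b [|b' B]] // pAB right sz.
    exact: cycle_shape_sandwich.
  case: B pAB left right => [|b B] pAB _ right sz; first exact: right.
  by exfalso; move: sz; rewrite /=; lia.
have small k : k \in A ++ B -> k <> M -> ((k < M) && (1 < M))%N by rewrite M1 AB; lia.
have : M \in A ++ B by rewrite AB.
move: uAB; rewrite cat_uniq mem_cat => /and3P[_ hAB _] /orP[MA|MB].
  apply: right; apply/allP => k kB; apply: small; first by rewrite mem_cat kB orbT.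
  by move=> kM; move/hasPn: hAB => /(_ k kB); rewrite /= kM MA.
apply: left; apply/allP => k kA; apply: small; first by rewrite mem_cat kA.
by move=> kM; move/hasPn: hAB => /(_ M MB); rewrite /= -kM kA.
Qed.

End StandardProducts.

(** * Simple systems of type D and the frame of a Coxeter element *)

Section FrameExistence.
Local Open Scope ring_scope.
Variables (R : realType) (n : nat).
Local Notation W := (groupD R n).
Local Notation T := (@reflmx R n).
Local Notation e := (@basis_vec R n).

Lemma signed_complete (h : 'I_n -> 'cV[R]_n) : (forall i, signed (h i)) ->
  (forall i j, i != j -> dot (h i) (h j) = 0) ->
  forall x, signed x -> exists i, x = h i \/ x = - h i.
Proof.
move=> hs hh x [k xk]; have [sigma hE] := choice hs.
have sigma_inj : injective sigma.
  move=> i j ij; apply/eqP/negPn/negP => /hh; have hi := hE i; have hj := hE j.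
  rewrite ij in hi; move/eqP; case: hi hj => -> [->|->];
    by rewrite ?dotNl ?dotNr ?opprK dot_basis basisE eqxx ?oppr_eq0 oner_eq0.
exists (invF sigma_inj k); have := hE (invF sigma_inj k); rewrite f_invF.
by case: xk => -> [->|->]; rewrite ?opprK; [left|right|right|left].
Qed.

Lemma frame_of_shape N f K c u : n = N.+1 -> (0 < N)%N -> W K -> @cycle_shape R n f N K c u ->
  (forall i, (i < n)%N -> signed (f i)) ->
  coxeter_frame N K c (fun p => iter p (mulmx K) (u 0)).
Proof.
move=> nN N0 KW [[u0 uN Ku] [sc Kc cu] [su uu] _] fs.
set v := fun p => iter p (mulmx K) (u 0).
have oK := groupD_orth KW.
have vu i : (i <= N)%N -> v i = u i.
  by elim: i => // i IH iN; rewrite /v /= -/(v i) IH ?Ku //; exact: ltnW.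
have iterN p x : iter p (mulmx K) (- x) = - iter p (mulmx K) x.
  by elim: p => //= p ->; rewrite mulmxN.
have vN p : v (p + N)%N = - v p by rewrite /v iterD -/(v N) vu // uN iterN.
have sv p : signed (v p).
  by elim: p => [|p IH]; [apply: su|rewrite /v /=; apply: groupD_signed].
have cv p : dot c (v p) = 0.
  elim: p => [|p IH]; first by apply: cu.
  have := dot_orth c (v p) oK; rewrite Kc dotNl IH => /eqP.
  by rewrite oppr_eq0 => /eqP.
have vv p q : (p < q)%N -> (q < p + N)%N -> dot (v p) (v q) = 0.
  elim: p q => [|p IH] [|q] // pq qN; first by rewrite !vu //; [apply: uu|lia].
  by rewrite /v /= dot_orth // IH //; lia.
split=> //.
pose h (i : 'I_n) := if i is Ordinal j.+1 _ then v j else c.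
have hs i : signed (h i) by case: i => [[|j] jn] /=; [exact: sc|exact: sv].
have hh i j : i != j -> dot (h i) (h j) = 0.
  move: i j => [[|i] iN] [[|j] jN] //= ij; first by rewrite dotC.
  have ij' : i <> j by move=> e'; move/eqP: ij; apply; apply: val_inj; rewrite /= e'.
  by have [h'|h'] := ltnP i j; [apply: vv|rewrite dotC; apply: vv]; lia.
move=> x sx; have [[[|j] jn] /= xE] := signed_complete hs hh sx.
  by case: xE => xE; [constructor 1|constructor 2].
by constructor 3; case: xE => xE; [exists j|exists (j + N)%N; rewrite vN].
Qed.

Lemma cV_sum (x : 'cV[R]_n) : x = \sum_k x k 0 *: e k.
Proof.
apply/matrixP => i j; rewrite ord1 summxE (bigD1 i) //= big1 ?addr0 => [|k ki].
  by rewrite mxE basisE eqxx mulr1.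
by rewrite mxE basisE eq_sym (negPf ki) mulr0.
Qed.

(** The sum of the coordinates with respect to [s]. For a simple system its sign tells positive
    roots from negative ones. *)
Lemma free_functional (s : seq 'cV[R]_n) : free s ->
  exists lam, forall a, a \in s -> dot lam a = 1.
Proof.
move=> fs; pose L x := \sum_i coord (in_tuple s) i x.
exists (\col_k L (e k)) => a /(nthP 0)[l ls <-].
have -> x : dot (\col_k L (e k)) x = L x.
  rewrite dotE [in RHS](cV_sum x) /L; under [RHS]eq_bigr do rewrite linear_sum.
  rewrite exchange_big; apply: eq_bigr => k _; rewrite mxE mulr_suml.
  by apply: eq_bigr => i _; rewrite linearZ /= mulrC.
have fs' : free (in_tuple s) by [].
rewrite /L (bigD1 (Ordinal ls)) //= big1 => [|i il].
  by have := coord_free (Ordinal ls) (Ordinal ls) fs'; rewrite /= => ->; rewrite eqxx addr0.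
by have := coord_free (Ordinal ls) i fs'; rewrite /= => ->; rewrite eq_sym (negPf il).
Qed.

(** Signs and order are chosen so that [lam] lies in the chamber of the standard roots. The values
    are strictly increasing because [lam] vanishes on no difference; the first one may be 0. *)
Lemma sorted_frame (lam : 'cV[R]_n) : (forall a, is_root a -> dot lam a <> 0) ->
  exists f : nat -> 'cV[R]_n,
  [/\ forall i, (i < n)%N -> signed (f i),
      forall i j, (i < n)%N -> (j < n)%N -> i <> j -> dot (f i) (f j) = 0,
      forall i, (i < n)%N -> 0 <= dot lam (f i) &
      forall i j, (i < j)%N -> (j < n)%N -> dot lam (f i) < dot lam (f j)].
Proof.
move=> lam0; pose E i := if 0 <= dot lam (e i) then e i else - e i.
have sE i : signed (E i).
  by rewrite /E; case: ifP => _; [exact: signed_basis|exact: signedN (signed_basis _ _)].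
have EE i j : i != j -> dot (E i) (E j) = 0.
  move=> ij; have o : dot (e i) (e j) = 0 by rewrite dot_basis basisE (negPf ij).
  by rewrite /E; do 2!case: ifP => _; rewrite ?dotNl ?dotNr o ?oppr0.
have E_inj : injective E.
  move=> i j ij; apply/eqP/negPn/negP => /EE; rewrite ij signed_norm // => /eqP.
  by rewrite oner_eq0.
have E0 i : 0 <= dot lam (E i).
  by rewrite /E; case: ifP => // /negbT; rewrite -ltNge dotNr oppr_ge0; exact: ltW.
pose le (x y : 'cV[R]_n) := dot lam x <= dot lam y.
pose F := sort le [seq E i | i <- enum 'I_n].
have szF : size F = n by rewrite size_sort size_map size_enum_ord.
have memF i : (i < n)%N -> exists k, nth 0 F i = E k.
  move=> iN; have : nth 0 F i \in F by rewrite mem_nth ?szF.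
  by rewrite mem_sort => /mapP[k _ ->]; exists k.
have uF : uniq F by rewrite sort_uniq map_inj_uniq // enum_uniq.
have le_trans : transitive le by move=> y x z; exact: Order.POrderTheory.le_trans.
have sF : sorted le F by apply: sort_sorted => x y; exact: le_total.
exists (nth 0 F); split.
- by move=> i /memF[k ->].
- move=> i j iN jN ij; have [k ki] := memF i iN; have [l lj] := memF j jN.
  rewrite ki lj EE //; apply/eqP => kl; apply: ij; apply/eqP.
  by rewrite -(nth_uniq 0 _ _ uF) ?szF // ki lj kl.
- by move=> i /memF[k ->].
move=> i j ij jN; have iN : (i < n)%N by lia.
have [k ki] := memF i iN; have [l lj] := memF j jN.
have kl : k != l.
  apply/eqP => kl; have : nth 0 F i == nth 0 F j by rewrite ki lj kl.
  by rewrite nth_uniq ?szF // => /eqP; lia.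
have le_ij : le (nth 0 F i) (nth 0 F j).
  by apply: (sorted_ltn_nth le_trans 0 sF); rewrite ?inE ?szF.
rewrite /le in le_ij; rewrite lt_neqAle le_ij andbT; apply/eqP => eq_ij.
have r : is_root (E k - E l) by exists (E k), (E l); split=> //; exact: EE.
by apply: (lam0 _ r); rewrite dotBr -ki -lj eq_ij subrr.
Qed.

Section Cone.
Variables (f : nat -> 'cV[R]_n) (lam : 'cV[R]_n).
Hypothesis fs : forall i, (i < n)%N -> signed (f i).
Hypothesis ff : forall i j, (i < n)%N -> (j < n)%N -> i <> j -> dot (f i) (f j) = 0.
Hypothesis lam_ge0 : forall i, (i < n)%N -> 0 <= dot lam (f i).
Hypothesis lam_lt : forall i j, (i < j)%N -> (j < n)%N -> dot lam (f i) < dot lam (f j).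
Local Notation bet := (standard_root f).

Definition cone (x : 'cV[R]_n) : Prop :=
  exists c : 'I_n -> R, (forall k, 0 <= c k) /\ x = \sum_k c k *: bet k.

Lemma cone0 : cone 0.
Proof.
exists (fun=> 0); split=> //; rewrite big1 // => k _; exact: scale0r.
Qed.

Lemma coneD x y : cone x -> cone y -> cone (x + y).
Proof.
move=> [c [c0 ->]] [d [d0 ->]]; exists (fun k => c k + d k); split.
  by move=> k; exact: addr_ge0.
by rewrite -big_split; apply: eq_bigr => k _; rewrite scalerDl.
Qed.

Lemma cone_standard k : (k < n)%N -> cone (bet k).
Proof.
move=> kn; exists (fun i => (i == Ordinal kn)%:R); split; first by move=> i; exact: ler0n.
rewrite (bigD1 (Ordinal kn)) //= eqxx scale1r big1 ?addr0 // => i /negPf ->.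
exact: scale0r.
Qed.

Lemma cone_sub i j : (i <= j)%N -> (j < n)%N -> cone (f j - f i).
Proof.
elim: j => [|j IH]; first by rewrite leqn0 => /eqP -> _; rewrite subrr; exact: cone0.
rewrite leq_eqVlt => /predU1P[-> _|]; first by rewrite subrr; exact: cone0.
rewrite ltnS => ij jn; have -> : f j.+1 - f i = (f j.+1 - f j) + (f j - f i).
  by rewrite addrA subrK.
by apply: coneD; [exact: (@cone_standard j.+1)|apply: IH => //; exact: ltnW].
Qed.

Lemma cone_add i j : (i < j)%N -> (j < n)%N -> cone (f j + f i).
Proof.
move=> ij jn; have -> : f j + f i = (f j - f 1%N) + (f i - f 0) + bet 0.
  by rewrite /bet; apply/matrixP => k l; rewrite !mxE; ring.
apply: coneD; first by apply: coneD; apply: cone_sub; lia.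
by apply: cone_standard; lia.
Qed.

Lemma cone_root a : is_root a -> 0 < dot lam a -> cone a.
Proof.
have fsE x : signed x -> exists2 i, (i < n)%N & x = f i \/ x = - f i.
  move=> sx; have [||i xE] := @signed_complete (fun i : 'I_n => f i) _ _ x sx.
  - by move=> i; apply: fs.
  - by move=> i j ij; apply: ff => //; apply/eqP.
  by exists i.
move=> [x [y [sx sy xy ->]]].
have [i iN xE] := fsE x sx; have [j jN yE] := fsE y sy.
have ij : i <> j.
  move=> ij; rewrite -ij in yE; move: xy; case: xE yE => -> [->|->];
    rewrite ?dotNl ?dotNr ?opprK signed_norm; try exact: fs; move/eqP;
    by rewrite ?oppr_eq0 oner_eq0.
have {}ij : (i < j)%N \/ (j < i)%N by lia.
rewrite dotBr; case: xE yE => -> [->|->]; rewrite ?dotNr ?opprK.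
- by case: ij => ij; [have := lam_lt ij jN; lra|move=> _; apply: cone_sub => //; exact: ltnW].
- by move=> _; case: ij => ij; [rewrite addrC|]; exact: cone_add.
- by have := lam_ge0 iN; have := lam_ge0 jN; lra.
- rewrite [- f i + f j]addrC; case: ij => ij; last by have := lam_lt ij iN; lra.
  by move=> _; apply: cone_sub => //; exact: ltnW.
Qed.

End Cone.

Lemma standard_root_is_root (f : nat -> 'cV[R]_n) k :
  (forall i, (i < n)%N -> signed (f i)) ->
  (forall i j, (i < n)%N -> (j < n)%N -> i <> j -> dot (f i) (f j) = 0) ->
  (1 < n)%N -> (k < n)%N -> is_root (standard_root f k).
Proof.
move=> fs ff n1 kn; case: k kn => [|k] kn.
  exists (f 0), (- f 1%N); rewrite opprK dotNr ff ?oppr0 //; try lia.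
  by split=> //; [apply: fs; lia|apply: signedN; apply: fs].
by exists (f k.+1), (f k); split=> //; [apply: fs|apply: fs; lia|apply: ff; lia].
Qed.

Lemma span_roots (s : seq 'cV[R]_n) : (1 < n)%N ->
  (forall a, is_root a -> a \in <<s>>%VS) -> <<s>>%VS = fullv.
Proof.
move=> n1 hs; apply/eqP; rewrite eqEsubv subvf /=; apply/subvP => x _.
rewrite [x]cV_sum; apply: memv_suml => k _; apply: memvZ.
have [j jk] : exists j : 'I_n, k != j.
  have [k0|k0] := eqVneq (k : nat) 0%N.
    by exists (Ordinal n1); apply/eqP => /(congr1 val) /=; lia.
  by exists (Ordinal (ltnW n1)); apply/eqP => /(congr1 val) /=; lia.
have o : dot (e k) (e j) = 0 by rewrite dot_basis basisE (negPf jk).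
have -> : e k = 2^-1 *: ((e k - e j) + (e k - - e j)).
  by apply/matrixP => p q; rewrite !mxE; field.
apply: memvZ; apply: memvD; apply: hs.
  by exists (e k), (e j); split=> //; exact: signed_basis.
exists (e k), (- e j); rewrite dotNr o oppr0; split=> //; first exact: signed_basis.
by apply: signedN; exact: signed_basis.
Qed.

(** Both [s] and the standard roots generate the cone of the roots on which [lam] is positive. The
    elements of a free generating set span the extremal rays of its cone, so each element of [s] is
    proportional to a standard root; counting makes this a bijection. *)
Lemma simple_system_standard (s : seq 'cV[R]_n) : (1 < n)%N -> simple_system W s ->
  exists f ks,
  [/\ forall i, (i < n)%N -> signed (f i),
      forall i j, (i < n)%N -> (j < n)%N -> i <> j -> dot (f i) (f j) = 0,
      perm_eq ks (iota 0 n) &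
      map T s = [seq T (standard_root f k) | k <- ks]].
Proof.
move=> n1 [fr_s roots_s comb_s].
have [lam lam_s] := free_functional fr_s.
have comb a : is_root a -> exists c : 'I_(size s) -> R,
    [/\ a = \sum_i c i *: s`_i, dot lam a = \sum_i c i &
        (forall i, 0 <= c i) \/ (forall i, c i <= 0)].
  move=> ra; have [|c [aE c0]] := comb_s a.
    by split; [exact: root_neq0|exact: groupD_root].
  exists c; split=> //; rewrite aE dot_sumr; apply: eq_bigr => i _.
  by rewrite dotZr lam_s ?mulr1 // mem_nth.
have lam0 a : is_root a -> dot lam a <> 0.
  move=> ra la; have [c [aE lE c0]] := comb a ra.
  have ci i : c i = 0.
    move: (lE); rewrite la => /esym/eqP; case: c0 => c0.
      by rewrite psumr_eq0 // => /allP/(_ i (mem_index_enum i))/eqP.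
    rewrite -oppr_eq0 -sumrN psumr_eq0; last by move=> j _; rewrite oppr_ge0.
    by move=> /allP/(_ i (mem_index_enum i)); rewrite /= oppr_eq0 => /eqP.
  have := root_neq0 ra; rewrite aE big1 ?eqxx // => i _.
  by rewrite ci scale0r.
have pos a : is_root a -> 0 < dot lam a -> exists c : 'I_(size s) -> R,
    a = \sum_i c i *: s`_i /\ forall i, 0 <= c i.
  move=> ra la; have [c [aE lE [c0|c0]]] := comb a ra; first by exists c.
  by move: la; rewrite lE ltNge sumr_le0.
have [f [fs ff lam_ge0 lam_lt]] := sorted_frame lam0.
pose bet := standard_root f.
have rbet k : (k < n)%N -> is_root (bet k) by exact: standard_root_is_root.
have lbet k : (k < n)%N -> 0 < dot lam (bet k).
  case: k => [|k] kn; rewrite /bet /=.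
    have := lam_lt 0%N 1%N isT n1; have := lam_ge0 0%N (ltnW n1).
    by rewrite dotDr; lra.
  by rewrite dotBr; have := lam_lt k k.+1 (ltnSn k) kn; lra.
have fs' : free (in_tuple s) by [].
have coordE l (c : 'I_(size s) -> R) : coord (in_tuple s) l (\sum_i c i *: s`_i) = c l.
  exact: coord_sum_free.
have key a : a \in s -> exists k, (k < n)%N /\ exists2 d, d != 0 & bet k = d *: a.
  move=> as_; have la := lam_s _ as_.
  have [b rb [m m0 aE]] := groupD_root_vector (roots_s _ as_).
  wlog mpos : b m rb m0 aE / 0 < m.
    move=> wl; have [mpos|mneg] := ltP 0 m; first exact: (wl b m).
    apply: (wl (- b) (- m)); [exact: is_rootN|by rewrite oppr_eq0| |].
      by rewrite scaleNr scalerN opprK.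
    by rewrite oppr_gt0 lt_neqAle m0.
  have lb : 0 < dot lam b by move: la; rewrite aE dotZr => mb; rewrite -(pmulr_rgt0 _ mpos) mb ltr01.
  have [c [c0 bE]] := cone_root fs ff lam_ge0 lam_lt rb lb.
  have [d dE] := choice (fun k : 'I_n => pos _ (rbet k (ltn_ord k)) (lbet k (ltn_ord k))).
  have [l ls lE] := nthP 0 as_; pose lo := Ordinal ls.
  have aE' : a = s`_lo by rewrite /= lE.
  (* The sum is a coordinate of [b] with respect to [s], and it vanishes because [b] is a multiple
     of [a]. Its terms are nonnegative, so each of them vanishes; for any k with c k nonzero,
     [bet k] is then a multiple of [a]. *)
  have coefb i : i != lo -> \sum_k c k * d k i = 0.
    move=> il; have : coord (in_tuple s) i a = 0.
      by rewrite aE'; have := coord_free lo i fs'; rewrite /= => ->; rewrite eq_sym (negPf il).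
    have coefE : coord (in_tuple s) i b = \sum_k c k * d k i.
      rewrite bE linear_sum; apply: eq_bigr => k _; rewrite linearZ /= -/bet.
      by have [-> _] := dE k; rewrite coordE.
    by rewrite aE linearZ /= coefE => /eqP; rewrite mulf_eq0 (negPf m0) => /eqP.
  have [k ck] : exists k, c k != 0.
    apply: contrapT => h; have := root_neq0 rb; rewrite bE big1 ?eqxx // => k _.
    suff -> : c k = 0 by rewrite scale0r.
    by apply/eqP/negPn/negP => ck; apply: h; exists k.
  exists k; split=> //; exists (d k lo).
    apply/eqP => dk; have := root_neq0 (rbet k (ltn_ord k)); have [-> _] := dE k.
    rewrite big1 ?eqxx // => i _; have [->|il] := eqVneq i lo; first by rewrite dk scale0r.
    have /eqP := coefb i il; rewrite psumr_eq0 => [|j _]; last by rewrite mulr_ge0 //; case: (dE j).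
    move=> /allP/(_ k (mem_index_enum k)); rewrite /= mulf_eq0 (negPf ck) /= => /eqP ->.
    exact: scale0r.
  have [-> _] := dE k; rewrite (bigD1 lo) //= lE big1 ?addr0 // => i il.
  have /eqP := coefb i il; rewrite psumr_eq0 => [|j _]; last by rewrite mulr_ge0 //; case: (dE j).
  move=> /allP/(_ k (mem_index_enum k)); rewrite /= mulf_eq0 (negPf ck) /= => /eqP ->.
  exact: scale0r.
pose kap a := if pselect (exists k, (k < n)%N /\ exists2 d, d != 0 & bet k = d *: a) is left h
  then projT1 (cid h) else 0%N.
have kapP a : a \in s -> (kap a < n)%N /\ exists2 d, d != 0 & bet (kap a) = d *: a.
  by move=> /key h; rewrite /kap; case: pselect => // h'; case: cid.
(* The roots span the space and lie in the span of [s], so the injective map [kap] from [s] to the n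
   indices is onto. *)
have szs : size s = n.
  have full : <<s>>%VS = fullv.
    apply: span_roots => // a ra; have [c [-> _ _]] := comb a ra.
    by apply: memv_suml => i _; apply: memvZ; apply: memv_span; rewrite mem_nth.
  by have := fr_s; rewrite /free full dimvf /dim /= muln1 => /eqP.
exists f, [seq kap a | a <- s]; split=> //.
  have us : uniq [seq kap a | a <- s].
    rewrite map_inj_in_uniq ?free_uniq // => a b as_ bs kab.
    have [_ [d d0 dE]] := kapP a as_; have [_ [d' d0' dE']] := kapP b bs.
    move: dE'; rewrite -kab dE => E; have := congr1 (dot lam) E.
    rewrite !dotZr !lam_s // !mulr1 => dd; apply: (scalerI d0).
    by rewrite E dd.
  have sub : {subset [seq kap a | a <- s] <= iota 0 n}.
    by move=> k /mapP[a as_ ->]; rewrite mem_iota; case: (kapP a as_).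
  apply: uniq_perm => //; first exact: iota_uniq.
  by have [] := uniq_min_size us sub; rewrite ?size_map ?size_iota ?szs.
rewrite -map_comp; apply/eq_in_map => a as_ /=.
by have [_ [d d0 dE]] := kapP a as_; rewrite -/bet dE reflmxZ.
Qed.

(** [coxeter_element] allows any simple system in any order: [simple_system_standard] normalises the
    roots, [cycle_shape_prod] deals with the order, so no conjugation to a fixed Coxeter element is
    used. *)
Lemma coxeter_frame_exists N (g : 'M[R]_n) : n = N.+1 -> (0 < N)%N -> coxeter_element W g ->
  exists f0 v, coxeter_frame N g f0 v.
Proof.
move=> nN N0 [s ss gE]; have n1 : (1 < n)%N by lia.
have [f [ks [fs ff pks sE]]] := simple_system_standard n1 ss.
have Nn : (N < n)%N by lia.
rewrite nN in pks; have [c [u sh]] := cycle_shape_prod fs ff N0 Nn pks.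
exists c, (fun p => iter p (mulmx g) (u 0)); rewrite gE sE.
apply: frame_of_shape sh _ => //; move: pks; rewrite -nN => /perm_mem pks {sE}.
have {pks} : {subset ks <= iota 0 n} by move=> k; rewrite pks.
elim: ks => [|k ks IH] h; first by rewrite /= /mxprod big_nil; exact: groupD1.
rewrite prodT_cons; apply: groupDM.
  apply: groupD_root; apply: standard_root_is_root => //.
  by have := h k (mem_head _ _); rewrite mem_iota.
by apply: IH => j jk; apply: h; rewrite inE jk orbT.
Qed.

End FrameExistence.

Theorem theorem6p15 (R : realType) (n : nat) (g : 'M[R]_n) :
  (2 <= n)%N ->
  coxeter_element (groupD R n) g ->
  isomorphic (poset_group (groupD R n) g) (artinD n).
Proof.
case: n g => // N g N1 cg.
have [f0 [v fr]] := coxeter_frame_exists (erefl _) N1 cg.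
exact: frame_isomorphic (erefl _) fr.
Qed.
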